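(* Let $n\ge 3$, $s\in(0,1)$, and let $\Omega\subset\mathbb{R}^n$ be a domain. Let $u\in C(\mathbb{R}^n)\cap L^1_{\omega_s}(\mathbb{R}^n)$ be such that for some $\eta_0>0$, $\mathcal{K}^s u\ge \eta_0$ in $\Omega$ in the viscosity sense. Moreover, assume there exists $K>0$ such that for every $x\in\Omega$ at which $u$ can be touched from above by a $C^2$-function, $$\mathcal{I}^s u(x,y+z)+\mathcal{I}^s u(x,y-z)-2\,\mathcal{I}^s u(x,y)\le 2K|z|^{2s}\qquad\text{for a.e. } y,z\in\mathbb{R}^n.$$ Then there is $\gamma_0>0$, depending only on $n,s,K,\eta_0$, such that for all $A\in\mathcal{A}_2$, $$\mathcal{L}^s_Au\ge\gamma_0\,\|A\|_F^{2s}\quad\text{in }\Omega$$ in the viscosity sense. Moreover, $\gamma_0\to\gamma_0^{\rm loc}$ as $s\to1$, where $$\gamma_0^{\rm loc}=\frac{\sqrt3\,\eta_0^2}{8n(n-1)K}.$$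
   Context: $\mathcal{S}^n_+$ is the set of symmetric positive definite real $n\times n$ matrices, and $\|A\|_F=\sqrt{\operatorname{tr}(A^2)}$ for symmetric $A$. For $A\in\mathcal{S}^n_+$, $\lambda_1(A),\dots,\lambda_n(A)$ are its eigenvalues with multiplicity. Let $\sigma_1(\zeta)=\sum_i\zeta_i$, $\sigma_2(\zeta)=\sum_{i<j}\zeta_i\zeta_j$, $\Gamma_2=\{\zeta\in\mathbb{R}^n:\sigma_1(\zeta)>0,\ \sigma_2(\zeta)>0\}$ and $$\mathcal{A}_2=\Big\{A\in\mathcal{S}^n_+:\ \lambda_i(A)^2=\sum_{j\ne i}\zeta_j\ (i=1,\dots,n)\ \text{for some }\zeta\in\Gamma_2\text{ with }\sigma_2(\zeta)=1\Big\}.$$ $L^1_{\omega_s}(\mathbb{R}^n)$ is the set of $u$ with $\int_{\mathbb{R}^n}\frac{|u(y)|}{1+|y|^{n+2s}}\,dy<\infty$. Let $C_{n,s}=\dfrac{4^s s\,\Gamma(\frac{n+2s}{2})}{\pi^{n/2}\Gamma(1-s)}$ and $\delta u(x,y)=u(x+y)+u(x-y)-2u(x)$. Define $$\mathcal{L}^s_Au(x)=C_{n,s}\,\mathrm{P.V.}\int_{\mathbb{R}^n}\frac{u(x+Ay)-u(x)}{|y|^{n+2s}}\,dy=\frac{C_{n,s}}2\int_{\mathbb{R}^n}\frac{\delta u(x,Ay)}{|y|^{n+2s}}\,dy,$$ $$\mathcal{K}^su(x)=\inf_{A\in\mathcal{A}_2}\mathcal{L}^s_Au(x),\qquad \mathcal{I}^su(x,y)=(1-s)\int_{-\infty}^\infty\frac{\delta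 u(x,ry)}{|r|^{1+2s}}\,dr.$$ $u$ can be touched from above by a $C^2$-function at $x\in\Omega$ if there are an open neighborhood $N\subset\Omega$ of $x$ and $\psi\in C^2(N)$ with $\psi(x)=u(x)$ and $\psi(y)>u(y)$ for all $y\in N\setminus\{x\}$. For $\mathcal{F}=\mathcal{K}^s$ or $\mathcal{F}=\mathcal{L}^s_A$ and a constant $c$, $\mathcal{F}u\ge c$ in $\Omega$ in the viscosity sense means: for all such $x,N,\psi$, the function $v$ equal to $\psi$ in $N$ and to $u$ in $\mathbb{R}^n\setminus N$ satisfies $\mathcal{F}v(x)\ge c$. (It is known that then $\mathcal{F}u(x)\ge c$ holds classically at every such $x$.) Under the hypotheses, the values of $\mathcal{I}^su(x,\cdot)$ in the second-difference inequality are finite for a.e. $y,z$. *)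

(* Defs.v *)
From HB Require Import structures.
From mathcomp Require Import all_boot all_order all_algebra.
From mathcomp Require Import all_classical all_reals all_analysis.

Set Implicit Arguments.
Unset Strict Implicit.
Unset Printing Implicit Defensive.

Import Order.TTheory GRing.Theory Num.Theory.
Import numFieldNormedType.Exports.

Local Open Scope classical_set_scope.
Local Open Scope ring_scope.

(** * Lebesgue measure on R^n

The library equips tuples with the product sigma-algebra but has no
n-dimensional Lebesgue measure, which is built here as the n-fold product of
[lebesgue_measure], transported along [(x, t) |-> x :: t]. Its value on boxes
is given by [leb_box]. *)

Section leb_step.
Context {R : realType} (n : nat).
Let T : measurableType _ := measurableTypeR R.
Variable mu : {sigma_finite_measure set (n.-tuple T) -> \bar R}.

Definition cons_pair (p : T * n.-tuple T) : n.+1.-tuple T :=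
  [tuple of p.1 :: p.2].

Lemma measurable_cons_pair : measurable_fun setT cons_pair.
Proof. exact: (measurable_cons measurable_fst measurable_snd). Qed.

Definition leb_step : set (n.+1.-tuple T) -> \bar R :=
  pushforward ((lebesgue_measure : {measure set T -> \bar R}) \x mu)%E cons_pair.

Let lm : {measure set (T * n.-tuple T)%type -> \bar R} :=
  ((lebesgue_measure : {measure set T -> \bar R}) \x mu)%E.

Let leb_stepE A : leb_step A = lm (cons_pair @^-1` A).
Proof. by []. Qed.

Let leb_step0 : leb_step set0 = 0%E.
Proof. by rewrite leb_stepE preimage_set0 measure0. Qed.

Let leb_step_ge0 A : (0 <= leb_step A)%E.
Proof. by rewrite leb_stepE. Qed.

Let leb_step_sigma_additive : semi_sigma_additive leb_step.
Proof.
move=> F mF tF mUF; rewrite leb_stepE preimage_bigcup.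
have mp (B : set (n.+1.-tuple T)) : measurable B ->
    measurable (cons_pair @^-1` B).
  by move=> mB; rewrite -[X in measurable X]setTI; exact: measurable_cons_pair.
apply: (@measure_semi_sigma_additive _ _ _ lm).
- by move=> i; exact: (mp _ (mF i)).
- apply/trivIsetP => /= i j _ _ ij; rewrite -preimage_setI.
  by move/trivIsetP : tF => /(_ _ _ _ _ ij) ->//; rewrite preimage_set0.
- by rewrite -preimage_bigcup; exact: mp.
Qed.

HB.instance Definition _ := isMeasure.Build _ _ _ leb_step
  leb_step0 leb_step_ge0 leb_step_sigma_additive.

Let leb_step_sigma_finite : sigma_finite setT leb_step.
Proof.
have /sigma_finiteP[F [FT ndF Foo]] :=
  sigma_finiteT (lebesgue_measure : {sigma_finite_measure set T -> \bar R}).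
have /sigma_finiteP[G [GT ndG Goo]] := sigma_finiteT mu.
pose uncons (t : n.+1.-tuple T) : T * n.-tuple T :=
  (tnth t ord0, [tuple of behead t]).
have consK p : uncons (cons_pair p) = p.
  by case: p => x t; congr (_, _); apply/val_inj.
have muncons : measurable_fun setT uncons.
  apply/measurable_fun_pairP; split.
    exact: (@measurable_tnth _ T).
  exact: (@measurable_behead _ T).
exists (fun i => uncons @^-1` (F i `*` G i)).
  rewrite -preimage_bigcup (_ : \bigcup_i _ = setT) ?preimage_setT//.
  rewrite -setXTT FT GT predeqE => -[x y]; split.
    by move=> [k _ []/= ? ?]; split; exists k.
  move=> [/= [k _ Fkx] [l _ Gly]]; exists (maxn k l) => //; split.
  - by move: x Fkx; exact/subsetPset/ndF/leq_maxl.
  - by move: y Gly; exact/subsetPset/ndG/leq_maxr.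
move=> i; have [mF Fi] := Foo i; have [mG Gi] := Goo i; split.
  rewrite -[X in measurable X]setTI; apply: muncons => //.
  exact: measurableX.
rewrite leb_stepE (_ : _ @^-1` _ = F i `*` G i); last first.
  by rewrite predeqE => p; rewrite /preimage/mkset consK.
by rewrite /lm/= product_measure1E// lte_mul_pinfty// ge0_fin_numE.
Qed.

HB.instance Definition _ := Measure_isSigmaFinite.Build _ _ _ leb_step
  leb_step_sigma_finite.

End leb_step.

Fixpoint leb (R : realType) (n : nat) :
    {sigma_finite_measure set (n.-tuple (measurableTypeR R)) -> \bar R} :=
  match n with
  | 0 => \d_[tuple]
  | k.+1 => leb_step (leb R k)
  end.

Lemma leb_box (R : realType) n (B : 'I_n -> set (measurableTypeR R)) :
  (forall i, measurable (B i)) ->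
  leb R n [set t | forall i, B i (tnth t i)]
  = (\prod_(i < n) lebesgue_measure (B i))%E.
Proof.
elim: n B => [|n IH] B mB /=.
  by rewrite big_ord0 diracE mem_set//= => -[].
rewrite big_ord_recl -IH//.
set C := [set t : n.-tuple _ | _].
have mC : measurable C.
  rewrite [X in measurable X](_ : _ = \bigcap_(i in [set: 'I_n])
      ((@tnth _ (measurableTypeR R) ^~ i) @^-1` (B (lift ord0 i)))); last first.
    by apply/seteqP; split=> t /= h; [move=> i _|move=> i]; exact: h.
  apply: fin_bigcap_measurable => // i _.
  by rewrite -[X in measurable X]setTI; exact: measurable_tnth.
rewrite -product_measure1E// /leb_step /pushforward; congr (_ _).
apply/seteqP; split=> -[x t] /=.
  move=> h; split; first exact: (h ord0).
  by move=> i; have := h (lift ord0 i); rewrite tnthS.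
move=> [h0 h] i; case: (unliftP ord0 i) => [j ->|->]; last exact: h0.
by rewrite tnthS; exact: h.
Qed.

(** Points of R^n are row vectors, on which the library has a topology and
directional derivatives; integrals over R^n are taken over coordinate tuples.
The library norm on ['rV_n] is the sup norm, whence [enorm]. *)

Section nonlocal.
Context {R : realType}.
Implicit Types (s c : R) (n : nat).

Definition vec n (t : n.-tuple (measurableTypeR R)) : 'rV[R]_n :=
  \row_i (tnth t i : R).

Definition enorm n (y : 'rV[R]_n) : R := Num.sqrt (\sum_i y 0 i ^+ 2).

(** * The set A_2 *)

Definition spd n (A : 'M[R]_n) : Prop :=
  A^T = A /\ forall v : 'rV[R]_n, v != 0 -> 0 < (v *m A *m v^T) 0 0.

Definition frob n (A : 'M[R]_n) : R := Num.sqrt (\tr (A *m A)).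

Definition sigma1 n (zeta : 'rV[R]_n) : R := \sum_i zeta 0 i.

Definition sigma2 n (zeta : 'rV[R]_n) : R :=
  \sum_(i < n) \sum_(j < n | (i < j)%N) zeta 0 i * zeta 0 j.

Definition Gamma2 n : set 'rV[R]_n :=
  [set zeta | 0 < sigma1 zeta /\ 0 < sigma2 zeta].

Definition eigenvalues_mult n (A : 'M[R]_n) (lambda : 'rV[R]_n) : Prop :=
  char_poly A = \prod_(i < n) ('X - (lambda 0 i)%:P).

(** The enumeration of the eigenvalues is immaterial, since [Gamma2] and
[sigma2] are invariant under permutations of the coordinates. *)
Definition A2 n : set 'M[R]_n :=
  [set A | spd A /\ exists lambda : 'rV[R]_n, eigenvalues_mult A lambda /\
    exists zeta : 'rV[R]_n, [/\ Gamma2 zeta, sigma2 zeta = 1 &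
      forall i, lambda 0 i ^+ 2 = \sum_(j < n | j != i) zeta 0 j]].

(** * Nonlocal operators *)

Definition Gamma_fun (z : R) : R :=
  fine (\int[lebesgue_measure]_(t in `]0%R, +oo[) (t `^ (z - 1) * expR (- t))%:E).

Definition C_ns n s : R :=
  4 `^ s * s * Gamma_fun ((n%:R + 2 * s) / 2) /
  (pi `^ (n%:R / 2) * Gamma_fun (1 - s)).

Definition L1_omega n s (u : 'rV[R]_n -> R) : Prop :=
  (leb R n).-integrable setT
    (fun t => (u (vec t) / (1 + enorm (vec t) `^ (n%:R + 2 * s)))%:E).

Definition delta n (u : 'rV[R]_n -> R) (x y : 'rV[R]_n) : R :=
  u (x + y) + u (x - y) - 2 * u x.

(** In row-vector notation, the vector [A y] is [y *m A^T]. The operators take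
extended real values: a nonlocal integral may diverge, and so may the infimum
defining [K_op]. *)
Definition L_op n s (A : 'M[R]_n) (u : 'rV[R]_n -> R) (x : 'rV[R]_n) : \bar R :=
  ((C_ns n s / 2)%:E * \int[leb R n]_t
    (delta u x (vec t *m A^T) / enorm (vec t) `^ (n%:R + 2 * s))%:E)%E.

Definition K_op n s (u : 'rV[R]_n -> R) (x : 'rV[R]_n) : \bar R :=
  ereal_inf [set L_op s A u x | A in @A2 n].

Definition I_op n s (u : 'rV[R]_n -> R) (x y : 'rV[R]_n) : \bar R :=
  ((1 - s)%:E * \int[lebesgue_measure]_r
    (delta u x ((r : R) *: y) / `|r : R| `^ (1 + 2 * s))%:E)%E.

(** * Viscosity solutions *)

Definition C1_on n (N : set 'rV[R]_n) (f : 'rV[R]_n -> R) : Prop :=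
  {in N, continuous f} /\
  forall i : 'I_n, (forall x, N x -> derivable f x (delta_mx 0 i)) /\
                   {in N, continuous ('D_(delta_mx 0 i) f)}.

Definition C2_on n (N : set 'rV[R]_n) (f : 'rV[R]_n -> R) : Prop :=
  C1_on N f /\ forall i : 'I_n, C1_on N ('D_(delta_mx 0 i) f).

Definition touches_above n (Omega : set 'rV[R]_n) (u : 'rV[R]_n -> R)
    (x : 'rV[R]_n) (N : set 'rV[R]_n) (psi : 'rV[R]_n -> R) : Prop :=
  [/\ open N, N x & N `<=` Omega] /\
  [/\ C2_on N psi, psi x = u x & forall y, N y -> y != x -> u y < psi y].

Definition touchable_above n (Omega : set 'rV[R]_n) (u : 'rV[R]_n -> R)
    (x : 'rV[R]_n) : Prop :=
  exists N psi, touches_above Omega u x N psi.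

(** [patch u N psi] is [psi] on [N] and [u] elsewhere. *)
Definition visc_ge n (F : ('rV[R]_n -> R) -> 'rV[R]_n -> \bar R)
    (Omega : set 'rV[R]_n) (u : 'rV[R]_n -> R) c : Prop :=
  forall x N psi, Omega x -> touches_above Omega u x N psi ->
    (c%:E <= F (patch u N psi) x)%E.

Definition second_difference_bound n s K (Omega : set 'rV[R]_n)
    (u : 'rV[R]_n -> R) : Prop :=
  forall x, Omega x -> touchable_above Omega u x ->
    {ae (leb R n \x leb R n)%E, forall p, let y := vec p.1 in let z := vec p.2 in
      (I_op s u x (y + z)%R + I_op s u x (y - z)%R - 2%:E * I_op s u x y
         <= (2 * K * enorm z `^ (2 * s))%:E)%E}.

Definition domain n (Omega : set 'rV[R]_n) : Prop :=
  [/\ Omega !=set0, open Omega & connected Omega].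

Definition gamma_loc n K eta0 : R :=
  Num.sqrt 3 * eta0 ^+ 2 / (8 * n%:R * (n%:R - 1) * K).

End nonlocal.

(* Main.v *)
(** At a point [x] touched from above the inequality [K^s u >= eta0] holds
classically: replace [u] by the test function on balls shrinking to [x] and use
Fatou's lemma. Average the second-difference inequality at [y = A g],
[z = b h] against independent Gaussian vectors [g], [h]. Integration in polar
coordinates turns the Gaussian average of [I^s u(x, A g)] into a multiple of
[L_A u(x)], and [A g + b h], [A g - b h] have the law of [B g] with
[B^2 = A^2 + b^2], whence
[L_B u(x) - L_A u(x) <= C b^(2 s)] with [C] proportional to [K]. Passing from
[A] to [B] adds [t / (n - 1)] to every [zeta_j], where [t = b^2], so a multiple
of [B] is in A_2 and, by homogeneity,
[L_B u(x) >= eta0 (t |A|^2 / (n - 1))^(s / 2)]. Optimise in [t]; as [s -> 1]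
the resulting constant tends to a limit larger than [gamma_loc], so its minimum
with [gamma_loc] does what is required. *)

Require Import Defs.
From HB Require Import structures.
From mathcomp Require Import all_boot all_order all_algebra.
From mathcomp Require Import all_classical all_reals all_analysis.
From mathcomp Require Import measurable_realfun ring lra.

Set Implicit Arguments.
Unset Strict Implicit.
Unset Printing Implicit Defensive.

Import Order.TTheory GRing.Theory Num.Theory.
Import numFieldNormedType.Exports.

Local Open Scope classical_set_scope.
Local Open Scope ring_scope.

(** * Measurability in coordinates *)

Section coordinates.
Context {R : realType}.
Implicit Types n : nat.

(** Two obstacles shape the development. The first is the change of variables by a general matrix,
    which is done without determinants: it is reduced to shears [(g, h) |-> (g, h + g X)] of pairs
    of points, which preserve Lebesgue measure because they translate [h] for each fixed [g]. The
    same device gives the law of [A g + b h]: a rotation of pairs whose cosine and sine are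
    commuting symmetric matrices is a product of three shears and preserves the product Gaussian.
    The second is [oo - oo]. The values of [I^s u] are split into positive and negative parts and
    the negative ones are moved across the inequality, so that only nonnegative functions are
    averaged. Subtraction comes last, once the classical inequality has made the integrals defining
    [L_A u(x)] and [L_B u(x)] finite. As for the constants, the optimum in [t] behaves like
    [eta0^2 / (4 n (n - 1) K)] as [s -> 1], because [(1 - s) Gamma(1 - s) -> 1]. Since [gamma_loc]
    is only [sqrt 3 / 2] times that value, a crude lower bound for Gamma leaves enough room. *)

Definition unvec n (v : 'rV[R]_n) : n.-tuple (measurableTypeR R) :=
  [tuple (v 0 i : measurableTypeR R) | i < n].

Lemma unvecK n : cancel (@unvec n) (@vec R n).
Proof. by move=> v; apply/rowP => i; rewrite mxE tnth_mktuple. Qed.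

Lemma vecK n : cancel (@vec R n) (@unvec n).
Proof.
by move=> t; apply: eq_from_tnth => i; rewrite tnth_mktuple mxE.
Qed.

Section measurable_coordinates.
Context d (D : measurableType d).

(** Measurability is tested on coordinate tuples: by coordinates for row-valued maps, and through
    [f \o vec] for functions of row vectors. *)
Definition measurable_row n (G : D -> 'rV[R]_n) :=
  forall i, measurable_fun [set: D] (fun p => G p 0 i : measurableTypeR R).

Lemma measurable_row_unvec n (G : D -> 'rV[R]_n) :
  measurable_row G -> measurable_fun [set: D] (@unvec n \o G).
Proof.
move=> mG; apply/measurable_fun_tnthP => i.
rewrite (_ : _ \o _ = fun p => G p 0 i)//.
by apply/funext => p /=; rewrite tnth_mktuple.
Qed.

Lemma measurable_comp_row n d' (E : measurableType d') (f : 'rV[R]_n -> E)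
    (G : D -> 'rV[R]_n) :
  measurable_fun setT (f \o @vec R n) -> measurable_row G ->
  measurable_fun setT (f \o G).
Proof.
move=> mf mG.
rewrite (_ : f \o G = (f \o @vec R n) \o (@unvec n \o G)); last first.
  by apply/funext => p /=; rewrite unvecK.
by apply: measurableT_comp => //; exact: measurable_row_unvec.
Qed.

Lemma measurable_row_cst n (v : 'rV[R]_n) : measurable_row (fun=> v).
Proof. by move=> i; exact: measurable_cst. Qed.

Lemma measurable_rowD n (G H : D -> 'rV[R]_n) :
  measurable_row G -> measurable_row H -> measurable_row (fun p => G p + H p).
Proof.
move=> mG mH i; under eq_fun do rewrite mxE.
by apply: measurable_funD; [exact: mG|exact: mH].
Qed.

Lemma measurable_rowN n (G : D -> 'rV[R]_n) :
  measurable_row G -> measurable_row (fun p => - G p).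
Proof.
move=> mG i; under eq_fun do rewrite mxE.
by apply: measurableT_comp => //; exact: mG.
Qed.

Lemma measurable_rowZ n (k : D -> R) (G : D -> 'rV[R]_n) :
  measurable_fun setT k ->
  measurable_row G -> measurable_row (fun p => k p *: G p).
Proof.
move=> mk mG i; under eq_fun do rewrite mxE.
by apply: measurable_funM; [exact: mk|exact: mG].
Qed.

Lemma measurable_rowM n m (A : 'M[R]_(n, m)) (G : D -> 'rV[R]_n) :
  measurable_row G -> measurable_row (fun p => G p *m A).
Proof.
move=> mG i; under eq_fun do rewrite mxE.
apply: measurable_sum => j.
by apply: measurable_funM; [exact: mG|exact: measurable_cst].
Qed.

End measurable_coordinates.

Lemma measurable_row_vec n : measurable_row (@vec R n).
Proof. by move=> i; under eq_fun do rewrite mxE; exact: measurable_tnth. Qed.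

Lemma measurable_row_vec_comp d (D : measurableType d) n
    (f : D -> n.-tuple (measurableTypeR R)) :
  measurable_fun setT f -> measurable_row (@vec R n \o f).
Proof.
move=> mf i; under eq_fun do rewrite /= mxE.
by apply: (measurableT_comp (@measurable_tnth _ _ _ _)).
Qed.

Lemma measurable_enorm n : measurable_fun setT (@enorm R n \o @vec R n).
Proof.
apply: (@measurableT_comp _ _ _ _ _ _ (@Num.sqrt R)) => //.
  exact: continuous_measurable_fun (@sqrt_continuous R).
apply: measurable_sum => j; apply: measurable_funX.
exact: measurable_row_vec.
Qed.

(* Rational sup-norm balls form a countable base of the topology of ['rV_n]. *)
Lemma measurable_open_row n (N : set 'rV[R]_n) :
  open N -> measurable (@vec R n @^-1` N).
Proof.
move=> oN.
pose q2r (q : 'rV[rat]_n) : 'rV[R]_n := map_mx ratr q.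
pose B (p : 'rV[rat]_n * nat) : set (n.-tuple (measurableTypeR R)) :=
  if `[< ball (q2r p.1) (p.2.+1%:R^-1) `<=` N >] then
    @vec R n @^-1` (ball (q2r p.1) (p.2.+1%:R^-1)) else set0.
rewrite (_ : _ @^-1` _ = \bigcup_p B p); last first.
  apply/seteqP; split => [t /= Nt|t [p _]]; last first.
    by rewrite /B; case: asboolP => // BN ?; exact: BN.
  have /nbhs_ballP[e /= e0 eN] : nbhs (vec t) N by exact: open_nbhs_nbhs.
  have [k ke] : exists k : nat, k.+1%:R^-1 < e / 2.
    have [k] := near_infty_natSinv_lt (PosNum (divr_gt0 e0 (ltr0n R 2))).
    by move=> _ /(_ k (leqnn k)); exists k.
  have kp : 0 < k.+1%:R^-1 :> R by rewrite invr_gt0.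
  have /choice[q qP] (i : 'I_n) : exists q : rat,
      vec t 0 i - k.+1%:R^-1 < ratr q < vec t 0 i + k.+1%:R^-1.
    have [|q] := @rat_in_itvoo R (vec t 0 i - k.+1%:R^-1) (vec t 0 i + k.+1%:R^-1).
      by rewrite ltrD2l gt0_cp.
    by rewrite in_itv /= => qP; exists q.
  have tq : ball (q2r (\row_i q i)) k.+1%:R^-1 (vec t).
    split; [exact: kp|move=> i j; rewrite !mxE].
    have /andP[q1 q2] := qP j; move: q1 q2; rewrite !mxE => q1 q2.
    by rewrite -ball_normE /= ltr_distl q1 q2.
  exists ((\row_i q i), k) => //; rewrite /B /= asboolT//.
  move=> z qz; apply: eN.
  rewrite (splitr e); apply: ball_triangle (le_ball (ltW ke) qz).
  apply: (le_ball (ltW ke)); exact: ball_sym.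
apply: countable_bigcupT_measurable => [|p]; first exact: countableP.
rewrite /B; case: asboolP => // _.
rewrite (_ : _ @^-1` _ = \bigcap_(i in [set: 'I_n])
   ((fun t => vec t 0 i) @^-1` (ball (q2r p.1 0 i) p.2.+1%:R^-1))); last first.
  apply/seteqP; split => t /=; first by move=> [_ h] i _; exact: h.
  move=> h; split; first by rewrite invr_gt0.
  by move=> i j; rewrite ord1; exact: h.
apply: fin_bigcap_measurable => // i _.
rewrite -[X in measurable X]setTI; apply: measurable_row_vec => //.
exact: measurable_ball.
Qed.

Lemma measurable_continuous_row n (f : 'rV[R]_n -> R) :
  continuous f -> measurable_fun setT (f \o @vec R n).
Proof.
move=> /continuousP cf; apply: (measurability _ (RGenOpens.measurableE R)) => _ [_ [a [b ->]] <-].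
by rewrite setTI comp_preimage; apply: measurable_open_row; apply: cf; exact: interval_open.
Qed.

End coordinates.

(** * Linear changes of variables *)

(** Only the values of [nu] on measurable sets have to match, so that a rescaled Lebesgue measure,
    or [leb] itself, can play the part of the image measure. *)
Lemma ge0_integral_image d1 d2 (X : measurableType d1) (Y : measurableType d2)
    (R : realType) (mu : {measure set X -> \bar R})
    (nu : {measure set Y -> \bar R}) (phi : X -> Y) (f : Y -> \bar R) :
  measurable_fun setT phi ->
  (forall A, measurable A -> nu A = mu (phi @^-1` A)) ->
  measurable_fun setT f -> (forall y, 0 <= f y)%E ->
  (\int[mu]_x f (phi x) = \int[nu]_y f y)%E.
Proof.
move=> mphi nuE mf f0; transitivity (\int[pushforward mu phi]_y f y)%E.
  by have /= -> := ge0_integral_pushforward mphi mu measurableT mf (fun y _ => f0 y).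
by apply: eq_measure_integral => A mA _ /=; rewrite nuE.
Qed.

Section affine_line.
Context {R : realType}.
Let mu : {measure set (measurableTypeR R) -> \bar R} := lebesgue_measure.
Local Open Scope ereal_scope.

Lemma measurable_affine (c a : R) :
  measurable_fun setT (fun x : measurableTypeR R => c * x + a : measurableTypeR R)%R.
Proof. by apply: measurable_funD => //; apply: measurable_funM. Qed.

(** Uniqueness of Lebesgue measure: the scaled image measure gives every half-open interval its
    length. *)
Lemma lebesgue_measure_affine (c a : R) (A : set (measurableTypeR R)) :
  (0 < c)%R -> measurable A ->
  lebesgue_measure A =
  c%:E * lebesgue_measure ((fun x : measurableTypeR R => c * x + a)%R @^-1` A).
Proof.
move=> c0 mA.
pose nu : {measure set (measurableTypeR R) -> \bar R} :=
  measure_function_pushforward__canonical__measure_function_Measure mu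
    (measurable_affine c a).
transitivity (mscale (NngNum (ltW c0)) nu A); last by [].
apply: lebesgue_measure_unique mA => //= _ [[p q]] _ <-.
rewrite /mscale /nu /pushforward /=.
have -> : pushforward lebesgue_measure
    (fun x : measurableTypeR R => (c * x + a)%R : measurableTypeR R) `]p, q] =
    lebesgue_measure `]((p - a) / c)%R, ((q - a) / c)%R]%classic.
  congr lebesgue_measure; apply/seteqP; split => x /=; rewrite !in_itv /=.
    by rewrite ltr_pdivrMr// ler_pdivlMr// ltrBlDr lerBrDr mulrC.
  by rewrite ltr_pdivrMr// ler_pdivlMr// ltrBlDr lerBrDr mulrC.
rewrite !lebesgue_measure_itv /= !lte_fin ltr_pM2r ?invr_gt0// ltrD2r.
case: ifPn => _; rewrite ?mule0// -EFinD -EFinM; congr EFin.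
by rewrite -mulrBl mulrCA divff ?gt_eqF// mulr1 opprB addrA subrK.
Qed.

Lemma ge0_integral_affine_gt0 (c a : R) (f : R -> \bar R) : (0 < c)%R ->
  measurable_fun [set: measurableTypeR R] f -> (forall x, 0 <= f x) ->
  \int[lebesgue_measure]_x f (c * x + a)%R =
  c^-1%:E * \int[lebesgue_measure]_x f x.
Proof.
move=> c0 mf f0.
have ci0 : (0 <= c^-1)%R by rewrite invr_ge0 ltW.
rewrite -[RHS](ge0_integral_mscale mu measurableT (NngNum ci0) mf)//.
apply: (ge0_integral_image (measurable_affine c a)) => // A mA.
transitivity (c^-1%:E * lebesgue_measure A); first by [].
rewrite (lebesgue_measure_affine a c0 mA).
by rewrite muleA -EFinM mulVf ?gt_eqF// mul1e.
Qed.

Lemma ge0_integral_opp (f : R -> \bar R) :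
  measurable_fun [set: measurableTypeR R] f -> (forall x, 0 <= f x) ->
  \int[lebesgue_measure]_x f (- x)%R = \int[lebesgue_measure]_x f x.
Proof.
move=> mf f0.
apply: (@ge0_integral_image _ _ (measurableTypeR R) (measurableTypeR R) R mu mu -%R) => // A mA.
by rewrite -[LHS](lebesgue_measureN mA).
Qed.

Lemma ge0_integral_affine (c a : R) (f : R -> \bar R) : (c != 0)%R ->
  measurable_fun [set: measurableTypeR R] f -> (forall x, 0 <= f x) ->
  \int[lebesgue_measure]_x f (c * x + a)%R =
  `|c|^-1%:E * \int[lebesgue_measure]_x f x.
Proof.
move=> cn0 mf f0; have [c0|c0|c0] := ltgtP c 0%R; last by rewrite c0 eqxx in cn0.
  rewrite ltr0_norm// -(ge0_integral_affine_gt0 a) ?oppr_gt0//.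
  rewrite -[LHS]ge0_integral_opp//.
  - by apply: eq_integral => x _; rewrite mulrN mulNr.
  - apply: measurableT_comp => //; exact: (measurable_affine c a).
by rewrite gtr0_norm// -(ge0_integral_affine_gt0 a).
Qed.

End affine_line.

Section leb_affine.
Context {R : realType}.
Local Open Scope ereal_scope.

Lemma ge0_integral_lebS n (f : n.+1.-tuple (measurableTypeR R) -> \bar R) :
  measurable_fun setT f -> (forall t, 0 <= f t) ->
  \int[leb R n.+1]_t f t =
  \int[lebesgue_measure]_x \int[leb R n]_t f (cons_pair (x, t)).
Proof.
move=> mf f0.
have mcp : measurable_fun setT (@cons_pair R n) by exact: measurable_cons_pair.
pose lm : {measure set (measurableTypeR R * n.-tuple (measurableTypeR R)) -> \bar R} :=
  ((lebesgue_measure : {measure set (measurableTypeR R) -> \bar R}) \x leb R n)%E.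
rewrite -(@ge0_integral_image _ _ _ _ R lm _ (@cons_pair R n))//.
rewrite fubini_tonelli1//.
exact: measurableT_comp.
Qed.

(** Induction on the dimension: Tonelli splits off the first coordinate, where the map is affine on
    the line. The translations obtained here are what makes shears measure-preserving. *)
Lemma ge0_integral_leb_affine n (c : R) (a : 'rV[R]_n) (f : 'rV[R]_n -> \bar R) :
  (c != 0)%R -> measurable_fun setT (f \o @vec R n) -> (forall x, 0 <= f x) ->
  \int[leb R n]_t f (c *: vec t + a)%R =
  (`|c| ^- n)%:E * \int[leb R n]_t f (vec t).
Proof.
move=> c0; elim: n a f => [|n IH] a f mf f0.
  rewrite expr0 invr1 mul1e; apply: eq_integral => t _; congr f.
  by apply/rowP => -[].
pose cons (x : R) (v : 'rV[R]_n) : 'rV[R]_n.+1 :=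
  \row_i (oapp (fun j => v ord0 j) x (unlift ord0 i))%R.
have vecS x (t : n.-tuple (measurableTypeR R)) :
    vec (cons_pair (x, t)) = cons x (vec t).
  apply/rowP => i; rewrite !mxE; case: unliftP => [j ->|->] //=.
  by rewrite tnthS mxE.
have mcons d (D : measurableType d) (g : D -> R) (G : D -> 'rV[R]_n) :
    measurable_fun setT g -> measurable_row G ->
    measurable_row (fun p => cons (g p) (G p)).
  move=> mg mG i; under eq_fun do rewrite mxE.
  by case: unliftP => [j _|_] /=; [exact: mG|exact: mg].
have mvec := @measurable_row_vec R n.
have maf : measurable_fun setT (fun t => f (c *: vec t + a)%R).
  apply: (measurable_comp_row mf); apply: measurable_rowD.
    by apply: measurable_rowZ => //; exact: measurable_row_vec.
  exact: measurable_row_cst.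
rewrite ge0_integral_lebS// ge0_integral_lebS//.
have consE x t : (c *: vec (cons_pair (x, t)) + a)%R =
    cons (c * x + a ord0 ord0)%R (c *: vec t + \row_j a ord0 (lift ord0 j))%R.
  apply/rowP => i; rewrite vecS !mxE; case: unliftP => [j ->|->] //=.
  by rewrite !mxE.
under eq_integral => x _.
  under eq_integral do rewrite consE.
  rewrite (IH _ (fun v => f (cons _ v)))//; last first.
    by apply: (measurable_comp_row mf); apply: mcons => //.
  over.
have mint : measurable_fun [set: measurableTypeR R]
    (fun x : measurableTypeR R => \int[leb R n]_t f (cons x (vec t))).
  apply: (measurable_fun_fubini_tonelli_F
    (fun p : measurableTypeR R * n.-tuple (measurableTypeR R) => f (cons p.1 (vec p.2)))) => //.
  apply: (measurable_comp_row mf); apply: mcons => //.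
  exact: measurable_row_vec_comp.
rewrite ge0_integralZl//; last 2 first.
- exact: (measurableT_comp mint (measurable_affine c (a ord0 ord0))).
- by move=> x _; apply: integral_ge0.
rewrite (ge0_integral_affine (a ord0 ord0) c0 mint); last first.
  by move=> x; exact: integral_ge0.
rewrite muleA -EFinM -invfM -exprSr; congr (_ * _).
by apply: eq_integral => x _; apply: eq_integral => t _; rewrite vecS.
Qed.

End leb_affine.

(** * Shears and rotations of pairs of points *)

Section shears.
Context {R : realType} (n : nat).
Implicit Types (F : 'rV[R]_n -> 'rV[R]_n -> \bar R) (X Y Z : 'M[R]_n).

Definition measurable_row2 F := measurable_fun setT
  (fun p : n.-tuple (measurableTypeR R) * n.-tuple (measurableTypeR R) =>
     F (vec p.1) (vec p.2)).

Lemma measurable_comp_row2 d (D : measurableType d) F (G H : D -> 'rV[R]_n) :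
  measurable_row2 F -> measurable_row G -> measurable_row H ->
  measurable_fun setT (fun p => F (G p) (H p)).
Proof.
move=> mF mG mH.
rewrite (_ : (fun p => _) =
    (fun p : n.-tuple (measurableTypeR R) * n.-tuple (measurableTypeR R) =>
       F (vec p.1) (vec p.2)) \o (fun p => (unvec (G p), unvec (H p)))); last first.
  by apply/funext => p /=; rewrite !unvecK.
apply: measurableT_comp => //; apply: measurable_fun_pair.
  exact: (measurable_row_unvec mG).
exact: (measurable_row_unvec mH).
Qed.

Definition double_integral F : \bar R :=
  (\int[leb R n]_g \int[leb R n]_h F (vec g) (vec h))%E.

Lemma measurable_row_vec1 : measurable_row
  (fun p : n.-tuple (measurableTypeR R) * n.-tuple (measurableTypeR R) => vec p.1).
Proof. exact: measurable_row_vec_comp. Qed.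

Lemma measurable_row_vec2 : measurable_row
  (fun p : n.-tuple (measurableTypeR R) * n.-tuple (measurableTypeR R) => vec p.2).
Proof. exact: measurable_row_vec_comp. Qed.

Hint Resolve measurable_row_vec1 measurable_row_vec2 measurable_row_vec : core.

Lemma double_integral_swap F : (forall g h, 0 <= F g h)%E -> measurable_row2 F ->
  double_integral F = double_integral (fun g h => F h g).
Proof.
move=> F0 mF; rewrite /double_integral.
exact: (fubini_tonelli (fun p : n.-tuple (measurableTypeR R) * n.-tuple (measurableTypeR R) =>
  F (vec p.1) (vec p.2))).
Qed.

(** For fixed [g] the inner integral is merely translated, whatever the matrix [X]. *)
Lemma double_integral_shear2 F X : (forall g h, 0 <= F g h)%E -> measurable_row2 F ->
  double_integral (fun g h => F g (h + g *m X)) = double_integral F.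
Proof.
move=> F0 mF; apply: eq_integral => g _.
have := @ge0_integral_leb_affine R n 1 (vec g *m X) (F (vec g)) (oner_neq0 R).
rewrite normr1 expr1n invr1 mul1e => <-//.
  by apply: eq_integral => h _; rewrite scale1r.
apply: (measurable_comp_row2 mF) => //; exact: measurable_row_cst.
Qed.

Lemma double_integral_shear1 F X : (forall g h, 0 <= F g h)%E -> measurable_row2 F ->
  double_integral (fun g h => F (g + h *m X) h) = double_integral F.
Proof.
move=> F0 mF; rewrite double_integral_swap//; last first.
  apply: (measurable_comp_row2 mF) => //.
  by apply: measurable_rowD => //; exact: measurable_rowM.
rewrite (double_integral_shear2 X (F := fun g h => F h g))//.
  rewrite -double_integral_swap//.
exact: (measurable_comp_row2 mF).
Qed.

(** The shears move [h], then [g], then [h] again, each using the values just updated. *)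
Lemma double_integral_shears F X Y Z :
  (forall g h, 0 <= F g h)%E -> measurable_row2 F ->
  double_integral (fun g h => F (g + (h + g *m X) *m Y)
    ((h + g *m X) + (g + (h + g *m X) *m Y) *m Z)) = double_integral F.
Proof.
move=> F0 mF.
pose F2 g h := F g (h + g *m Z); pose F1 g h := F2 (g + h *m Y) h.
have mF2 : measurable_row2 F2.
  apply: (measurable_comp_row2 mF) => //.
  by apply: measurable_rowD => //; exact: measurable_rowM.
have mF1 : measurable_row2 F1.
  apply: (measurable_comp_row2 mF2) => //.
  by apply: measurable_rowD => //; exact: measurable_rowM.
transitivity (double_integral F1).
  by apply: (@double_integral_shear2 F1) => // g h; exact: F0.
transitivity (double_integral F2); last exact: double_integral_shear2.
by apply: (@double_integral_shear1 F2) => // g h; exact: F0.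
Qed.

(* [[C, -S], [S, C]] = U(X) L(S) U(X) with [X = (C - 1) S^-1]. *)
Lemma double_integral_rotation F C S : S \in unitmx -> C *m S = S *m C ->
  C *m C + S *m S = 1%:M ->
  (forall g h, 0 <= F g h)%E -> measurable_row2 F ->
  double_integral (fun g h => F (g *m C + h *m S) (h *m C - g *m S)) =
  double_integral F.
Proof.
move=> uS CS CC F0 mF; pose X := (C - 1%:M) *m invmx S.
rewrite -(double_integral_shears X S X F0 mF).
have XS : X *m S = C - 1%:M by rewrite /X -mulmxA mulVmx// mulmx1.
have SX : S *m X = C - 1%:M.
  by rewrite /X mulmxA mulmxBr mulmx1 -CS -{2}[S]mul1mx -mulmxBl -mulmxA mulmxV// mulmx1.
have CX : C *m X = - S - X.
  rewrite /X mulmxA mulmxBr mulmx1.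
  have -> : C *m C = 1%:M - S *m S by rewrite -CC addrK.
  rewrite !mulmxBl mul1mx -mulmxA mulmxV// mulmx1 opprB addrA.
  by rewrite [invmx S - S]addrC.
congr double_integral; apply/funext => g; apply/funext => h.
have E : g + (h + g *m X) *m S = g *m C + h *m S.
  by rewrite mulmxDl -mulmxA XS mulmxBr mulmx1 addrC -addrA subrK addrC.
rewrite E; congr F.
rewrite mulmxDl -!mulmxA CX SX mulmxBr mulmxBr mulmx1 mulmxN.
rewrite [_ + (h *m C - h)]addrC addrACA [h + _]addrC subrK.
by rewrite [g *m X + _]addrC subrK.
Qed.

Lemma double_integralM (Phi Psi : 'rV[R]_n -> \bar R) :
  (forall v, 0 <= Phi v)%E -> (forall v, 0 <= Psi v)%E ->
  measurable_fun setT (Phi \o @vec R n) -> measurable_fun setT (Psi \o @vec R n) ->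
  double_integral (fun g h => Phi g * Psi h)%E =
  (\int[leb R n]_g Phi (vec g) * \int[leb R n]_h Psi (vec h))%E.
Proof.
move=> Phi0 Psi0 mPhi mPsi; rewrite /double_integral.
under eq_integral => g _ do rewrite ge0_integralZl//.
by rewrite ge0_integralZr//; exact: integral_ge0.
Qed.

(** Whitehead's factorisation: the shears by [A], [- A^-1], [A] compose to
    [(g, h) |-> (- h A^-1, g A)], which therefore preserves the measure on pairs. On a product
    function the unknown Jacobians of [A] and [A^-1] then sit in two separate integrals. *)
Lemma double_integral_whitehead (Phi Psi : 'rV[R]_n -> \bar R) A : A \in unitmx ->
  (forall v, 0 <= Phi v)%E -> (forall v, 0 <= Psi v)%E ->
  measurable_fun setT (Phi \o @vec R n) -> measurable_fun setT (Psi \o @vec R n) ->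
  (\int[leb R n]_g Psi (vec g *m A) * \int[leb R n]_h Phi (- (vec h *m invmx A))%R =
  \int[leb R n]_g Psi (vec g) * \int[leb R n]_h Phi (vec h))%E.
Proof.
move=> uA Phi0 Psi0 mPhi mPsi.
rewrite [RHS]muleC -double_integralM//.
rewrite -(double_integral_shears A (- invmx A) A); last 2 first.
- by move=> g h; exact: mule_ge0.
- apply: emeasurable_funM; first exact: (measurable_comp_row mPhi).
  exact: (measurable_comp_row mPsi).
rewrite -(@double_integralM (fun g => Psi (g *m A)) (fun h => Phi (- (h *m invmx A))))//.
- congr double_integral; apply/funext => g; apply/funext => h.
  have -> : g + (h + g *m A) *m - invmx A = - (h *m invmx A).
    by rewrite mulmxN mulmxDl -mulmxA mulmxV// mulmx1 opprD addrC subrK.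
  by rewrite mulNmx -mulmxA mulVmx// mulmx1 addrAC subrr add0r muleC.
- apply: (measurable_comp_row mPsi); exact: measurable_rowM.
- apply: (measurable_comp_row mPhi).
  by apply: measurable_rowN; exact: measurable_rowM.
Qed.

End shears.

(** * The Euclidean norm and its distortion by matrices *)

Section euclidean_norm.
Context {R : realType} (n : nat).
Implicit Types (u v : 'rV[R]_n).

Lemma enorm_ge0 v : 0 <= enorm v.
Proof. exact: sqrtr_ge0. Qed.

Lemma enorm_sqr v : enorm v ^+ 2 = \sum_i v 0 i ^+ 2.
Proof. by rewrite sqr_sqrtr// sumr_ge0// => i _; exact: sqr_ge0. Qed.

Lemma enorm_sqrE v : enorm v ^+ 2 = (v *m v^T) 0 0.
Proof. by rewrite enorm_sqr mxE; apply: eq_bigr => i _; rewrite mxE expr2. Qed.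

Lemma enormZ (c : R) v : enorm (c *: v) = `|c| * enorm v.
Proof.
rewrite -sqrtr_sqr -sqrtrM ?sqr_ge0//; congr Num.sqrt.
by rewrite mulr_sumr; apply: eq_bigr => i _; rewrite mxE exprMn.
Qed.

Lemma enormN v : enorm (- v) = enorm v.
Proof. by rewrite -scaleN1r enormZ normrN1 mul1r. Qed.

Lemma enorm_eq0 v : (enorm v == 0) = (v == 0).
Proof.
apply/idP/eqP => [/eqP v0|->]; last first.
  by rewrite /enorm big1 ?sqrtr0// => i _; rewrite mxE expr0n.
have /eqP : enorm v ^+ 2 = 0 by rewrite v0 expr0n.
rewrite enorm_sqr psumr_eq0 => [/allP h|i _]; last exact: sqr_ge0.
apply/rowP => i; rewrite mxE; apply/eqP; rewrite -sqrf_eq0.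
by have := h i (mem_index_enum i).
Qed.

Lemma enorm_gt0 v : (0 < enorm v) = (v != 0).
Proof. by rewrite lt_def enorm_eq0 enorm_ge0 andbT. Qed.

Lemma coord_le_enorm v i : `|v 0 i| <= enorm v.
Proof.
rewrite -(ler_pXn2r (n := 2))// ?nnegrE ?enorm_ge0// enorm_sqr (bigD1 i)//=.
by rewrite real_normK ?num_real// lerDl sumr_ge0// => j _; exact: sqr_ge0.
Qed.

Lemma enorm_sqrD u v : enorm (u + v) ^+ 2 <= 2 * (enorm u ^+ 2 + enorm v ^+ 2).
Proof.
rewrite !enorm_sqr mulrDr !mulr_sumr -big_split; apply: ler_sum => i _ /=.
rewrite mxE -subr_ge0.
rewrite [X in 0 <= X](_ : _ = (u 0 i - v 0 i) ^+ 2); last by ring.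
exact: sqr_ge0.
Qed.

Lemma enorm_mulmx_bound (A : 'M[R]_n) :
  exists2 M, 0 < M & forall v, enorm (v *m A) <= M * enorm v.
Proof.
pose S : R := \sum_i \sum_j `|A i j|.
have S0 : 0 <= S by apply: sumr_ge0 => i _; apply: sumr_ge0.
(* The summand [1] keeps the constant positive when [A = 0]. *)
exists (n%:R * S + 1) => [|v].
  by rewrite ltr_wpDl// mulr_ge0.
rewrite -(ler_pXn2r (n := 2))// ?nnegrE ?enorm_ge0// ?mulr_ge0 ?enorm_ge0//; last first.
  by rewrite addr_ge0// mulr_ge0.
have h (j : 'I_n) : ((v *m A) 0 j) ^+ 2 <= (S * enorm v) ^+ 2.
  rewrite -real_normK ?num_real// ler_pXn2r// ?nnegrE// ?mulr_ge0 ?enorm_ge0//.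
  rewrite mxE (le_trans (ler_norm_sum _ _ _))// /S mulr_suml ler_sum// => i _.
  rewrite normrM mulrC ler_pM ?coord_le_enorm//.
  by rewrite (bigD1 j)//= lerDl sumr_ge0.
rewrite enorm_sqr (le_trans (ler_sum _ (fun j _ => h j)))//.
rewrite sumr_const card_ord -[leLHS]mulr_natl !exprMn mulrA.
apply: ler_wpM2r; first exact: sqr_ge0.
move: S0 => {h}; move: (S); case: (n) => [|k] T T0; first by rewrite mul0r sqr_ge0.
apply: (@le_trans _ _ ((k.+1%:R * T) ^+ 2)).
  by rewrite exprMn ler_wpM2r ?sqr_ge0// expr2 ler_peMr// ler1n.
by rewrite ler_pXn2r ?nnegrE ?lerDl ?addr_ge0 ?mulr_ge0.
Qed.

Lemma enorm_mulmx_lbound (A : 'M[R]_n) : A \in unitmx ->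
  exists2 m, 0 < m & forall v, m * enorm v <= enorm (v *m A).
Proof.
move=> uA; have [M M0 hM] := enorm_mulmx_bound (invmx A).
exists M^-1; first by rewrite invr_gt0.
move=> v; rewrite ler_pdivrMl//.
by have := hM (v *m A); rewrite -mulmxA mulmxV// mulmx1.
Qed.

End euclidean_norm.

(** * Gaussian integrals and the Jacobian of a matrix *)

Section gaussian.
Context {R : realType}.

(** The density is left unnormalised: its mass [pi^(n/2)] is the power of [pi] in [C_ns], against
    which it cancels in the end. *)
Definition gaussian n (v : 'rV[R]_n) : R := expR (- enorm v ^+ 2).

Lemma gaussian_ge0 n (v : 'rV[R]_n) : 0 <= gaussian v.
Proof. exact: expR_ge0. Qed.

Lemma measurable_gaussian n : measurable_fun setT (@gaussian n \o @vec R n).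
Proof.
apply: (@measurableT_comp _ _ _ _ _ _ (@expR R)) => //.
apply: measurableT_comp => //; apply: measurable_funX; exact: measurable_enorm.
Qed.

Lemma measurable_gaussian_row d (D : measurableType d) n (G : D -> 'rV[R]_n) :
  measurable_row G -> measurable_fun setT (fun p => (gaussian (G p))%:E).
Proof.
move=> mG; apply/measurable_EFinP.
exact: (measurable_comp_row (@measurable_gaussian n) mG).
Qed.

Lemma integral_gaussian n :
  (\int[leb R n]_t (gaussian (vec t))%:E)%E = (pi `^ (n%:R / 2))%:E.
Proof.
have -> : pi `^ (n%:R / 2) = Num.sqrt pi ^+ n :> R.
  by rewrite -powR12_sqrt ?pi_ge0// -powR_mulrn ?powR_ge0// -powRrM mulrC.
elim: n => [|n IH].
  rewrite /= integral_dirac//=; last exact: measurable_gaussian_row (@measurable_row_vec R 0).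
  rewrite diracE mem_set// mul1e /gaussian enorm_sqr big_ord0.
  by rewrite oppr0 expR0 expr0.
rewrite ge0_integral_lebS; last 2 first.
- exact: measurable_gaussian_row (@measurable_row_vec R _).
- by move=> t; rewrite lee_fin gaussian_ge0.
have gE x (t : n.-tuple (measurableTypeR R)) :
    (gaussian (vec (cons_pair (x, t))))%:E = ((gauss_fun x)%:E * (gaussian (vec t))%:E)%E.
  rewrite -EFinM /gaussian /gauss_fun -expRD !enorm_sqr big_ord_recl opprD.
  have -> : vec (cons_pair (x, t)) 0 ord0 = x by rewrite mxE.
  rewrite (eq_bigr (fun i => vec t 0 i ^+ 2))// => i _.
  by rewrite !mxE tnthS.
under eq_integral => x _.
  under eq_integral do rewrite gE.
  rewrite ge0_integralZl//; last 3 first.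
  - exact: measurable_gaussian_row (@measurable_row_vec R _).
  - by move=> t _; rewrite lee_fin gaussian_ge0.
  - by rewrite lee_fin gauss_fun_ge0.
  rewrite IH; over.
rewrite ge0_integralZr//; last 2 first.
- by apply/measurable_EFinP; exact: measurable_gauss_fun.
- by move=> x _; rewrite lee_fin gauss_fun_ge0.
by rewrite integralT_gauss -EFinM -exprS.
Qed.

Lemma integral_gaussian_scale n (c : R) : 0 < c ->
  (\int[leb R n]_t (gaussian (c *: vec t))%:E)%E = (c ^- n * pi `^ (n%:R / 2))%:E.
Proof.
move=> c0; have := @ge0_integral_leb_affine R n c 0 (fun v => (gaussian v)%:E).
under eq_integral do rewrite addr0.
move=> ->.
- by rewrite integral_gaussian gtr0_norm.
- by rewrite gt_eqF.
- by apply: measurable_gaussian_row; exact: measurable_row_vec.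
- by move=> v; rewrite lee_fin gaussian_ge0.
Qed.

(* Whitehead's identity reduces the change of variables by [A] to shears, the
   Gaussian being used to cancel the change of variables by [invmx A]. *)
Lemma ge0_integral_leb_mulmx n (A : 'M[R]_n) : A \in unitmx ->
  exists2 c, 0 < c & forall f : 'rV[R]_n -> \bar R,
    measurable_fun setT (f \o @vec R n) -> (forall v, 0 <= f v)%E ->
    (\int[leb R n]_t f (vec t *m A) = c%:E * \int[leb R n]_t f (vec t))%E.
Proof.
move=> uA; have uA' : invmx A \in unitmx by rewrite unitmx_inv.
have [M M0 hM] := enorm_mulmx_bound (invmx A).
have [m m0 hm] := enorm_mulmx_lbound uA'.
(* The factor sought is [pi^(n/2) / J]. As [A^-1] distorts the norm by bounded factors, [J] lies
   between two scaled Gaussian integrals, hence is finite and positive. *)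
pose J := (\int[leb R n]_t (gaussian (- (vec t *m invmx A)))%:E)%E.
have mg : measurable_fun setT (fun t : n.-tuple (measurableTypeR R) =>
    (gaussian (- (vec t *m invmx A)))%:E).
  apply: measurable_gaussian_row.
  by apply: measurable_rowN; apply: measurable_rowM; exact: measurable_row_vec.
have mgc c : measurable_fun setT (fun t : n.-tuple (measurableTypeR R) =>
    (gaussian (c *: (vec t)))%:E).
  apply: measurable_gaussian_row.
  by apply: measurable_rowZ => //; exact: measurable_row_vec.
have le_gauss (u v : 'rV[R]_n) : enorm u <= enorm v -> ((gaussian v)%:E <= (gaussian u)%:E)%E.
  move=> uv; rewrite lee_fin ler_expR lerN2.
  by rewrite ler_pXn2r// nnegrE enorm_ge0.
have J1 : ((M ^- n * pi `^ (n%:R / 2))%:E <= J)%E.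
  rewrite -(integral_gaussian_scale n M0); apply: ge0_le_integral => //.
  - by move=> t _; rewrite lee_fin gaussian_ge0.
  - by move=> t _; apply: le_gauss; rewrite enormN enormZ gtr0_norm.
have J2 : (J <= (m ^- n * pi `^ (n%:R / 2))%:E)%E.
  rewrite -(integral_gaussian_scale n m0); apply: ge0_le_integral => //.
  - by move=> t _; rewrite lee_fin gaussian_ge0.
  - by move=> t _; apply: le_gauss; rewrite enormN enormZ gtr0_norm.
have pi0 : 0 < pi `^ (n%:R / 2) :> R by rewrite powR_gt0// pi_gt0.
have [j Jj] : exists j, J = j%:E.
  exists (fine J); rewrite fineK// ge0_fin_numE.
    by rewrite (le_lt_trans J2)// ltry.
  by apply: integral_ge0 => t _; rewrite lee_fin gaussian_ge0.
have j0 : 0 < j.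
  by rewrite Jj lee_fin in J1; apply: lt_le_trans J1; rewrite mulr_gt0// invr_gt0 exprn_gt0.
exists (pi `^ (n%:R / 2) / j); first by rewrite divr_gt0.
move=> f mf f0.
have := @double_integral_whitehead R n (fun v => (gaussian v)%:E) f A uA.
rewrite integral_gaussian -/J Jj => wh.
have {}wh : (\int[leb R n]_g f (vec g *m A) * j%:E =
    \int[leb R n]_g f (vec g) * (pi `^ (n%:R / 2))%:E)%E.
  apply: wh => //; first by move=> v; rewrite lee_fin gaussian_ge0.
  exact: measurable_gaussian_row (@measurable_row_vec R n).
rewrite mulrC EFinM -muleA [X in _ = (_ * X)%E]muleC -wh muleC -muleA -EFinM divff ?mule1//.
by rewrite gt_eqF.
Qed.

End gaussian.

(** * The Gamma function *)

Section exponential_substitution.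
Context {R : realType}.
Let mu : {measure set (measurableTypeR R) -> \bar R} := lebesgue_measure.

Lemma measurable_invr_ge0 d (D : measurableType d) (k : D -> R) :
  (forall p, 0 <= k p) -> measurable_fun setT k ->
  measurable_fun setT (fun p => (k p)^-1).
Proof.
move=> k0 mk; under eq_fun do rewrite -powR_inv1//.
exact: (measurableT_comp (measurable_powR _)).
Qed.

Lemma ge0_integral_even (f : R -> \bar R) :
  measurable_fun [set: measurableTypeR R] f -> (forall x, 0 <= f x)%E ->
  (forall x, f (- x) = f x) ->
  (\int[lebesgue_measure]_x f x =
   2%:E * \int[lebesgue_measure]_(x in `]0%R, +oo[) f x)%E.
Proof.
move=> mf f0 fN.
have mfS D : measurable_fun D f by exact: measurable_funTS.
have -> : [set: R] = `]-oo, 0] `|` `]0, +oo[.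
  by apply/seteqP; split => x //= _; rewrite !in_itv /= andbT; case: (leP x 0); [left|right].
rewrite ge0_integral_setU//; last 2 first.
- exact: mfS.
- apply/disj_setPLR => x /=; rewrite !in_itv /= andbT => x0.
  by apply/negP; rewrite -leNgt.
rewrite [X in (X + _)%E](_ : _ = \int[lebesgue_measure]_(x in `]0%R, +oo[) f x)%E.
  by rewrite mule_natl mule2n.
rewrite integral_itv_obnd_cbnd// ge0_integration_by_substitution0//.
by apply: eq_integral => x _; rewrite fN.
Qed.

(** The substitution is made on the compact intervals [[exp (- k), exp k]] and [[- k, k]], and
    monotone convergence exhausts both domains. Afterwards power substitutions on the half-line are
    affine changes of variable on the line. *)
Lemma ge0_integral_expR (G : R -> R) :
  (forall t, 0 < t -> {for t, continuous G}) -> (forall t, 0 < t -> 0 <= G t) ->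
  (\int[lebesgue_measure]_(t in `]0%R, +oo[) (G t)%:E =
   \int[lebesgue_measure]_x (G (expR x) * expR x)%:E)%E.
Proof.
move=> cG G0.
have dE : derive1 (@expR R) = expR by apply/funext => x; rewrite derive1E; exact: derive_val.
have cGE : continuous (fun x => G (expR x) * expR x).
  move=> x; apply: cvgM; last exact: continuous_expR.
  by apply: continuous_comp; [exact: continuous_expR|exact/cG/expR_gt0].
pose A k : set R := `[expR (- k%:R), expR k%:R]%classic.
pose B k : set R := `[- k%:R, k%:R]%classic.
have AE : \bigcup_k A k = `]0, +oo[%classic.
  apply/seteqP; split => [t [k _] /=|t /=]; rewrite !in_itv /= andbT.
    by rewrite /A /= in_itv /= => /andP[+ _]; apply: lt_le_trans; exact: expR_gt0.
  move=> t0; exists (Num.truncn `|ln t|).+1 => //=; rewrite /A /= in_itv /=.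
  rewrite -{2 3}(lnK t0) !ler_expR -ler_norml.
  by apply/ltW/truncnS_gt.
have BE : \bigcup_k B k = [set: R].
  apply/seteqP; split => // x _; exists (Num.truncn `|x|).+1 => //=.
  by rewrite /B /= in_itv /= -ler_norml; apply/ltW/truncnS_gt.
have ndA : nondecreasing_seq A.
  move=> i j ij; rewrite subsetEset => t; rewrite /A /= !in_itv /= => /andP[h1 h2].
  by rewrite (le_trans _ h1) ?(le_trans h2)// ler_expR ?lerN2 ler_nat.
have ndB : nondecreasing_seq B.
  move=> i j ij; rewrite subsetEset => t; rewrite /B /= !in_itv /= => /andP[h1 h2].
  by rewrite (le_trans _ h1) ?(le_trans h2)// ?lerN2 ler_nat.
have cA : (\int[mu]_(t in A k) (G t)%:E @[k --> \oo] -->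
           \int[mu]_(t in `]0%R, +oo[) (G t)%:E)%E.
  rewrite -AE; apply: ge0_nondecreasing_set_cvg_integral => //.
  - by move=> i; exact: measurable_itv.
  - move=> i; have mG : measurable_fun (`]0%R, +oo[%classic : set R) G.
      apply: open_continuous_measurable_fun; first exact: interval_open.
      by move=> x; rewrite inE /= in_itv /= andbT => x0; exact: cG.
    apply/measurable_EFinP; apply: measurable_funS mG => //.
    by rewrite -AE; exact: bigcup_sup.
  - move=> i x; rewrite /A /= in_itv /= => /andP[h _]; rewrite lee_fin G0//.
    by apply: lt_le_trans h; exact: expR_gt0.
have cB : (\int[mu]_(x in B k) (G (expR x) * expR x)%:E @[k --> \oo] -->
           \int[mu]_x (G (expR x) * expR x)%:E)%E.
  rewrite -BE; apply: ge0_nondecreasing_set_cvg_integral => //.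
  - by move=> i; exact: measurable_itv.
  - move=> i; apply: measurable_funTS; apply/measurable_EFinP.
    exact: continuous_measurable_fun.
  - by move=> i x _; rewrite lee_fin mulr_ge0 ?expR_ge0// G0 ?expR_gt0.
suff AB : (fun k => \int[mu]_(t in A k) (G t)%:E)%E =
          (fun k => \int[mu]_(x in B k) (G (expR x) * expR x)%:E)%E.
  by rewrite AB in cA; exact: (cvg_unique _ cA cB).
apply/funext => k; rewrite /A integration_by_substitution_increasing ?dE//.
- by rewrite ge0_cp.
- by move=> x y _ _; rewrite ltr_expR.
- by move=> x _; exact: continuous_expR.
- by apply/cvg_ex; exists (expR (- k%:R)); apply: cvg_at_right_filter; exact: continuous_expR.
- by apply/cvg_ex; exists (expR k%:R); apply: cvg_at_left_filter; exact: continuous_expR.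
- split; first by move=> x _; exact: derivable_expR.
    by apply: cvg_at_right_filter; exact: continuous_expR.
  by apply: cvg_at_left_filter; exact: continuous_expR.
- apply: continuous_in_subspaceT => x; rewrite inE /= in_itv /= => /andP[h _].
  by apply: cG; apply: lt_le_trans h; exact: expR_gt0.
Qed.

Lemma continuous_powR (p t : R) : 0 < t -> {for t, continuous (fun x => x `^ p)}.
Proof.
move=> t0; apply/differentiable_continuous/derivable1_diffP.
by apply: derivable_powR; rewrite in_itv /= andbT.
Qed.

(** Euler's integral for [Gamma(a)] after [t = exp x], kept in the extended reals until it is known
    to be finite. *)
Definition gamma_int (a : R) : \bar R :=
  (\int[lebesgue_measure]_x (expR (a * x - expR x))%:E)%E.

Lemma measurable_gamma_int (a : R) : measurable_fun setT
  (fun x : measurableTypeR R => (expR (a * x - expR x))%:E).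
Proof.
apply/measurable_EFinP; apply: continuous_measurable_fun => x.
apply: (@continuous_comp _ _ _ (fun x => a * x - expR x) expR); last exact: continuous_expR.
by apply: cvgB; [exact: mulrl_continuous|exact: continuous_expR].
Qed.

Lemma gamma_intE (a : R) :
  (\int[lebesgue_measure]_(t in `]0%R, +oo[) (t `^ (a - 1) * expR (- t))%:E)%E =
  gamma_int a.
Proof.
rewrite ge0_integral_expR.
- apply: eq_integral => x _; rewrite -expRM -!expRD; congr (EFin (expR _)); ring.
- move=> t t0; apply: cvgM; first exact: continuous_powR.
  apply: (@continuous_comp _ _ _ -%R expR); first exact: opp_continuous.
  exact: continuous_expR.
- by move=> t t0; rewrite mulr_ge0 ?powR_ge0 ?expR_ge0.
Qed.

Lemma integral_expR_neg (a : R) : 0 < a ->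
  (\int[lebesgue_measure]_(x in `]0%R, +oo[) (expR (- (a * x)))%:E)%E = a^-1%:E.
Proof.
move=> a0; have := integral_exponential_pdf a0.
have -> : (\int[lebesgue_measure]_x (exponential_pdf a x)%:E =
    \int[lebesgue_measure]_(x in `[0%R, +oo[) (a * expR (- a * x))%:E)%E.
  rewrite [RHS]integral_mkcond; apply: eq_integral => x _.
  by rewrite /exponential_pdf !patchE; case: ifP.
move=> h.
have me : measurable_fun (`]0%R, +oo[%classic : set (measurableTypeR R))
    (fun x : measurableTypeR R => (expR (- (a * x)))%:E).
  apply: measurable_funTS; apply/measurable_EFinP; apply: measurableT_comp => //.
  by apply: measurableT_comp => //; exact: measurable_funM.
transitivity (a^-1%:E * (a%:E * \int[lebesgue_measure]_(x in `]0%R, +oo[) (expR (- (a * x)))%:E))%E.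
  by rewrite muleA -EFinM mulVf ?gt_eqF// mul1e.
rewrite -[RHS]mule1 -h; congr (_ * _)%E.
rewrite -ge0_integralZl//.
- rewrite integral_itv_obnd_cbnd; last exact: emeasurable_funM.
  by apply: eq_integral => x _; rewrite /= mulNr EFinM.
- by rewrite lee_fin ltW.
Qed.

Lemma integral_expR_abs (a : R) : 0 < a ->
  (\int[lebesgue_measure]_x (expR (- (a * `|x|)))%:E)%E = (2 / a)%:E.
Proof.
move=> a0; rewrite ge0_integral_even.
- rewrite EFinM -integral_expR_neg//; congr (_ * _)%E.
  by apply: eq_integral => x; rewrite inE /= in_itv /= andbT => x0; rewrite gtr0_norm.
- apply/measurable_EFinP; apply: measurableT_comp => //.
  apply: measurableT_comp => //; apply: measurable_funM => //.
- by move=> x; rewrite lee_fin expR_ge0.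
- by move=> x; rewrite normrN.
Qed.

Lemma gamma_int_lty (a : R) : 0 < a -> (gamma_int a < +oo)%E.
Proof.
move=> a0.
apply: (@le_lt_trans _ _ ((expR (2 * a ^+ 2))%:E *
    \int[lebesgue_measure]_x (expR (- (a * `|x|)))%:E)%E); last first.
  by rewrite integral_expR_abs// -EFinM ltry.
have me : measurable_fun setT (fun x : measurableTypeR R => (expR (- (a * `|x|)))%:E).
  apply/measurable_EFinP; apply: measurableT_comp => //.
  apply: measurableT_comp => //; apply: measurable_funM => //.
rewrite -ge0_integralZl//.
(* For [x >= 0] this combines [2 a x <= 2 a^2 + x^2 / 2] with [x^2 / 2 <= exp x]; for [x < 0] the
   terms [a x] and [- a |x|] coincide. *)
have key (x : R) : a * x - expR x <= 2 * a ^+ 2 + - (a * `|x|).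
  have := expR_gt0 x; have [x0|x0] := lerP 0 x => ex.
    rewrite ger0_norm//; have := expR_ge1Dxn 1 x0; rewrite (_ : 2`! = 2%N)// => h.
    by have := sqr_ge0 (x - 2 * a); move: h; rewrite !expr2; move: (expR x) => w; lra.
  by rewrite ltr0_norm//; have := sqr_ge0 a; move: ex; move: (expR x) => w; lra.
apply: ge0_le_integral => //.
- exact: measurable_gamma_int.
- exact: emeasurable_funM.
- by move=> x _; rewrite -EFinM lee_fin -expRD ler_expR.
Qed.

(** Euler's integral is restricted to [0 < t < e], where [exp (- t) >= exp (- e)]; the reflection
    [x |-> ln e - x] turns this range into a half-line. With [a = 1 - s] the bound controls
    [(1 - s) Gamma(1 - s)] up to [s = 1], and [e] remains to be chosen. *)
Lemma gamma_int_ge (a e : R) : 0 < a -> 0 < e ->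
  ((expR (- e) * e `^ a / a)%:E <= gamma_int a)%E.
Proof.
move=> a0 e0.
have me D : measurable_fun D (fun x : measurableTypeR R => (expR (- (a * x)))%:E).
  apply: measurable_funTS; apply/measurable_EFinP; apply: measurableT_comp => //.
  by apply: measurableT_comp => //; exact: measurable_funM.
rewrite EFinM -integral_expR_neg// -ge0_integralZl//.
have -> : gamma_int a = (\int[lebesgue_measure]_x
    (expR (a * (ln e - x) - expR (ln e - x)))%:E)%E.
  have := @ge0_integral_affine R (-1) (ln e) _ _ (measurable_gamma_int a).
  rewrite normrN1 invr1 mul1e -/(gamma_int a) => <-.
  - by apply: eq_integral => x _; rewrite mulN1r (addrC (- x)).
  - by rewrite oppr_eq0 oner_eq0.
  - by move=> x; rewrite lee_fin expR_ge0.
have mg : measurable_fun setT (fun x : measurableTypeR R =>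
    (expR (a * (ln e - x) - expR (ln e - x)))%:E).
  rewrite (_ : (fun x => _) = (fun x => (expR (a * x - expR x))%:E) \o (fun x => -1 * x + ln e)).
    exact: (measurableT_comp (measurable_gamma_int a) (measurable_affine (-1) (ln e))).
  by apply/funext => x /=; rewrite mulN1r (addrC (- x)).
apply: (@le_trans _ _ (\int[lebesgue_measure]_(x in `]0%R, +oo[)
    (expR (a * (ln e - x) - expR (ln e - x)))%:E)%E).
  apply: ge0_le_integral => //.
  - by move=> x _; rewrite -EFinM lee_fin ?mulr_ge0 ?expR_ge0 ?powR_ge0.
  - exact: emeasurable_funM.
  - exact: measurable_funTS.
  - move=> x /=; rewrite in_itv /= andbT => x0.
    rewrite -EFinM lee_fin /powR gt_eqF// -!expRD ler_expR.
    have : expR (ln e - x) <= e by rewrite -{2}(lnK e0) ler_expR; lra.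
    by move: (expR _) => w; lra.
  by apply: ge0_subset_integral.
by rewrite lee_fin mulr_ge0 ?expR_ge0 ?powR_ge0.
Qed.

(** With [r = exp x] the integrand is that of [gamma_int (p / 2)] at [- 2 x]; the factor [1/2] from
    this dilation cancels the [2] from evenness. *)
Lemma integral_inverse_gauss (p : R) : 0 < p ->
  (\int[lebesgue_measure]_r (expR (- (r ^- 2)) / `|r| `^ (p + 1))%:E)%E =
  gamma_int (p / 2).
Proof.
move=> p0; rewrite ge0_integral_even; last 3 first.
- apply/measurable_EFinP; apply: measurable_funM.
    apply: measurableT_comp => //; apply: measurableT_comp => //.
    by apply: measurable_invr_ge0 => [r|]; [exact: sqr_ge0|exact: measurable_funX].
  apply: measurable_invr_ge0 => [r|]; first exact: powR_ge0.
  by apply: (measurableT_comp (measurable_powR _)).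
- by move=> r; rewrite lee_fin mulr_ge0 ?invr_ge0 ?powR_ge0 ?expR_ge0.
- by move=> r; rewrite sqrrN normrN.
transitivity (2%:E * \int[lebesgue_measure]_(r in `]0%R, +oo[)
    (expR (- (r ^- 2)) / r `^ (p + 1))%:E)%E.
  congr (_ * _)%E; apply: eq_integral => r.
  by rewrite inE /= in_itv /= andbT => r0; rewrite gtr0_norm.
rewrite ge0_integral_expR; last 2 first.
- move=> t t0; apply: cvgM.
    apply: (@continuous_cvg _ _ _ _ _ _ expR); first exact: continuous_expR.
    apply: cvgN; apply: cvgV; first by rewrite expf_neq0// gt_eqF.
    exact: exprn_continuous.
  apply: cvgV; last exact: continuous_powR.
  by rewrite gt_eqF// powR_gt0.
- by move=> r r0; rewrite mulr_ge0 ?invr_ge0 ?powR_ge0 ?expR_ge0.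
have := ge0_integral_affine 0 _ (measurable_gamma_int (p / 2)) => /(_ (-2)).
rewrite oppr_eq0 pnatr_eq0 => /(_ isT) => h.
transitivity (2%:E * \int[lebesgue_measure]_x
  (expR (p / 2 * (-2 * x + 0) - expR (-2 * x + 0)))%:E)%E.
  congr (_ * _)%E; apply: eq_integral => x _; rewrite -expRM -expRN -!expRD.
  rewrite -expRM_natl -expRN.
  congr (EFin (expR _)); rewrite addr0 !mulNr; by field.
rewrite h; last by move=> x; rewrite lee_fin expR_ge0.
by rewrite normrN ger0_norm// muleA -EFinM divff// mul1e.
Qed.

End exponential_substitution.

(** * Gaussian averages *)

Section gaussian_moments.
Context {R : realType} (n : nat).
Let P : R := pi `^ (n%:R / 2).

Let P_gt0 : 0 < P.
Proof. by rewrite powR_gt0// pi_gt0. Qed.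

Let mvec : measurable_row (@vec R n) := @measurable_row_vec R n.

Lemma measurable_enorm_row d (D : measurableType d) (G : D -> 'rV[R]_n) :
  measurable_row G -> measurable_fun setT (fun p => enorm (G p)).
Proof. by move=> mG; exact: (measurable_comp_row (@measurable_enorm R n) mG). Qed.

(* Comparing [gaussian v] with [gaussian (c^-1 *: v)], whose integral is known
   by scaling, avoids any integration by parts; the bound comes from [c -> 1]. *)
Lemma gaussian_moment2_le :
  (\int[leb R n]_t (enorm (vec t) ^+ 2 * gaussian (vec t))%:E <=
   (n%:R / 2 * P)%:E)%E.
Proof.
set J := (\int[leb R n]_t _)%E.
have mJ : measurable_fun setT (fun t : n.-tuple (measurableTypeR R) =>
    (enorm (vec t) ^+ 2 * gaussian (vec t))%:E).
  apply/measurable_EFinP; apply: measurable_funM.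
    by apply: measurable_funX; exact: measurable_enorm.
  exact: measurable_gaussian.
have mg := measurable_gaussian_row mvec.
have J0 : (0 <= J)%E.
  by apply: integral_ge0 => t _; rewrite lee_fin mulr_ge0 ?sqr_ge0 ?gaussian_ge0.
(* From [exp y >= 1 + y] at [y = (1 - c^-2) |v|^2] follows [gaussian (c^-1 v) >= (1 + (1 - c^-2)
   |v|^2) gaussian v], which is integrated. *)
have key (c : R) : 1 < c -> (P%:E + (1 - c ^- 2)%:E * J <= (c ^+ n * P)%:E)%E.
  move=> c1; have c0 : 0 < c by rewrite (lt_trans _ c1).
  have ec : 0 <= 1 - c ^- 2.
    by rewrite subr_ge0 invf_le1 ?exprn_gt0// exprn_ege1// ltW.
  have ci0 : 0 < c^-1 by rewrite invr_gt0.
  have := integral_gaussian_scale n ci0; rewrite exprVn invrK => <-.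
  rewrite -integral_gaussian -ge0_integralZl//; last first.
    by move=> t _; rewrite lee_fin mulr_ge0 ?sqr_ge0 ?gaussian_ge0.
  rewrite -ge0_integralD//; last 3 first.
  - by move=> t _; rewrite lee_fin gaussian_ge0.
  - by move=> t _; rewrite -EFinM lee_fin mulr_ge0// mulr_ge0 ?sqr_ge0 ?gaussian_ge0.
  - exact: emeasurable_funM.
  apply: ge0_le_integral => //.
  - move=> t _; rewrite -EFinM -EFinD lee_fin addr_ge0 ?gaussian_ge0//.
    by rewrite mulr_ge0// mulr_ge0 ?sqr_ge0 ?gaussian_ge0.
  - by apply: emeasurable_funD => //; exact: emeasurable_funM.
  - by apply: measurable_gaussian_row; exact: measurable_rowZ.
  move=> t _; rewrite -EFinM -EFinD lee_fin /gaussian enormZ gtr0_norm// exprMn exprVn.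
  set w := enorm _ ^+ 2.
  have -> : - (c ^- 2 * w) = (1 - c ^- 2) * w + - w by ring.
  rewrite expRD mulrA -[X in X + _]mul1r -mulrDl ler_wpM2r ?expR_ge0//.
  exact: expR_ge1Dx.
have Jfin : J \is a fin_num.
  rewrite ge0_fin_numE//; have := key 2 (ltr1n R 2).
  apply: contraTT; rewrite -leNgt leye_eq => /eqP ->.
  rewrite mulry gtr0_sg; last by rewrite subr_gt0 invf_lt1 ?exprn_gt0// exprn_egt1// ltr1n.
  by rewrite mul1e addey// -ltNge ltry.
move: key; rewrite -(fineK Jfin); move: (fine J) => j key.
rewrite lee_fin.
(* Both sides vanish to first order at [c = 1]; dividing by [c - 1] leaves polynomials in [c], whose
   values at [1] give the bound. *)
have {}key (c : R) : 1 < c -> (c + 1) * j <= c ^+ 2 * (\sum_(i < n) c ^+ i) * P.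
  move=> c1; have c0 : 0 < c by rewrite (lt_trans _ c1).
  have := key c c1; rewrite -EFinM -EFinD lee_fin -lerBrDl.
  rewrite -[X in _ <= _ - X]mul1r -mulrBl subrX1.
  have -> : 1 - c ^- 2 = (c - 1) * (c + 1) / c ^+ 2.
    by field; rewrite gt_eqF.
  rewrite -!mulrA ler_pM2l ?subr_gt0// => h.
  have -> : (c + 1) * j = c ^+ 2 * ((c + 1) * (c ^- 2 * j)).
    by field; rewrite gt_eqF.
  by rewrite [leRHS]mulrA -expr2; apply: ler_wpM2l => //; exact: sqr_ge0.
suff : 2 * j <= n%:R * P by lra.
rewrite -subr_ge0; pose h (c : R) := c ^+ 2 * (\sum_(i < n) c ^+ i) * P - (c + 1) * j.
have hc : h c @[c --> 1^'+] --> h 1.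
  have cX k : c ^+ k @[c --> (1 : R)^'+] --> (1 : R) ^+ k.
    by apply: cvg_at_right_filter; exact: exprn_continuous.
  apply: cvgB; last first.
    by apply: cvgMr_tmp; apply: cvgD; [exact: (cX 1%N)|exact: cvg_cst].
  apply: cvgMr_tmp; apply: cvgM; first exact: cX.
  elim: (n) => [|m IH].
    by rewrite big_ord0; under eq_fun do rewrite big_ord0; exact: cvg_cst.
  rewrite big_ord_recr; under eq_fun do rewrite big_ord_recr.
  exact: cvgD (IH) (cX m).
have -> : n%:R * P - 2 * j = h 1.
  rewrite /h expr1n mul1r (eq_bigr (fun=> 1)); last by move=> i _; rewrite expr1n.
  by rewrite sumr_const card_ord.
apply: (cvgr_to_ge hc); near=> c; rewrite subr_ge0; apply: key.
by near: c; exact: nbhs_right_gt.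
Unshelve. all: by end_near. Qed.

(** The right side is the tangent at [1] of the concave function [x^s]; Young's inequality with
    exponents [1 / s] and [1 / (1 - s)] gives it without derivatives. *)
Lemma powR_le_tangent (x s : R) : 0 <= x -> 0 < s < 1 -> x `^ s <= s * x + (1 - s).
Proof.
move=> x0 /andP[s0 s1].
have := @conjugate_powR R (x `^ s) 1 s^-1 (1 - s)^-1 (powR_ge0 _ _) ler01.
rewrite !invrK subrKC !invr_gt0 subr_gt0 => /(_ s0 s1 erefl).
by rewrite mulr1 -powRrM divff ?gt_eqF// powRr1// powR1 mul1r mulrC.
Qed.

(** Jensen's inequality for [x^s], with [x = |t|^2] and the mean bounded by [a = n / 2]: the tangent
    bound is used at [x / a], so that only moments of order 0 and 2 occur. *)
Lemma gaussian_moment_le (s : R) : (0 < n)%N -> 0 < s < 1 ->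
  (\int[leb R n]_t (enorm (vec t) `^ (2 * s) * gaussian (vec t))%:E <=
   ((n%:R / 2) `^ s * P)%:E)%E.
Proof.
move=> n0 s01; have /andP[s0 s1] := s01; pose a : R := n%:R / 2.
have a0 : 0 < a by rewrite divr_gt0// ltr0n.
have mg := measurable_gaussian_row mvec.
have mJ : measurable_fun setT (fun t : n.-tuple (measurableTypeR R) =>
    (enorm (vec t) ^+ 2 * gaussian (vec t))%:E).
  apply/measurable_EFinP; apply: measurable_funM.
    by apply: measurable_funX; exact: measurable_enorm.
  exact: measurable_gaussian.
pose k1 := a `^ s * (s / a); pose k2 := a `^ s * (1 - s).
have k10 : 0 <= k1 by rewrite mulr_ge0 ?powR_ge0 ?divr_ge0// ltW.
have k20 : 0 <= k2 by rewrite mulr_ge0 ?powR_ge0 ?subr_ge0// ltW.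
apply: (@le_trans _ _ (k1%:E * \int[leb R n]_t (enorm (vec t) ^+ 2 * gaussian (vec t))%:E
   + k2%:E * \int[leb R n]_t (gaussian (vec t))%:E)%E); last first.
  rewrite integral_gaussian.
  apply: (@le_trans _ _ (k1%:E * (a * P)%:E + k2%:E * P%:E)%E).
    by rewrite leeD2r// lee_wpmul2l ?lee_fin//; exact: gaussian_moment2_le.
  rewrite -!EFinM -EFinD lee_fin le_eqVlt; apply/orP; left; apply/eqP.
  by rewrite /k1 /k2 -/a; field; rewrite gt_eqF.
rewrite -!ge0_integralZl//; last 2 first.
- by move=> t _; rewrite lee_fin gaussian_ge0.
- by move=> t _; rewrite lee_fin mulr_ge0 ?sqr_ge0 ?gaussian_ge0.
rewrite -ge0_integralD//; last 4 first.
- by move=> t _; rewrite -EFinM lee_fin mulr_ge0// mulr_ge0 ?sqr_ge0 ?gaussian_ge0.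
- exact: emeasurable_funM.
- by move=> t _; rewrite -EFinM lee_fin mulr_ge0 ?gaussian_ge0.
- exact: emeasurable_funM.
apply: ge0_le_integral => //.
- by move=> t _; rewrite lee_fin mulr_ge0 ?powR_ge0 ?gaussian_ge0.
- apply/measurable_EFinP; apply: measurable_funM; last exact: measurable_gaussian.
  exact: (measurableT_comp (measurable_powR _) (@measurable_enorm R n)).
- by apply: emeasurable_funD; exact: emeasurable_funM.
move=> t _; rewrite -!EFinM -EFinD lee_fin mulrA -mulrDl ler_wpM2r ?gaussian_ge0//.
set w := enorm _; have w0 : 0 <= w ^+ 2 / a by rewrite divr_ge0 ?sqr_ge0 ?ltW.
rewrite powRrM (powR_mulrn 2 (enorm_ge0 _)) -/w.
have -> : w ^+ 2 = a * (w ^+ 2 / a) by field; rewrite gt_eqF.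
rewrite powRM ?(ltW a0)//.
have -> : k1 * (a * (w ^+ 2 / a)) + k2 = a `^ s * (s * (w ^+ 2 / a) + (1 - s)).
  by rewrite /k1 /k2; field; rewrite gt_eqF.
by rewrite ler_wpM2l ?powR_ge0//; exact: powR_le_tangent.
Qed.

End gaussian_moments.

(** * Rotation invariance of pairs of Gaussian vectors *)

Section gaussian_rotation.
Context {R : realType} (n : nat).
Let P : R := pi `^ (n%:R / 2).
Let mvec : measurable_row (@vec R n) := @measurable_row_vec R n.

Let dot (u v : 'rV[R]_n) : R := (u *m v^T) 0 0.

(** Commuting symmetric [C] and [S] act as cosine and sine of a single angle, so the block matrix
    with rows [C, - S] and [S, C] is orthogonal. *)
Lemma enorm_rotation (C S : 'M[R]_n) (g h : 'rV[R]_n) : C^T = C -> S^T = S ->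
  C *m S = S *m C -> C *m C + S *m S = 1%:M ->
  enorm (g *m C + h *m S) ^+ 2 + enorm (h *m C - g *m S) ^+ 2 =
  enorm g ^+ 2 + enorm h ^+ 2.
Proof.
move=> Ct St CS CC.
have dotC u v : dot u v = dot v u.
  by rewrite /dot !mxE; apply: eq_bigr => i _; rewrite !mxE mulrC.
have dotD u v w : dot (u + v) w = dot u w + dot v w by rewrite /dot mulmxDl mxE.
have dotN u w : dot (- u) w = - dot u w by rewrite /dot mulNmx mxE.
have dotM u v M : M^T = M -> dot (u *m M) v = dot u (v *m M).
  by move=> Mt; rewrite /dot trmx_mul Mt mulmxA.
have sqr u v : dot (u + v) (u + v) = dot u u + 2 * dot u v + dot v v.
  by rewrite dotD !(dotC _ (u + v)) !dotD (dotC v u); ring.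
have sum v : dot (v *m C) (v *m C) + dot (v *m S) (v *m S) = dot v v.
  rewrite dotM// dotM// dotC (dotC v (_ *m S)) -dotD -!mulmxA -mulmxDr CC.
  by rewrite mulmx1.
have nE (v : 'rV_n) : enorm v ^+ 2 = dot v v by rewrite enorm_sqrE.
rewrite !nE -(sum g) -(sum h) !sqr.
have dotNr u v : dot u (- v) = - dot u v by rewrite dotC dotN dotC.
rewrite !dotNr dotN opprK.
have -> : dot (h *m C) (g *m S) = dot (g *m C) (h *m S).
  by rewrite dotC !dotM// -!mulmxA CS.
ring.
Qed.

(** The choice [C = A B^-1], [S = b B^-1] satisfies [C^2 + S^2 = 1] because [B^2 = A^2 + b^2], and
    [(g C + h S) B = g A + b h]. After this rotation the second vector only contributes the Gaussian
    mass [P]. *)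
Lemma double_integral_gaussian (A B : 'M[R]_n) (b : R) (Phi : 'rV[R]_n -> \bar R) :
  A^T = A -> B^T = B -> B \in unitmx -> A *m B = B *m A -> b != 0 ->
  B *m B = A *m A + (b ^+ 2)%:M ->
  measurable_fun setT (Phi \o @vec R n) -> (forall v, 0 <= Phi v)%E ->
  double_integral (fun g h => (gaussian g * gaussian h)%:E * Phi (g *m A + b *: h)%R)%E =
  (P%:E * \int[leb R n]_t ((gaussian (vec t))%:E * Phi (vec t *m B)))%E.
Proof.
move=> At Bt uB AB b0 BB mPhi Phi0.
pose C := A *m invmx B; pose S := b *: invmx B.
have uS : S \in unitmx by rewrite unitmxZ ?unitfE// unitmx_inv.
have AiB : A *m invmx B = invmx B *m A.
  by rewrite -[LHS]mul1mx -(mulVmx uB) -mulmxA (mulmxA B) -AB -mulmxA mulmxV// mulmx1.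
have iBt : (invmx B)^T = invmx B by rewrite trmx_inv Bt.
have Ct : C^T = C by rewrite /C trmx_mul At iBt AiB.
have St : S^T = S by rewrite /S linearZ /= iBt.
have CS : C *m S = S *m C.
  by rewrite /C /S -scalemxAr -scalemxAl [in RHS]mulmxA -AiB.
have CC : C *m C + S *m S = 1%:M.
  have -> : C *m C = A *m A *m (invmx B *m invmx B).
    by rewrite /C -(mulmxA A) (mulmxA (invmx B) A) -AiB !mulmxA.
  have -> : S *m S = (b ^+ 2)%:M *m (invmx B *m invmx B).
    by rewrite mul_scalar_mx /S -scalemxAr -scalemxAl scalerA -expr2.
  by rewrite -mulmxDl -BB mulmxA -(mulmxA B) mulmxV// mulmx1 mulmxV.
pose F (g h : 'rV[R]_n) := ((gaussian g * gaussian h)%:E * Phi (g *m B))%E.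
have F0 g h : (0 <= F g h)%E by rewrite mule_ge0// lee_fin mulr_ge0 ?gaussian_ge0.
have mgm d (D : measurableType d) (G H : D -> 'rV[R]_n) : measurable_row G -> measurable_row H ->
    measurable_fun setT (fun p => (gaussian (G p) * gaussian (H p))%:E).
  move=> mG mH; under eq_fun do rewrite EFinM.
  by apply: emeasurable_funM; exact: measurable_gaussian_row.
have mF : measurable_row2 F.
  apply: emeasurable_funM; first exact: mgm (@measurable_row_vec1 R n) (@measurable_row_vec2 R n).
  by apply: (measurable_comp_row mPhi); apply: measurable_rowM; exact: measurable_row_vec1.
transitivity (double_integral F).
  rewrite -(double_integral_rotation uS CS CC F0 mF); congr double_integral.
  apply/funext => g; apply/funext => h; rewrite /F; congr (_%:E * Phi _)%E.
    by rewrite /gaussian -!expRD -!opprD enorm_rotation.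
  rewrite mulmxDl /C /S -(mulmxA g) -(mulmxA A) mulVmx// mulmx1.
  by rewrite -!scalemxAr -scalemxAl -mulmxA mulVmx// mulmx1.
rewrite /double_integral /F.
under eq_integral => t _.
  under eq_integral => u _.
    rewrite EFinM -muleA [X in (_ * X)%E]muleC muleA.
    over.
  rewrite ge0_integralZl//; last 3 first.
  - exact: measurable_gaussian_row.
  - by move=> u _; rewrite lee_fin gaussian_ge0.
  - by rewrite mule_ge0// lee_fin gaussian_ge0.
  rewrite integral_gaussian; over.
rewrite ge0_integralZr//.
- by rewrite muleC.
- apply: emeasurable_funM; first exact: measurable_gaussian_row.
  by apply: (measurable_comp_row mPhi); exact: measurable_rowM.
- by move=> t _; rewrite mule_ge0// lee_fin gaussian_ge0.
- by rewrite lee_fin powR_ge0.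
Qed.

End gaussian_rotation.

Lemma measurable_invr {R : realType} d (D : measurableType d) (k : D -> R) :
  measurable_fun setT k -> measurable_fun setT (fun p => (k p)^-1).
Proof.
move=> mk; rewrite (_ : (fun p => _) = (fun p => k p * (k p ^+ 2)^-1)).
  apply: measurable_funM => //; apply: measurable_invr_ge0 => [p|].
    exact: sqr_ge0.
  exact: measurable_funX.
apply/funext => p; have [->|kp] := eqVneq (k p) 0; first by rewrite invr0 mul0r.
by field.
Qed.

(** * Polar coordinates through Gaussian averages *)

Section polar.
Context {R : realType} (n : nat) (s : R).
Hypothesis s01 : 0 < s < 1.
Let q : R := n%:R + 2 * s.
Let mvec : measurable_row (@vec R n) := @measurable_row_vec R n.
Let X := n.-tuple (measurableTypeR R).
Let T := measurableTypeR R.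

Let s0 : 0 < s. Proof. by case/andP: s01. Qed.
Let s1 : s < 1. Proof. by case/andP: s01. Qed.
Let q0 : 0 < q. Proof. by rewrite ltr_wpDl// mulr_gt0. Qed.

(** The kernel of [I_op]. As [1 + 2 s] is nonzero, the conventions for powers and inverses of [0]
    make it vanish at [r = 0], where dilation by [r] cannot be inverted. *)
Definition radial_weight (r : R) : R := (`|r| `^ (1 + 2 * s))^-1.

Lemma radial_weight_ge0 r : 0 <= radial_weight r.
Proof. by rewrite invr_ge0 powR_ge0. Qed.

Lemma measurable_radial_weight : measurable_fun setT (radial_weight : T -> R).
Proof.
apply: measurable_invr_ge0 => [r|]; first exact: powR_ge0.
by apply: (measurableT_comp (measurable_powR _)).
Qed.

(** Dilating [r] by [|v|] extracts the power of [|v|] and leaves [integral_inverse_gauss] with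
    exponent [q = n + 2 s]. This is how the kernel of [L_op] emerges from that of [I_op]. *)
Lemma kernel_ray_integral (v : 'rV[R]_n) : v != 0 ->
  (\int[lebesgue_measure]_r (`|r| ^- n * gaussian (r^-1 *: v) * radial_weight r)%:E =
   (enorm v `^ q)^-1%:E * gamma_int (q / 2))%E.
Proof.
move=> v0; have e0 : 0 < enorm v by rewrite enorm_gt0.
pose k (r : R) := expR (- (r ^- 2)) / `|r| `^ (q + 1).
have mk : measurable_fun setT (fun r : T => (k r)%:E).
  apply/measurable_EFinP; apply: measurable_funM.
    apply: measurableT_comp => //; apply: measurableT_comp => //.
    by apply: measurable_invr_ge0 => [r|]; [exact: sqr_ge0|exact: measurable_funX].
  apply: measurable_invr_ge0 => [r|]; first exact: powR_ge0.
  by apply: (measurableT_comp (measurable_powR _)).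
have k0 r : (0 <= (k r)%:E)%E.
  by rewrite lee_fin mulr_ge0 ?invr_ge0 ?powR_ge0 ?expR_ge0.
have kE (r : R) : `|r| ^- n * gaussian (r^-1 *: v) * radial_weight r =
    (enorm v `^ (q + 1))^-1 * k ((enorm v)^-1 * r + 0).
  rewrite addr0 /k /gaussian /radial_weight enormZ exprMn real_normK ?num_real//.
  have [->|r0] := eqVneq r 0.
    rewrite mulr0 normr0 !powR0 ?invr0 ?mulr0// gt_eqF//.
    by rewrite ltr_pwDl// mulr_ge0// ltW.
    by rewrite ltr_pwDl// mulr_ge0// ltW.
  rewrite normrM gtr0_norm ?invr_gt0// powRM// ?invr_ge0 ?ltW//.
  have -> : (enorm v)^-1 `^ (q + 1) = (enorm v `^ (q + 1))^-1.
    by rewrite -powR_inv1 ?ltW// -powRrM mulN1r powRN.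
  have -> : r^-1 ^+ 2 * enorm v ^+ 2 = ((enorm v)^-1 * r) ^- 2.
    by field; rewrite r0 gt_eqF.
  have -> : `|r| `^ (q + 1) = `|r| ^+ n * `|r| `^ (1 + 2 * s).
    rewrite -powR_mulrn// -powRD; last by rewrite normr_eq0 r0 implybT.
    by congr (_ `^ _); rewrite /q; ring.
  have rn : `|r| ^+ n != 0 by rewrite expf_neq0// normr_eq0.
  have rs : `|r| `^ (1 + 2 * s) != 0 by rewrite gt_eqF// powR_gt0// normr_gt0.
  have ev : enorm v `^ (q + 1) != 0 by rewrite gt_eqF// powR_gt0.
  move: (_ `^ (1 + _)) (_ `^ (q + 1)) (_ ^+ n) (expR _) rn rs ev => x y z w z0 x0 y0.
  by field; rewrite x0 y0 z0.
under eq_integral do rewrite kE EFinM.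
rewrite ge0_integralZl//; last 2 first.
- exact: (measurableT_comp mk (measurable_affine _ _)).
- by rewrite lee_fin invr_ge0 powR_ge0.
rewrite (ge0_integral_affine 0 (_ : (enorm v)^-1 != 0) mk)//; last first.
  by rewrite invr_eq0 gt_eqF.
rewrite integral_inverse_gauss// muleA -EFinM; congr (_%:E * _)%E.
rewrite gtr0_norm ?invr_gt0// invrK powRD; last by rewrite (gt_eqF e0) implybT.
by rewrite powRr1 ?ltW//; field; rewrite !gt_eqF ?powR_gt0.
Qed.

(** No measure on the sphere is involved: Tonelli puts the [r]-integral outside, [t = r g] is
    substituted for each fixed [r] at the price of [|r|^-n], and after exchanging again the
    [r]-integral is explicit. The point [t = 0] is covered by [f 0 = 0]. *)
Lemma ge0_polar_gaussian (f : 'rV[R]_n -> R) :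
  measurable_fun setT (f \o @vec R n) -> (forall v, 0 <= f v) -> f 0 = 0 ->
  (\int[leb R n]_g ((gaussian (vec g))%:E *
      \int[lebesgue_measure]_r (f (r *: vec g) * radial_weight r)%:E) =
  gamma_int (q / 2) * \int[leb R n]_t (f (vec t) / enorm (vec t) `^ q)%:E)%E.
Proof.
move=> mf f0 f00.
have mraw : measurable_row (fun p : X * T => p.2 *: vec p.1 : 'rV[R]_n).
  by apply: measurable_rowZ => //; exact: measurable_row_vec_comp.
have mw : measurable_fun setT (fun p : X * T => radial_weight p.2).
  exact: (measurableT_comp measurable_radial_weight).
have mg (k : X * T -> R) : measurable_fun setT k ->
    measurable_fun setT (fun p : X * T => gaussian (k p *: vec p.1 : 'rV[R]_n)).
  move=> mk; apply: (measurable_comp_row (@measurable_gaussian R n)).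
  by apply: measurable_rowZ => //; exact: measurable_row_vec_comp.
have minv : measurable_fun setT (fun p : X * T => (`|p.2| ^- n)).
  apply: measurable_invr_ge0 => [p|]; first exact: exprn_ge0.
  by apply: measurable_funX; apply: measurableT_comp.
pose H (p : X * T) := (gaussian (vec p.1) * (f (p.2 *: vec p.1) * radial_weight p.2))%:E.
have mH : measurable_fun setT H.
  apply/measurable_EFinP; apply: measurable_funM.
    apply: (measurable_comp_row (@measurable_gaussian R n)).
    exact: measurable_row_vec_comp.
  by apply: measurable_funM => //; exact: (measurable_comp_row mf).
have H0 p : (0 <= H p)%E.
  by rewrite lee_fin mulr_ge0 ?gaussian_ge0// mulr_ge0 ?radial_weight_ge0.
pose K (p : X * T) := (`|p.2| ^- n *
  (gaussian (p.2^-1 *: vec p.1) * (f (vec p.1) * radial_weight p.2)))%:E.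
have mK : measurable_fun setT K.
  apply/measurable_EFinP; apply: measurable_funM => //; apply: measurable_funM.
    by apply: mg; apply: measurable_invr.
  apply: measurable_funM => //; apply: (measurable_comp_row mf).
  exact: measurable_row_vec_comp.
have K0 p : (0 <= K p)%E.
  rewrite lee_fin mulr_ge0 ?invr_ge0 ?exprn_ge0// mulr_ge0 ?gaussian_ge0//.
  by rewrite mulr_ge0 ?radial_weight_ge0.
transitivity (\int[leb R n]_g \int[lebesgue_measure]_r H (g, r))%E.
  apply: eq_integral => g _; rewrite -ge0_integralZl//.
  - apply/measurable_EFinP; apply: measurable_funM; last exact: measurable_radial_weight.
    by apply: (measurable_comp_row mf); apply: measurable_rowZ.
  - by move=> r _; rewrite lee_fin mulr_ge0 ?radial_weight_ge0.
  - by rewrite lee_fin gaussian_ge0.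
rewrite fubini_tonelli//.
transitivity (\int[lebesgue_measure]_r \int[leb R n]_g K (g, r))%E.
  apply: eq_integral => r _; have [->|r0] := eqVneq r 0.
    have w0 : radial_weight 0 = 0.
      by rewrite /radial_weight normr0 powR0 ?invr0// gt_eqF// ltr_pwDl// mulr_ge0// ltW.
    rewrite !integral0_eq// => g _; rewrite /K /H /= w0 ?mulr0//.
  pose F v := (gaussian (r^-1 *: v) * (f v * radial_weight r))%:E.
  have F0 v : (0 <= F v)%E.
    by rewrite lee_fin mulr_ge0 ?gaussian_ge0// mulr_ge0 ?radial_weight_ge0.
  have mF : measurable_fun setT (F \o @vec R n).
    apply/measurable_EFinP; apply: measurable_funM.
      apply: (measurable_comp_row (@measurable_gaussian R n)).
      exact: measurable_rowZ.
    exact: measurable_funM.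
  transitivity (\int[leb R n]_g F (r *: vec g + 0)%R)%E.
    apply: eq_integral => g _; rewrite /F /H /= addr0 scalerA mulVf// scale1r //.
  by rewrite ge0_integral_leb_affine// -ge0_integralZl.
rewrite -fubini_tonelli//.
have mfq : measurable_fun setT (fun t : X => (f (vec t) / enorm (vec t) `^ q)%:E).
  apply/measurable_EFinP; apply: measurable_funM => //; apply: measurable_invr.
  exact: (measurableT_comp (measurable_powR _) (@measurable_enorm R n)).
rewrite -ge0_integralZl//; last 2 first.
- by move=> t _; rewrite lee_fin mulr_ge0// invr_ge0 powR_ge0.
- by apply: integral_ge0 => x _; rewrite lee_fin expR_ge0.
apply: eq_integral => t _; rewrite /K /=.
have [vt|vt] := eqVneq (vec t) 0.
  by rewrite vt f00 mul0r mule0 integral0_eq// => r _; rewrite mul0r !mulr0.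
rewrite EFinM muleCA [X in _ = (_ * X)%E]muleC -kernel_ray_integral// -ge0_integralZl//.
- apply: eq_integral => r _; rewrite -EFinM; congr EFin.
  by move: (_ ^- n) (gaussian _) (radial_weight r) => *; ring.
- apply/measurable_EFinP; apply: measurable_funM; last exact: measurable_radial_weight.
  apply: measurable_funM.
    apply: measurable_invr; apply: measurable_funX; exact: normr_measurable.
  apply: (measurable_comp_row (@measurable_gaussian R n)).
  by apply: measurable_rowZ => //; apply: measurable_invr.
- by move=> r _; rewrite lee_fin mulr_ge0 ?radial_weight_ge0// mulr_ge0 ?gaussian_ge0.
- by rewrite lee_fin.
Qed.

Lemma gamma_int_gt0 (a : R) : 0 < a -> (0 < gamma_int a)%E.
Proof.
move=> a0; apply: lt_le_trans (gamma_int_ge a0 (ltr01 : 0 < 1)).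
by rewrite lte_fin divr_gt0// mulr_gt0 ?expR_gt0// powR_gt0.
Qed.

Lemma integrable_levy_line :
  (\int[lebesgue_measure]_r (r ^+ 2 / (1 + r ^+ 2) * radial_weight r)%:E < +oo)%E.
Proof.
have sq (r : R) : 0 < 1 + r ^+ 2 by rewrite ltr_pwDl// sqr_ge0.
have mf : measurable_fun setT (fun r : T => (r ^+ 2 / (1 + r ^+ 2) * radial_weight r)%:E).
  apply/measurable_EFinP; apply: measurable_funM; last exact: measurable_radial_weight.
  apply: measurable_funM; first exact: measurable_funX.
  apply: measurable_invr_ge0 => [r|]; first by rewrite ltW.
  by apply: measurable_funD => //; exact: measurable_funX.
rewrite ge0_integral_even//; last 2 first.
- move=> r; rewrite lee_fin mulr_ge0 ?radial_weight_ge0// mulr_ge0 ?sqr_ge0//.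
  by rewrite invr_ge0 ltW.
- by move=> r; rewrite /radial_weight sqrrN normrN.
rewrite [X in (_ * X)%E](_ : _ = \int[lebesgue_measure]_(r in `]0%R, +oo[)
    (r ^+ 2 / (1 + r ^+ 2) / r `^ (1 + 2 * s))%:E)%E; last first.
  apply: eq_integral => r; rewrite inE /= in_itv /= andbT => r0.
  by rewrite /radial_weight gtr0_norm.
rewrite ge0_integral_expR; last 2 first.
- move=> r r0; apply: cvgM; last first.
    by apply: cvgV; [rewrite gt_eqF// powR_gt0|exact: continuous_powR].
  apply: cvgM; first exact: exprn_continuous.
  apply: cvgV; first by rewrite gt_eqF.
  by apply: cvgD; [exact: cvg_cst|exact: exprn_continuous].
- move=> r r0; rewrite mulr_ge0 ?invr_ge0 ?powR_ge0// mulr_ge0 ?sqr_ge0//.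
  by rewrite invr_ge0 ltW.
(* After [r = exp x] the integrand decays like [exp (- 2 s x)] at [+oo] and like [exp ((2 - 2 s) x)]
   at [-oo]; [a] is the slower of the two rates. *)
pose a := Num.min (2 * s) (2 - 2 * s).
have a0 : 0 < a by rewrite lt_min mulr_gt0//= subr_gt0 gtr_pMr.
apply: (@le_lt_trans _ _ (2%:E * \int[lebesgue_measure]_x (expR (- (a * `|x|)))%:E)%E); last first.
  by rewrite integral_expR_abs// -EFinM ltry.
have bound (x : R) : expR x ^+ 2 / (1 + expR x ^+ 2) / expR x `^ (1 + 2 * s) * expR x <=
    expR (- (a * `|x|)).
  have -> : expR x ^+ 2 / (1 + expR x ^+ 2) / expR x `^ (1 + 2 * s) * expR x =
      (1 + expR x ^+ 2)^-1 * expR ((2 - 2 * s) * x).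
    rewrite -expRM -expRM_natl -expRN.
    rewrite [expR (2 * x) / _]mulrC -!mulrA -!expRD; congr (_ * expR _); ring.
  have a1 : a <= 2 * s by rewrite ge_min lexx.
  have a2 : a <= 2 - 2 * s by rewrite ge_min lexx orbT.
  have [x0|x0] := lerP 0 x.
    rewrite ger0_norm// (@le_trans _ _ ((expR x ^+ 2)^-1 * expR ((2 - 2 * s) * x)))//.
      by rewrite ler_wpM2r ?expR_ge0// lef_pV2 ?posrE ?exprn_gt0 ?expR_gt0// lerDr.
    by rewrite -expRM_natl -expRN -expRD ler_expR; nra.
  rewrite ltr0_norm// (@le_trans _ _ (1 * expR ((2 - 2 * s) * x)))//.
    by rewrite ler_wpM2r ?expR_ge0// invf_le1 ?sq// lerDl sqr_ge0.
  by rewrite mul1r ler_expR; nra.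
rewrite lee_wpmul2l//; apply: ge0_le_integral => //.
- have mE : measurable_fun setT (fun x : T => expR x) by exact: measurable_expR.
  apply/measurable_EFinP; apply: measurable_funM => //; apply: measurable_funM.
    apply: measurable_funM; first exact: measurable_funX.
    by apply: measurable_invr; apply: measurable_funD => //; exact: measurable_funX.
  by apply: measurable_invr; exact: (measurableT_comp (measurable_powR _) mE).
- apply/measurable_EFinP; apply: measurableT_comp => //.
  by apply: measurableT_comp => //; apply: measurable_funM.
- by move=> x _; rewrite lee_fin.
Qed.

(** The polar identity reduces this to the line: the ray integral of [|v|^2 / (1 + |v|^2)] is at
    most [|v|^(2 s)] times the one-dimensional integral, up to nothing but a change of cutoff, and
    the Gaussian moment of order [2 s] is finite. *)
Lemma levy_kernel_lty : (0 < n)%N ->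
  (\int[leb R n]_t (enorm (vec t) ^+ 2 / (1 + enorm (vec t) ^+ 2) /
     enorm (vec t) `^ q)%:E < +oo)%E.
Proof.
move=> n0; set J := (\int[leb R n]_t _)%E.
have sq (v : 'rV[R]_n) : 0 < 1 + enorm v ^+ 2 by rewrite ltr_pwDl// sqr_ge0.
pose f (v : 'rV[R]_n) := enorm v ^+ 2 / (1 + enorm v ^+ 2).
have f0 v : 0 <= f v by rewrite mulr_ge0 ?sqr_ge0// invr_ge0 ltW.
have f00 : f 0 = 0.
  have /eqP e0 : enorm (0 : 'rV[R]_n) == 0 by rewrite enorm_eq0.
  by rewrite /f e0 expr0n mul0r.
have mf : measurable_fun setT (f \o @vec R n).
  apply: measurable_funM; first by apply: measurable_funX; exact: measurable_enorm.
  apply: measurable_invr_ge0 => [t|]; first by rewrite ltW.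
  by apply: measurable_funD => //; apply: measurable_funX; exact: measurable_enorm.
have J0 : (0 <= J)%E.
  by apply: integral_ge0 => t _; rewrite lee_fin mulr_ge0 ?invr_ge0 ?powR_ge0// f0.
have := ge0_polar_gaussian mf f0 f00; rewrite -/J.
set I1 := (\int[lebesgue_measure]_r (r ^+ 2 / (1 + r ^+ 2) * radial_weight r)%:E)%E.
have I1fin := integrable_levy_line; rewrite -/I1 in I1fin.
have k0 (r : R) : (0 <= (r ^+ 2 / (1 + r ^+ 2) * radial_weight r)%:E)%E.
  rewrite lee_fin mulr_ge0 ?radial_weight_ge0// mulr_ge0 ?sqr_ge0//.
  by rewrite invr_ge0 addr_ge0// sqr_ge0.
have mk : measurable_fun setT (fun r : T => (r ^+ 2 / (1 + r ^+ 2) * radial_weight r)%:E).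
  apply/measurable_EFinP; apply: measurable_funM; last exact: measurable_radial_weight.
  apply: measurable_funM; first exact: measurable_funX.
  by apply: measurable_invr; apply: measurable_funD => //; exact: measurable_funX.
have I10 : (0 <= I1)%E by exact: integral_ge0.
have inner (v : 'rV[R]_n) : (\int[lebesgue_measure]_r (f (r *: v) * radial_weight r)%:E =
    (enorm v `^ (2 * s))%:E * I1)%E.
  have [->|v0] := eqVneq v 0.
    have -> : enorm (0 : 'rV[R]_n) = 0 by apply/eqP; rewrite enorm_eq0.
    rewrite powR0 ?mul0e; last by rewrite gt_eqF// mulr_gt0.
    by rewrite integral0_eq// => r _; rewrite scaler0 f00 mul0r.
  have e0 : 0 < enorm v by rewrite enorm_gt0.
  have := @ge0_integral_affine R (enorm v) 0 _ (lt0r_neq0 e0) mk k0.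
  rewrite -/I1 => h.
  have -> : ((enorm v `^ (2 * s))%:E * I1 = (enorm v `^ (1 + 2 * s))%:E *
     ((`|enorm v|^-1)%:E * I1))%E.
    rewrite muleA -EFinM; congr (_%:E * _)%E; rewrite gtr0_norm// powRD; last first.
      by rewrite (gt_eqF e0) implybT.
    by rewrite powRr1 ?ltW//; field; rewrite gt_eqF.
  rewrite -h -ge0_integralZl//; last 2 first.
  - exact: (measurableT_comp mk (measurable_affine _ _)).
  - by rewrite lee_fin powR_ge0.
  apply: eq_integral => r _; rewrite -EFinM; congr EFin.
  rewrite /f enormZ addr0 /radial_weight normrM gtr0_norm// powRM//; last by rewrite ltW.
  rewrite !exprMn real_normK ?num_real// [_ ^+ 2 * _]mulrC invfM.
  rewrite [RHS]mulrCA; congr (_ * _).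
  by rewrite mulrA divff ?mul1r// gt_eqF// powR_gt0.
under eq_integral do rewrite inner muleA.
have mm : measurable_fun setT (fun t : X =>
    ((gaussian (vec t))%:E * (enorm (vec t) `^ (2 * s))%:E)%E).
  apply: emeasurable_funM; first exact: measurable_gaussian_row.
  apply/measurable_EFinP.
  exact: (measurableT_comp (measurable_powR _) (@measurable_enorm R n)).
rewrite ge0_integralZr//; last first.
  by move=> t _; rewrite -EFinM lee_fin mulr_ge0 ?gaussian_ge0 ?powR_ge0.
move=> h.
have : (gamma_int (q / 2) * J < +oo)%E.
  rewrite -h; apply: lte_mul_pinfty => //.
    by apply: integral_ge0 => t _; rewrite -EFinM lee_fin mulr_ge0 ?gaussian_ge0 ?powR_ge0.
  rewrite ge0_fin_numE; last first.
    by apply: integral_ge0 => t _; rewrite -EFinM lee_fin mulr_ge0 ?gaussian_ge0 ?powR_ge0.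
  under eq_integral do rewrite -EFinM mulrC.
  by rewrite (le_lt_trans (gaussian_moment_le n0 s01))// ltry.
apply: contraTT; rewrite -!leNgt !leye_eq => /eqP ->.
by rewrite gt0_muley// gamma_int_gt0// divr_gt0.
Qed.

End polar.

(** * Functional calculus on the set A_2 *)

Section functional_calculus.
Context {R : realType}.

Lemma sum_sqr_mulmx_tr_eq0 n (v : 'rV[R]_n) : (v *m v^T) 0 0 = 0 -> v = 0.
Proof.
rewrite mxE => /eqP; rewrite psumr_eq0 => [/allP h|i _]; last first.
  by rewrite mxE -expr2 sqr_ge0.
apply/rowP => i; rewrite [RHS]mxE; apply/eqP; rewrite -sqrf_eq0 expr2.
by have := h i (mem_index_enum i); rewrite mxE.
Qed.

Lemma symmetric_sqr_eq0 n (B : 'M[R]_n) : B^T = B -> B *m B = 0 -> B = 0.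
Proof.
move=> Bt BB; apply/row_matrixP => i; rewrite row0 rowE.
apply: sum_sqr_mulmx_tr_eq0.
by rewrite trmx_mul Bt mulmxA -(mulmxA (delta_mx 0 i) B B) BB mulmx0 mul0mx mxE.
Qed.

Lemma trmx_horner_mx n (A : 'M[R]_n.+1) p : A^T = A ->
  (horner_mx A p)^T = horner_mx A p.
Proof.
move=> At; elim/poly_ind: p => [|p c IH]; first by rewrite raddf0 trmx0.
rewrite raddfD /= rmorphM /= horner_mx_X horner_mx_C linearD /= tr_scalar_mx.
congr (_ + _); rewrite -mulmxE trmx_mul At IH.
exact: (comm_mx_horner _ (comm_mx_refl A)).
Qed.

(** The exponent is enlarged to a power of two, then halved repeatedly: a symmetric matrix of square
    zero has rows of norm zero. *)
Lemma symmetric_nilpotent_eq0 n (B : 'M[R]_n.+1) k : B^T = B -> B ^+ k = 0 -> B = 0.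
Proof.
move=> Bt Bk; have {}Bk : B ^+ (2 ^ k) = 0.
  by rewrite -(subnK (ltnW (ltn_expl k (ltnSn 1)))) exprD Bk mulr0.
have BXt m : (B ^+ m)^T = B ^+ m.
  elim: m => [|m IH]; first by rewrite expr0 trmx1.
  by rewrite {1}exprS -mulmxE trmx_mul IH Bt mulmxE -exprSr.
elim: k Bk => [|k IH]; first by rewrite expn0 expr1.
rewrite expnS mulnC exprM expr2 -mulmxE => h.
by apply: IH; exact: symmetric_sqr_eq0 h.
Qed.

(** Let [Q] have the distinct eigenvalues as simple roots. By Cayley-Hamilton [Q(A)] is nilpotent,
    and it is symmetric, hence zero; so the minimal polynomial splits with simple roots. Nothing is
    claimed about orthogonality of [P]. *)
Lemma symmetric_diag n (A : 'M[R]_n.+1) (l : 'rV[R]_n.+1) :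
  A^T = A -> eigenvalues_mult A l ->
  exists2 P : 'M[R]_n.+1, P \in unitmx &
    exists d : 'rV[R]_n.+1, A = invmx P *m diag_mx d *m P.
Proof.
move=> At Al; pose rs := undup [seq l 0 i | i <- enum 'I_n.+1].
pose Q := \prod_(x <- rs) ('X - x%:P).
have lQ i : 'X - (l 0 i)%:P %| Q.
  rewrite dvdp_XsubCl /Q root_prod_XsubC mem_undup.
  by apply/mapP; exists i; rewrite ?mem_enum.
have QA : horner_mx A Q = 0.
  apply: (@symmetric_nilpotent_eq0 _ _ n.+1); first exact: trmx_horner_mx.
  rewrite -rmorphXn /=; apply/eqP; rewrite -dvd_mxminpoly.
  apply: (dvdp_trans (mxminpoly_dvd_char A)); rewrite Al.
  rewrite -[X in Q ^+ X]card_ord -prodr_const.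
  by apply: (big_ind2 (fun p q => p %| q)) => // *; exact: dvdp_mul.
have [P uP] : diagonalizable A.
  by apply/diagonalizableP; exists rs; rewrite ?undup_uniq// dvd_mxminpoly QA.
move=> /(diagonalizable_forLR uP)[d Ad].
by exists P => //; exists d; rewrite Ad mxpoly.conjVmx.
Qed.

Section conjugation.
Context n (A P : 'M[R]_n.+1) (d l : 'rV[R]_n.+1).
Hypotheses (At : A^T = A) (Al : eigenvalues_mult A l) (uP : P \in unitmx).
Hypothesis AE : A = invmx P *m diag_mx d *m P.

(** The matrix [phi(A)], computed in the fixed diagonalisation. The diagonal [d] and the given list
    [l] of eigenvalues agree up to order only. *)
Definition fun_mx (phi : R -> R) : 'M[R]_n.+1 :=
  invmx P *m diag_mx (map_mx phi d) *m P.

Lemma fun_mx_id : fun_mx id = A.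
Proof. by rewrite /fun_mx map_mx_id_in. Qed.

Lemma fun_mxM phi psi : fun_mx phi *m fun_mx psi = fun_mx (fun x => phi x * psi x).
Proof.
rewrite /fun_mx !mulmxA mulmxK// -(mulmxA _ (diag_mx _) (diag_mx _)) mulmx_diag.
by congr (_ *m diag_mx _ *m _); apply/rowP => i; rewrite !mxE.
Qed.

Lemma fun_mxD phi psi : fun_mx phi + fun_mx psi = fun_mx (fun x => phi x + psi x).
Proof.
rewrite /fun_mx -mulmxDl -mulmxDr -linearD /=; congr (_ *m diag_mx _ *m _).
by apply/rowP => i; rewrite !mxE.
Qed.

Lemma fun_mx_cst (c : R) : fun_mx (fun=> c) = c%:M.
Proof.
rewrite /fun_mx (_ : diag_mx _ = c%:M); last first.
  by rewrite -diag_const_mx; congr diag_mx; apply/rowP => i; rewrite !mxE.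
by rewrite -scalemx1 -scalemxAr mulmx1 -scalemxAl mulVmx.
Qed.

(** As [P] may fail to be orthogonal, symmetry is read off [G = P P^T]: symmetry of [A] says that
    [G] commutes with [diag d], so [G i j = 0] unless [d i = d j], and then [G] commutes with
    [diag (phi d)] too. *)
Lemma fun_mx_sym phi : (fun_mx phi)^T = fun_mx phi.
Proof.
pose G := P *m P^T.
have GD : G *m diag_mx d = diag_mx d *m G.
  have : P *m A^T *m P^T = P *m A *m P^T by rewrite At.
  rewrite AE !trmx_mul tr_diag_mx trmx_inv !mulmxA mulmxV// mul1mx.
  by rewrite -!mulmxA mulVmx ?unitmx_tr// mulmx1 !mulmxA.
have GDphi : G *m diag_mx (map_mx phi d) = diag_mx (map_mx phi d) *m G.
  apply/matrixP => i j; move/matrixP/(_ i j) : GD.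
  rewrite !mul_mx_diag !mul_diag_mx !mxE => h.
  have [->|dij] := eqVneq (d 0 i) (d 0 j); first by rewrite mulrC.
  suff -> : \sum_k P i k * P^T k j = 0 by rewrite mul0r mulr0.
  apply/eqP; rewrite mulrC in h.
  move/eqP: h; rewrite -subr_eq0 -mulrBl mulf_eq0 subr_eq0 eq_sym.
  by rewrite (negbTE dij).
rewrite /fun_mx !trmx_mul tr_diag_mx trmx_inv mulmxA.
apply: (@row_free_inj _ _ _ _ P^T); first by rewrite row_free_unit unitmx_tr.
rewrite mulmxKV ?unitmx_tr//.
apply: (can_inj (mulKmx uP)).
by rewrite !mulmxA -/G GDphi mulmxV// mul1mx -mulmxA.
Qed.

Lemma fun_mx_comm phi : A *m fun_mx phi = fun_mx phi *m A.
Proof.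
rewrite -[A]fun_mx_id !fun_mxM; congr fun_mx.
by apply/funext => x; rewrite mulrC.
Qed.

Lemma char_poly_fun_mx phi : char_poly (fun_mx phi) = \prod_i ('X - (phi (d 0 i))%:P).
Proof.
have -> : char_poly (fun_mx phi) = char_poly (diag_mx (map_mx phi d)).
  rewrite /char_poly /char_poly_mx /fun_mx.
  set D := diag_mx _.
  have -> : 'X%:M - map_mx polyC (invmx P *m D *m P) =
      map_mx polyC (invmx P) *m ('X%:M - map_mx polyC D) *m map_mx polyC P.
    rewrite mulmxBr mulmxBl !map_mxM; congr (_ - _).
    by rewrite mul_mx_scalar -scalemxAl -map_mxM mulVmx// map_mx1 scalemx1.
  rewrite !det_mulmx mulrC mulrA -det_mulmx -map_mxM mulmxV//.
  by rewrite map_mx1 det1 mul1r.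
rewrite char_poly_trig ?diag_mx_is_trig//.
by apply: eq_bigr => i _; rewrite !mxE eqxx mulr1n.
Qed.

Lemma eigenvalues_perm :
  perm_eq [seq d 0 i | i <- enum 'I_n.+1] [seq l 0 i | i <- enum 'I_n.+1].
Proof.
apply: prod_XsubC_eq; rewrite !big_image /= -Al -fun_mx_id.
by rewrite char_poly_fun_mx.
Qed.

Lemma eigenvalues_perm_map (phi : R -> R) :
  perm_eq [seq phi (d 0 i) | i <- enum 'I_n.+1] [seq phi (l 0 i) | i <- enum 'I_n.+1].
Proof.
rewrite (map_comp phi (fun i => d 0 i)) (map_comp phi (fun i => l 0 i)).
exact: perm_map eigenvalues_perm.
Qed.

Lemma eigenvalues_fun_mx phi : eigenvalues_mult (fun_mx phi) (map_mx phi l).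
Proof.
rewrite /eigenvalues_mult char_poly_fun_mx.
have : \prod_(x <- [seq phi (d 0 i) | i <- enum 'I_n.+1]) ('X - x%:P) =
    \prod_(x <- [seq phi (l 0 i) | i <- enum 'I_n.+1]) ('X - x%:P).
  exact: perm_big (eigenvalues_perm_map phi).
rewrite !big_image /= => ->.
by apply: eq_bigr => i _; rewrite mxE.
Qed.

Lemma mxtrace_fun_mx phi : \tr (fun_mx phi) = \sum_i phi (l 0 i).
Proof.
rewrite /fun_mx mxtrace_mulC mulmxA mulmxV// mul1mx mxtrace_diag.
have : \sum_(x <- [seq phi (d 0 i) | i <- enum 'I_n.+1]) x =
    \sum_(x <- [seq phi (l 0 i) | i <- enum 'I_n.+1]) x.
  exact: perm_big (eigenvalues_perm_map phi).
rewrite !big_image /= => <-.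
by apply: eq_bigr => i _; rewrite mxE.
Qed.

Lemma fun_mx_unit phi : (forall x, phi x != 0) -> fun_mx phi \in unitmx.
Proof.
move=> phi0; suff /mulmx1_unit[] : fun_mx phi *m fun_mx (fun x => (phi x)^-1) = 1%:M by [].
rewrite fun_mxM -fun_mx_cst; congr fun_mx.
by apply/funext => x; rewrite divff.
Qed.

(** [phi(A)] is the square of the symmetric invertible matrix [r(A)] with [r = sqrt phi], so its
    quadratic form at [v] is the squared norm of [v r(A)]. *)
Lemma fun_mx_spd phi : (forall x, 0 < phi x) -> spd (fun_mx phi).
Proof.
move=> phi0; split; first exact: fun_mx_sym.
move=> v v0; pose r x := Num.sqrt (phi x).
have -> : fun_mx phi = fun_mx r *m fun_mx r.
  by rewrite fun_mxM; congr fun_mx; apply/funext => x; rewrite -expr2 sqr_sqrtr// ltW.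
have ur : fun_mx r \in unitmx by apply: fun_mx_unit => x; rewrite gt_eqF// sqrtr_gt0.
rewrite mulmxA -[X in _ *m X *m _]fun_mx_sym -mulmxA -trmx_mul.
set w := v *m _; have w0 : w != 0.
  by apply: contra_neq v0 => w0; rewrite -(mulmxK ur v) -/w w0 mul0mx.
rewrite lt_def; apply/andP; split.
  by apply: contra_neq w0; exact: sum_sqr_mulmx_tr_eq0.
by rewrite mxE sumr_ge0// => i _; rewrite [w^T _ _]mxE -expr2 sqr_ge0.
Qed.

End conjugation.

Lemma sigma2_sqr n (z : 'rV[R]_n) :
  2 * sigma2 z = sigma1 z ^+ 2 - \sum_i z 0 i ^+ 2.
Proof.
have E : sigma1 z ^+ 2 = \sum_i \sum_j z 0 i * z 0 j.
  by rewrite expr2 /sigma1 mulr_suml; apply: eq_bigr => i _; rewrite mulr_sumr.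
have split3 i : \sum_j z 0 i * z 0 j = \sum_(j < n | (i < j)%N) z 0 i * z 0 j +
    (\sum_(j < n | (j < i)%N) z 0 i * z 0 j + z 0 i ^+ 2).
  rewrite (bigID (fun j : 'I_n => (i < j)%N)) /=; congr (_ + _).
  rewrite (bigD1 i) /= ?ltnn// addrC -expr2; congr (_ + _).
  by apply: eq_bigl => j; rewrite -leqNgt ltn_neqAle andbC.
rewrite E (eq_bigr _ (fun i _ => split3 i)) !big_split /= addrA addrK.
rewrite -/(sigma2 z) [X in _ = _ + X](_ : _ = sigma2 z); first by ring.
rewrite /sigma2 (exchange_big_dep xpredT)//=.
by apply: eq_bigr => i _; apply: eq_bigr => j _; rewrite mulrC.
Qed.

Lemma sigma2_shift n (z : 'rV[R]_n) (tau : R) :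
  sigma2 (z + const_mx tau) =
  sigma2 z + (n%:R - 1) * tau * sigma1 z + n%:R * (n%:R - 1) / 2 * tau ^+ 2.
Proof.
have s1 : sigma1 (z + const_mx tau) = sigma1 z + n%:R * tau.
  rewrite /sigma1; under eq_bigr do rewrite !mxE.
  by rewrite big_split /= sumr_const card_ord mulr_natl.
have s2 : \sum_i (z + const_mx tau) 0 i ^+ 2 =
    \sum_i z 0 i ^+ 2 + 2 * tau * sigma1 z + n%:R * tau ^+ 2.
  have -> : n%:R * tau ^+ 2 = \sum_(i < n) tau ^+ 2.
    by rewrite sumr_const card_ord mulr_natl.
  rewrite /sigma1 mulr_sumr -!big_split /=.
  by apply: eq_bigr => i _ /=; rewrite !mxE; ring.
have h := sigma2_sqr (z + const_mx tau); rewrite s1 s2 in h.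
have h' := sigma2_sqr z.
have -> : sigma2 (z + const_mx tau) = 2 * sigma2 (z + const_mx tau) / 2 by field.
have e : \sum_i z 0 i ^+ 2 = sigma1 z ^+ 2 - 2 * sigma2 z.
  by rewrite h' opprB addrC subrK.
by rewrite h e; field.
Qed.

Lemma sigma1_minus n (z : 'rV[R]_n) i : \sum_(j < n | j != i) z 0 j = sigma1 z - z 0 i.
Proof. by rewrite /sigma1 [in RHS](bigD1 i)//= addrAC subrr add0r. Qed.

Lemma frob_sqr n (A : 'M[R]_n) : A^T = A -> frob A ^+ 2 = \tr (A *m A).
Proof.
move=> At; rewrite sqr_sqrtr// -{2}At mxtrace_mulC; apply: sumr_ge0 => i _.
by rewrite mxE sumr_ge0// => j _; rewrite mxE -expr2 sqr_ge0.
Qed.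

(* [B] is the square root of [A^2 + t]; passing from [A] to [B] adds
   [t / (n - 1)] to every [zeta_j], so that [sigma2] gains at least
   [t * sigma1], and [c *: B] is the rescaling of [B] to [sigma2 = 1]. *)
Lemma A2_sqrt_shift n (A : 'M[R]_n) (t : R) : (3 <= n)%N -> A2 A -> 0 < t ->
  exists B c, [/\ B^T = B, B \in unitmx, A *m B = B *m A &
    B *m B = A *m A + t%:M] /\
    [/\ 0 < c, A2 (c *: B) & t * frob A ^+ 2 / (n%:R - 1) <= c ^- 4].
Proof.
case: n A => [//|n] A n3 [spdA [l [Al [z [[z1 z2] sz lz]]]]] t0.
have At := spdA.1.
have [P uP [d AE]] := symmetric_diag At Al.
pose phi (x : R) := Num.sqrt (x ^+ 2 + t).
have x0 (x : R) : 0 < x ^+ 2 + t by rewrite ltr_wpDl// sqr_ge0.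
have phi2 x : phi x ^+ 2 = x ^+ 2 + t by rewrite sqr_sqrtr// ltW.
have phi0 x : 0 < phi x by rewrite sqrtr_gt0.
pose N : R := n.+1%:R - 1.
have NE : N = n%:R by rewrite /N -natr1 addrK.
have N0 : 0 < N by rewrite NE ltr0n; move: n3; case: (n).
pose tau := t / N; pose z' := z + const_mx tau.
pose S := sigma2 z'.
(* Each [zeta_j] occurs in all but one of the sums [lambda_i^2]. *)
have frobA : frob A ^+ 2 = N * sigma1 z.
  rewrite frob_sqr// -{1 2}(fun_mx_id AE) (fun_mxM _ uP) (mxtrace_fun_mx Al uP AE).
  under eq_bigr do rewrite -expr2 lz sigma1_minus.
  rewrite sumrB sumr_const card_ord -/(sigma1 z) -[sigma1 z *+ _]mulr_natl /N; ring.
have Sge : t * sigma1 z <= S.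
  have -> : t * sigma1 z = N * tau * sigma1 z by rewrite /tau; field; rewrite gt_eqF.
  rewrite /S sigma2_shift sz -/N -addrA addrCA lerDl addr_ge0// mulr_ge0 ?sqr_ge0//.
  by rewrite divr_ge0// mulr_ge0// ltW.
have S0 : 0 < S by apply: lt_le_trans Sge; rewrite mulr_gt0.
pose r := Num.sqrt S; have r0 : 0 < r by rewrite sqrtr_gt0.
have r2 : r ^+ 2 = S by rewrite sqr_sqrtr// ltW.
(* Scaling the matrix by [c] scales [zeta] by [c^2] and [sigma2] by [c^4], so [c^-4 = S] is
   forced. *)
pose c := (Num.sqrt r)^-1; have c0 : 0 < c by rewrite invr_gt0 sqrtr_gt0.
have c2 : c ^+ 2 = r^-1 by rewrite exprVn sqr_sqrtr// ltW.
exists (fun_mx P d phi), c; split; split => //.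
- exact: (fun_mx_sym At uP AE).
- by apply: fun_mx_unit => // x; rewrite gt_eqF.
- exact: (fun_mx_comm uP AE).
- rewrite fun_mxM// -(fun_mx_id AE) fun_mxM// -(fun_mx_cst d uP) fun_mxD//.
  by congr fun_mx; apply/funext => x; rewrite -!expr2 phi2.
- have cphi : c *: fun_mx P d phi = fun_mx P d (fun x => c * phi x).
    by rewrite -mul_scalar_mx -(fun_mx_cst d uP) fun_mxM.
  rewrite cphi; split; first by apply: (fun_mx_spd At uP AE) => x; rewrite mulr_gt0.
  exists (map_mx (fun x => c * phi x) l); split; first exact: (eigenvalues_fun_mx Al uP AE).
  exists (r^-1 *: z').
  have s1z : sigma1 z' = sigma1 z + n.+1%:R * tau.
    rewrite /sigma1; under eq_bigr do rewrite !mxE.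
    by rewrite big_split /= sumr_const card_ord mulr_natl.
  have s1' : 0 < sigma1 z'.
    by rewrite s1z addr_gt0// mulr_gt0// divr_gt0.
  have s2' : sigma2 (r^-1 *: z') = 1.
    rewrite (_ : sigma2 _ = r^-1 ^+ 2 * S).
      by rewrite exprVn r2 mulVf// gt_eqF.
    rewrite /S /sigma2 mulr_sumr; apply: eq_bigr => i _.
    by rewrite mulr_sumr; apply: eq_bigr => j _; rewrite !mxE; ring.
  split => //.
  + split; last by rewrite s2'.
    rewrite (_ : sigma1 _ = r^-1 * sigma1 z'); first by rewrite mulr_gt0// invr_gt0.
    by rewrite /sigma1 mulr_sumr; apply: eq_bigr => j _; rewrite !mxE.
  + move=> i; rewrite mxE exprMn phi2 c2 lz.
    under [RHS]eq_bigr do rewrite !mxE.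
    rewrite -mulr_sumr big_split /=; congr (_ * (_ + _)).
    rewrite sumr_const (_ : #|_| = n); last by rewrite cardC1 card_ord.
    by rewrite -[RHS]mulr_natl -NE /tau mulrCA divff ?mulr1// gt_eqF.
- rewrite frobA -/N (_ : t * (N * _) / N = t * sigma1 z); last by field; rewrite gt_eqF.
  by rewrite (exprM c 2 2) c2 -exprVn invrK r2.
Qed.

End functional_calculus.

(** * From viscosity to classical inequalities *)

Section taylor.
Context {R : realType} (n : nat).
Implicit Types (f : 'rV[R]_n -> R) (x y z p : 'rV[R]_n).

Let e_ (i : 'I_n) : 'rV[R]_n := delta_mx 0 i.

Lemma derivable_line f p i (t : R) :
  derivable f (p + t *: e_ i) (e_ i) ->
  is_derive t 1 (fun t => f (p + t *: e_ i)) ('D_(e_ i) f (p + t *: e_ i)).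
Proof.
have E : (fun h : R => h^-1 *: (f (p + (h *: (1 : R) + t) *: e_ i) - f (p + t *: e_ i))) =
    (fun h : R => h^-1 *: (f (h *: e_ i + (p + t *: e_ i)) - f (p + t *: e_ i))).
  apply/funext => h; congr (_ *: (f _ - _)).
  by rewrite [h%:A]mulr1 scalerDl addrCA.
by move=> df; split; rewrite /derivable /derive /= E.
Qed.

Lemma mean_value_line f p i (h : R) :
  (forall th, 0 <= th <= 1 -> derivable f (p + (th * h) *: e_ i) (e_ i)) ->
  exists2 th, 0 <= th <= 1 &
    f (p + h *: e_ i) - f p = h * 'D_(e_ i) f (p + (th * h) *: e_ i).
Proof.
move=> df; pose g (t : R) := f (p + (t * h) *: e_ i).
have dg (t : R) : 0 <= t <= 1 -> is_derive t 1 g (h * 'D_(e_ i) f (p + (t * h) *: e_ i)).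
  move=> t01; have dl := derivable_line (df t t01).
  have dm : is_derive t (1 : R) (fun t : R => t * h) h.
    by apply: is_derive_eq; rewrite scaler0 add0r [h%:A]mulr1.
  by have := @is_derive1_comp _ _ (fun t : R => t * h) _ _ _ dl dm; rewrite mulrC.
have [||th th01] := @MVT_segment R g (fun t => h * 'D_(e_ i) f (p + (t * h) *: e_ i)) 0 1 ler01.
- by move=> t; rewrite in_itv /= => /andP[t0 t1]; apply: dg; rewrite !ltW.
- apply: derivable_within_continuous => t; rewrite in_itv /= => t01.
  by have [] := dg t t01.
rewrite /g subr0 mulr1 mul1r mul0r scale0r addr0 => E.
by exists th => //; rewrite in_itv /= in th01.
Qed.

Definition coord_between (z y w : 'rV[R]_n) := forall j,
  exists2 th, 0 <= th <= 1 & w 0 j = z 0 j + th * (y 0 j - z 0 j).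

(** Coordinates are changed from [z] to [y] one at a time, each change being governed by the
    one-variable mean value theorem; thus partial derivatives suffice. *)
Lemma mean_value_coord f y z :
  (forall w, coord_between z y w -> forall i, derivable f w (e_ i)) ->
  exists2 xi : 'I_n -> 'rV[R]_n, forall i, coord_between z y (xi i) &
    f y - f z = \sum_i (y 0 i - z 0 i) * 'D_(e_ i) f (xi i).
Proof.
move=> df; pose w k : 'rV[R]_n := \row_j (if (j < k)%N then y 0 j else z 0 j).
have wS (i : 'I_n) : w i.+1 = w i + (y 0 i - z 0 i) *: e_ i.
  apply/rowP => j; rewrite !mxE eqxx /= ltnS leq_eqVlt.
  have [->|ji] := eqVneq j i; first by rewrite eqxx ltnn mulr1 addrC subrK.
  by rewrite val_eqE (negbTE ji) /= mulr0 addr0.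
have btw (i : 'I_n) th : 0 <= th <= 1 ->
    coord_between z y (w i + (th * (y 0 i - z 0 i)) *: e_ i).
  move=> th01 j; have [->|ji] := eqVneq j i.
    by exists th => //; rewrite !mxE !eqxx ltnn mulr1.
  have [ji'|ji'] := ltnP j i.
    by exists 1; rewrite ?ler01 ?lexx// !mxE ji' (negbTE ji) mulr0 addr0 mul1r addrC subrK.
  exists 0; rewrite ?ler01 ?lexx// !mxE ltnNge ji' (negbTE ji) /= mulr0.
  by rewrite mul0r.
have /choice[th thP] (i : 'I_n) : exists th, 0 <= th <= 1 /\
    f (w i.+1) - f (w i) = (y 0 i - z 0 i) *
      'D_(e_ i) f (w i + (th * (y 0 i - z 0 i)) *: e_ i).
  rewrite wS; have [th th01|th th01 E] := @mean_value_line f (w i) i (y 0 i - z 0 i).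
    by apply: df; exact: btw.
  by exists th.
exists (fun i : 'I_n => w i + (th i * (y 0 i - z 0 i)) *: e_ i).
  by move=> i; apply: btw; have [] := thP i.
have -> : f y = f (w n) by congr f; apply/rowP => j; rewrite mxE ltn_ord.
have -> : f z = f (w 0%N) by congr f; apply/rowP => j; rewrite mxE.
rewrite -(telescope_sumr (fun k => f (w k)) (leq0n n)) big_mkord; apply: eq_bigr => i _.
by have [] := thP i.
Qed.

Definition box x (rho : R) := [set w : 'rV[R]_n | forall j, `|w 0 j - x 0 j| < rho].

Lemma coord_between_box x rho y z w :
  box x rho y -> box x rho z -> coord_between z y w -> box x rho w.
Proof.
move=> yb zb b j; have [th /andP[th0 th1] ->] := b j.
have := yb j; have := zb j; rewrite !ltr_norml => /andP[a1 a2] /andP[b1 b2].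
move: (y 0 j) (z 0 j) (x 0 j) a1 a2 b1 b2 => Y Z X a1 a2 b1 b2.
have conv (a c r : R) : a < r -> c < r -> a + th * (c - a) < r.
  move=> ar cr; have [ac|ac] := lerP a c.
    by apply: le_lt_trans cr; rewrite -lerBrDl ler_piMl// subr_ge0.
  by apply: le_lt_trans ar; rewrite gerDl mulr_ge0_le0// subr_le0 ltW.
have E : Z + th * (Y - Z) - X = (Z - X) + th * ((Y - X) - (Z - X)) by ring.
rewrite {}E; apply/andP; split; last exact: conv.
rewrite ltrNl (_ : - (Z - X + th * _) = - (Z - X) + th * (- (Y - X) - - (Z - X))).
  by apply: conv; rewrite ltrNl.
by ring.
Qed.

Lemma lipschitz_box f x rho (M : R) :
  (forall w, box x rho w -> forall i, derivable f w (e_ i) /\ `|'D_(e_ i) f w| <= M) ->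
  forall y z, box x rho y -> box x rho z ->
    `|f y - f z| <= M * \sum_i `|y 0 i - z 0 i|.
Proof.
move=> df y z yb zb.
have [w b i|xi xib ->] := @mean_value_coord f y z.
  by have [] := df w (coord_between_box yb zb b) i.
rewrite (le_trans (ler_norm_sum _ _ _))// mulr_sumr ler_sum// => i _.
rewrite normrM mulrC ler_wpM2r//.
by have [] := df _ (coord_between_box yb zb (xib i)) i.
Qed.

Lemma ball_box x rho : 0 < rho -> ball x rho = box x rho.
Proof.
move=> rho0; apply/seteqP; split => w /=.
  by move=> [_ h] j; have := h 0 j; rewrite -ball_normE /= distrC.
by move=> h; split => // i j; rewrite ord1 -ball_normE /= distrC.
Qed.

Lemma le_sum_entries (a : 'I_n -> 'I_n -> R) i j : (forall i j, 0 <= a i j) ->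
  a i j <= \sum_i \sum_j a i j.
Proof.
move=> a0; rewrite (bigD1 i)//= (bigD1 j)//= -addrA lerDl.
by rewrite addr_ge0// ?sumr_ge0// => k _; rewrite ?sumr_ge0.
Qed.

(** Applied to both increments [psi (x + h) - psi x] and [psi (x - h) - psi x], the mean value
    formula leaves [h_i] times differences of first partial derivatives at points whose coordinates
    differ by at most [2 |h|]; these derivatives are Lipschitz on a box. *)
Lemma C2_second_difference (N : set 'rV[R]_n) (psi : 'rV[R]_n -> R) x :
  open N -> N x -> C2_on N psi ->
  exists2 rho, 0 < rho & ball x rho `<=` N /\
    exists2 C, 0 <= C & forall h : 'rV[R]_n, (forall j, `|h 0 j| < rho) ->
      delta psi x h <= C * enorm h ^+ 2.
Proof.
move=> oN Nx [[_ D1] D2].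
pose D i j : 'rV[R]_n -> R := 'D_(e_ j) ('D_(e_ i) psi).
(* The extra [1] makes the bound strict at [x], so that continuity extends it to a neighbourhood. *)
pose M := 1 + \sum_i \sum_j `|D i j x|.
have nearD : \forall w \near x, N w /\ forall i j, `|D i j w| <= M.
  near=> w; split; first by near: w; exact: open_nbhs_nbhs.
  near: w; apply: filter_forall => i; apply: filter_forall => j.
  have cD : {for x, continuous (D i j)}.
    by have [_ /(_ j)[_ +]] := D2 i; apply; rewrite inE.
  have : `|D i j x| < M.
    apply: (@le_lt_trans _ _ (\sum_i \sum_j `|D i j x|)); last by rewrite ltrDr.
    by apply: (@le_sum_entries (fun i j => `|D i j x|)).
  have cn := @cvg_norm R R^o _ _ _ _ _ (cD : D i j @ x --> D i j x).
  move=> /(cvgr_lt _ (cn _)); apply: filterS => w; exact: ltW.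
have /nbhs_ballP[rho /= rho0 rhoP] := nearD.
have M0 : 0 <= M by rewrite addr_ge0// sumr_ge0// => i _; rewrite sumr_ge0.
have bN w : box x rho w -> N w by rewrite -ball_box// => /rhoP[].
exists rho => //; split; first by move=> w /rhoP[].
exists (2 * M * n%:R ^+ 2); first by rewrite mulr_ge0 ?sqr_ge0// mulr_ge0.
move=> h hrho.
have rho_box : box x rho x by move=> j; rewrite subrr normr0.
have boxD (v : 'rV[R]_n) : (forall j, `|v 0 j| < rho) -> box x rho (x + v).
  by move=> vb j; rewrite mxE addrAC subrr add0r.
have bh : box x rho (x + h) by exact: boxD.
have bh' : box x rho (x - h) by apply: boxD => j; rewrite mxE normrN.
have lip i y z : box x rho y -> box x rho z ->
    `|'D_(e_ i) psi y - 'D_(e_ i) psi z| <= M * \sum_j `|y 0 j - z 0 j|.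
  apply: (@lipschitz_box ('D_(e_ i) psi) x rho M) => w wb j.
  have [_ /(_ j)[dj _]] := D2 i; split; first by apply: dj; exact: bN.
  by have [_ +] := rhoP w (eq_ind _ (fun S : set _ => S w) wb _ (esym (ball_box x rho0))); exact.
have dpsi w : box x rho w -> forall i, derivable psi w (e_ i).
  by move=> wb i; have [dj _] := D1 i; apply: dj; exact: bN.
have [w b i|xi xib E] := @mean_value_coord psi (x + h) x.
  by apply: dpsi; exact: coord_between_box b.
have [w b i|xi' xib' E'] := @mean_value_coord psi (x - h) x.
  by apply: dpsi; exact: coord_between_box b.
have -> : delta psi x h = (psi (x + h) - psi x) + (psi (x - h) - psi x).
  by rewrite /delta; ring.
rewrite E E' -big_split /=.
have step i : (( x + h) 0 i - x 0 i) * 'D_(e_ i) psi (xi i) +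
    ((x - h) 0 i - x 0 i) * 'D_(e_ i) psi (xi' i) <= 2 * M * n%:R * enorm h ^+ 2.
  have -> : (x + h) 0 i - x 0 i = h 0 i by rewrite mxE addrAC subrr add0r.
  have -> : (x - h) 0 i - x 0 i = - h 0 i by rewrite !mxE addrAC subrr add0r.
  rewrite mulNr -mulrBr (le_trans (ler_norm _))// normrM.
  have := lip i (xi i) (xi' i) (coord_between_box bh rho_box (xib i))
    (coord_between_box bh' rho_box (xib' i)).
  have sum_le : \sum_j `|xi i 0 j - xi' i 0 j| <= n%:R * (2 * enorm h).
    rewrite -[X in X%:R * _](card_ord n) mulr_natl -sumr_const ler_sum// => j _.
    have [th /andP[t0 t1] ->] := xib i j; have [th' /andP[t0' t1'] ->] := xib' i j.
    rewrite !mxE; have := coord_le_enorm h j.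
    move: (h 0 j) (enorm h) => a e ae.
    have -> : x 0 j + th * (x 0 j + a - x 0 j) - (x 0 j + th' * (x 0 j - a - x 0 j)) =
      (th + th') * a by ring.
    rewrite normrM ger0_norm; last by rewrite addr_ge0.
    by apply: ler_pM => //; [rewrite addr_ge0|lra].
  move=> L; have {}L := le_trans L (ler_wpM2l M0 sum_le).
  apply: (le_trans (ler_pM (normr_ge0 _) (normr_ge0 _) (coord_le_enorm h i) L)).
  by rewrite le_eqVlt; apply/orP; left; apply/eqP; ring.
rewrite (le_trans (ler_sum _ (fun i _ => step i)))// sumr_const card_ord.
by rewrite -mulr_natl le_eqVlt; apply/orP; left; apply/eqP; ring.
Unshelve. all: by end_near. Qed.

End taylor.

(** * Integrals of functions with an integrable upper bound *)

Section majorized_integrals.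
Context d (T : measurableType d) (R : realType) (mu : {measure set T -> \bar R}).
Implicit Types (f g h E : T -> R).
Local Open Scope ereal_scope.

Lemma le_integral_funepos f g : measurable_fun setT f -> measurable_fun setT g ->
  (forall t, (f t <= g t)%R) ->
  \int[mu]_t (EFin \o f)^\+ t <= \int[mu]_t (EFin \o g)^\+ t /\
  \int[mu]_t (EFin \o g)^\- t <= \int[mu]_t (EFin \o f)^\- t.
Proof.
move=> mf mg fg.
have mf' : measurable_fun setT (EFin \o f) by exact/measurable_EFinP.
have mg' : measurable_fun setT (EFin \o g) by exact/measurable_EFinP.
split; apply: ge0_le_integral => //; try exact: measurable_funepos; try exact: measurable_funeneg.
- move=> t _; rewrite !funeposE /= ge_max le_max lee_fin fg /= le_max lexx orbT.
  by [].
- move=> t _; rewrite !funenegE /= ge_max le_max lee_fin lerN2 fg /= le_max lexx orbT.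
  by [].
Qed.

(** Positive parts increase and negative parts decrease, so the comparison covers divergent
    integrals as well. *)
Lemma le_integral_measurable f g : measurable_fun setT f -> measurable_fun setT g ->
  (forall t, (f t <= g t)%R) ->
  \int[mu]_t (f t)%:E <= \int[mu]_t (g t)%:E.
Proof.
move=> mf mg fg; have [p m] := le_integral_funepos mf mg fg.
by rewrite integralE [leRHS]integralE leeB.
Qed.

(** The majorant makes the positive part integrable, and then the lower bound [c] excludes a
    negative part of infinite integral. *)
Lemma integrable_majorized f E (c : R) : measurable_fun setT f ->
  measurable_fun setT E -> \int[mu]_t (E t)%:E < +oo ->
  (forall t, (0 <= E t)%R) -> (forall t, (f t <= E t)%R) ->
  c%:E <= \int[mu]_t (f t)%:E -> mu.-integrable setT (EFin \o f).
Proof.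
move=> mf mE Eoo E0 fE cf.
have mf' : measurable_fun setT (EFin \o f) by exact/measurable_EFinP.
have [p _] := le_integral_funepos mf mE fE.
have {}p : \int[mu]_t (EFin \o f)^\+ t < +oo.
  apply: le_lt_trans p _; rewrite (_ : (EFin \o E)^\+ = EFin \o E)//.
  by apply/funext => t; rewrite !funeposE /=; apply/max_idPl; rewrite lee_fin.
apply/integrableP; split=> //.
rewrite -[X in \int[mu]_t X t]/(abse \o (EFin \o f)) fune_abse ge0_integralD//;
  [|exact: measurable_funepos|exact: measurable_funeneg].
rewrite lte_add_pinfty// ltey; apply/eqP => m.
by move: cf; rewrite integralE m /= addeNy// leeNy_eq.
Qed.

(** Fatou's lemma for the nonnegative functions [E - f k]. It bounds the integral of [E - g], which
    yields integrability of [g] along with the inequality. *)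
Lemma fatou_majorized (f : nat -> T -> R) g E (c : R) :
  (forall k, measurable_fun setT (f k)) -> measurable_fun setT g ->
  measurable_fun setT E -> \int[mu]_t (E t)%:E < +oo ->
  (forall t, (0 <= E t)%R) -> (forall k t, (f k t <= E t)%R) ->
  (forall t, \forall k \near \oo, f k t = g t) ->
  (forall k, c%:E <= \int[mu]_t (f k t)%:E) ->
  mu.-integrable setT (EFin \o g) /\ c%:E <= \int[mu]_t (g t)%:E.
Proof.
move=> mf mg mE Eoo E0 fE fg cf.
have gE t : (g t <= E t)%R.
  by have [k _ /(_ k (leqnn k)) <-] := fg t.
have iE : mu.-integrable setT (EFin \o E).
  apply/integrableP; split; first exact/measurable_EFinP.
  by under eq_integral => t _ do rewrite /= ger0_norm//.
have fif k : mu.-integrable setT (EFin \o f k).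
  exact: (integrable_majorized (mf k) mE _ _ _ (cf k)).
have mEg : measurable_fun setT (fun t => E t - g t)%R by exact: measurable_funB.
have Eg_le : \int[mu]_t (E t - g t)%:E <= \int[mu]_t (E t)%:E - c%:E.
  have F := @fatou _ _ _ mu _ measurableT (fun k t => (E t - f k t)%:E).
  rewrite (_ : \int[mu]_t _ = \int[mu]_t limn_einf (fun k => (E t - f k t)%:E)); last first.
    apply: eq_integral => t _; apply/esym.
    have cv : (fun k => (E t - f k t)%:E) @ \oo --> (E t - g t)%:E.
      apply: cvg_near_cst; have := fg t; apply: filterS => k ->.
      by [].
    by rewrite is_cvg_limn_einfE; [exact/cvg_lim|apply/cvg_ex; eexists; exact: cv].
  apply: (le_trans (F _ _)) => [k|k t _|].
  - by apply/measurable_EFinP; exact: measurable_funB.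
  - by rewrite lee_fin subr_ge0.
  have le k : \int[mu]_t (E t - f k t)%:E <= \int[mu]_t (E t)%:E - c%:E.
    under eq_integral => t _ do rewrite EFinB.
    by rewrite integralB_EFin// leeB.
  rewrite limn_einf_lim; apply: lime_le; first exact: is_cvg_einfs.
  apply: nearW => k; apply: le_trans (le k); apply: ereal_inf_lbound.
  by exists k => /=.
have iEg : mu.-integrable setT (EFin \o (fun t => E t - g t)%R).
  apply/integrableP; split; first exact/measurable_EFinP.
  under eq_integral => t _ do rewrite /= ger0_norm ?subr_ge0//.
  apply: le_lt_trans Eg_le _.
  by rewrite lteBlDr// addye.
have ig : mu.-integrable setT (EFin \o g).
  rewrite (_ : EFin \o g = (fun t => (E t)%:E - (E t - g t)%:E)); last first.
    by apply/funext => t /=; rewrite -EFinB opprB addrC subrK.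
  exact: (integrableB measurableT iE iEg).
split => //.
move: Eg_le; under eq_integral => t _ do rewrite EFinB.
rewrite integralB_EFin//.
have := integrable_fin_num measurableT iE; have := integrable_fin_num measurableT ig.
rewrite /comp; case: (\int[mu]_t (g t)%:E) => // a _; case: (\int[mu]_t (E t)%:E) => // b _.
by rewrite -!EFinB !lee_fin lerD2l lerN2.
Qed.
End majorized_integrals.

(** * The classical inequality at points touched from above *)

Section classical_viscosity.
Context {R : realType} (n : nat) (s : R).
Hypothesis s01 : 0 < s < 1.
Hypothesis n0 : (0 < n)%N.
Let q : R := n%:R + 2 * s.
Let mvec : measurable_row (@vec R n) := @measurable_row_vec R n.
Implicit Types (u v psi : 'rV[R]_n -> R) (x w h : 'rV[R]_n).

Let s0 : 0 < s. Proof. by case/andP: s01. Qed.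
Let q0 : 0 < q. Proof. by rewrite ltr_wpDl ?ler0n// mulr_gt0. Qed.

Lemma measurable_patch u psi (N : set 'rV[R]_n) : open N -> continuous u ->
  {in N, continuous psi} -> measurable_fun setT (patch u N psi \o @vec R n).
Proof.
move=> oN cu cpsi; have mN := measurable_open_row oN.
have mu := measurable_continuous_row cu.
rewrite (_ : _ \o _ = patch (u \o @vec R n) (@vec R n @^-1` N) (psi \o @vec R n)); last first.
  apply/funext => t; rewrite /patch /=.
  suff -> : (vec t \in N) = (t \in @vec R n @^-1` N) by [].
  by apply/idP/idP; rewrite !inE.
have EN : (fun t => t \in @vec R n @^-1` N) @^-1` [set true] = @vec R n @^-1` N.
  by apply/seteqP; split => t /=; [exact: set_mem|exact: mem_set].
apply: (@measurable_fun_if _ _ _ (measurableTypeR R) (psi \o @vec R n) (u \o @vec R n)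
  setT measurableT (fun t => t \in @vec R n @^-1` N)) => //.
- apply: (measurable_fun_bool true).
  by rewrite setTI EN.
- rewrite setTI EN.
  apply: (measurability _ (RGenOpens.measurableE R)) => _ [_ [a [b ->]] <-].
  rewrite (_ : _ `&` _ = @vec R n @^-1` (N `&` psi @^-1` `]a, b[%classic))//.
  apply: measurable_open_row; rewrite openE => w [Nw abw]; apply: filterI.
    exact: open_nbhs_nbhs.
  by apply: (cpsi w (mem_set Nw)); apply: open_nbhs_nbhs; split=> //; exact: interval_open.
- exact: measurable_funTS.
Qed.

(** Allows the weight in [L1_omega] to be recentred at [x]; it rests on
    [|w| <= 2 max(|w - x|, |x|)]. *)
Lemma one_enorm_powR_shift x : exists2 K, 0 < K & forall w,
  1 + enorm w `^ q <= K * (1 + enorm (w - x) `^ q).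
Proof.
have p0 a : 0 <= a `^ q :> R by exact: powR_ge0.
exists (1 + 2 `^ q * (1 + enorm x `^ q)) => [|w].
  by rewrite ltr_pwDl// mulr_ge0// addr_ge0.
have wx : enorm w <= 2 * Num.max (enorm (w - x)) (enorm x).
  rewrite -(@ler_pXn2r _ 2)//; last 2 first.
    exact: enorm_ge0.
    by rewrite nnegrE mulr_ge0// le_max enorm_ge0.
  rewrite -{1}(subrK x w); apply: (le_trans (enorm_sqrD _ _)).
  rewrite exprMn -[2 ^+ 2]/(2 * 2) -mulrA ler_wpM2l//.
  have := enorm_ge0 (w - x); have := enorm_ge0 x.
  by case: (leP (enorm (w - x)) (enorm x)) => h a b; nra.
have {}wx : enorm w `^ q <= 2 `^ q * (enorm (w - x) `^ q + enorm x `^ q).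
  apply: (@le_trans _ _ ((2 * Num.max (enorm (w - x)) (enorm x)) `^ q)).
    apply: ge0_ler_powR => //; rewrite ?nnegrE ?enorm_ge0 ?mulr_ge0 ?le_max ?enorm_ge0//.
    exact: ltW.
  rewrite powRM ?le_max ?enorm_ge0// ler_wpM2l//.
  by case: (leP (enorm (w - x)) (enorm x)) => _; rewrite ?lerDl ?lerDr.
have := p0 2; have := p0 (enorm (w - x)); have := p0 (enorm x).
move: wx; move: (enorm w `^ q) (2 `^ q) (enorm (w - x) `^ q) (enorm x `^ q) => a b c e.
move=> abc e0 c0 b0; have := mulr_ge0 b0 (mulr_ge0 e0 c0); have := mulr_ge0 b0 e0.
have := mulr_ge0 b0 c0; lra.
Qed.

Lemma L1_omega_affine u x (c : R) : c != 0 -> continuous u -> L1_omega s u ->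
  (\int[leb R n]_t (`|u (c *: vec t + x)| / (1 + enorm (c *: vec t) `^ q))%:E < +oo)%E.
Proof.
move=> c0 cu /integrableP[_ Lu].
have [K K0 KP] := one_enorm_powR_shift x.
have mden (G : n.-tuple (measurableTypeR R) -> 'rV[R]_n) : measurable_row G ->
    measurable_fun setT (fun t => 1 + enorm (G t) `^ q).
  move=> mG; apply: measurable_funD => //.
  exact: (measurableT_comp (measurable_powR _) (measurable_enorm_row mG)).
have mux (G : n.-tuple (measurableTypeR R) -> 'rV[R]_n) : measurable_row G ->
    measurable_fun setT (fun t => (`|u (vec t)| / (1 + enorm (G t) `^ q))%:E).
  move=> mG; apply/measurable_EFinP; apply: measurable_funM.
    exact: measurableT_comp (measurable_continuous_row cu).
  exact: measurable_invr (mden _ mG).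
have d0 w : 0 < 1 + enorm w `^ q by rewrite ltr_pwDl// powR_ge0.
have mwx : measurable_row (fun t => @vec R n t - x).
  by apply: measurable_rowD => //; exact: measurable_row_cst.
pose F w := (`|u w| / (1 + enorm (w - x) `^ q))%:E.
rewrite (_ : (\int[leb R n]_t _ = \int[leb R n]_t F (c *: vec t + x)%R)%E); last first.
  by apply: eq_integral => t _; rewrite /F addrK.
rewrite ge0_integral_leb_affine//; last 2 first.
- exact: mux mwx.
- by move=> w; rewrite lee_fin divr_ge0// ltW.
apply: lte_mul_pinfty; rewrite ?lee_fin ?invr_ge0 ?exprn_ge0//.
apply: (@le_lt_trans _ _ (\int[leb R n]_t (K%:E * (`|u (vec t)| / (1 + enorm (vec t) `^ q))%:E))%E).
  apply: ge0_le_integral => //.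
  - by move=> t _; rewrite lee_fin divr_ge0// ltW.
  - exact: mux mwx.
  - exact: measurable_funeM (mux _ mvec).
  - move=> t _; rewrite /F -EFinM lee_fin mulrCA ler_wpM2l// ler_pdivlMr//.
    by rewrite mulrC ler_pdivrMr.
rewrite ge0_integralZl//; last 3 first.
- exact: mux mvec.
- by move=> t _; rewrite lee_fin divr_ge0// ltW.
- by rewrite lee_fin ltW.
apply: lte_mul_pinfty; rewrite ?lee_fin ?(ltW K0)//.
apply: le_lt_trans Lu; rewrite le_eqVlt; apply/orP; left; apply/eqP.
apply: eq_integral => t _; by rewrite abse_EFin normrM normfV (gtr0_norm (d0 _)).
Qed.

(** A single [E] must serve all the patched functions at once, as dominating function for Fatou.
    Near [0] the quadratic bound is absorbed by the Levy kernel; farther out [v] equals [u], and the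
    recentred weight of [L1_omega] takes over. *)
Lemma second_difference_majorant u x (rho C : R) :
  0 < rho -> 0 <= C -> continuous u -> L1_omega s u ->
  exists E : 'rV[R]_n -> R, [/\ forall h, 0 <= E h,
    measurable_fun setT (E \o @vec R n),
    (\int[leb R n]_t (E (vec t))%:E < +oo)%E &
    forall v, v x = u x -> (forall w, ~ ball x rho w -> v w = u w) ->
      (forall h, (forall j, `|h 0 j| < rho) -> delta v x h <= C * enorm h ^+ 2) ->
      forall h, delta v x h / enorm h `^ q <= E h].
Proof.
move=> rho0 C0 cu Lu.
pose f1 h := enorm h ^+ 2 / (1 + enorm h ^+ 2) / enorm h `^ q.
pose f2 (c : R) h := `|u (c *: h + x)| / (1 + enorm (c *: h) `^ q).
(* The first term uses [|h|^2 <= n rho^2] inside the box; the second absorbs [2 |u x|] outside it,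
   where [|h|^2 / (1 + |h|^2) >= rho^2 / (1 + rho^2)]. *)
pose C1 := C * (1 + n%:R * rho ^+ 2) + 2 * `|u x| * ((1 + rho ^+ 2) / rho ^+ 2).
(* Chosen so that [|h|^-q <= C2 / (1 + |h|^q)] as soon as [|h| >= rho]. *)
pose C2 := 1 + (rho `^ q)^-1.
have Cr0 : 0 <= C * (1 + n%:R * rho ^+ 2).
  by apply: mulr_ge0 => //; apply: addr_ge0 => //; apply: mulr_ge0 => //; exact: sqr_ge0.
have ur0 : 0 <= 2 * `|u x| * ((1 + rho ^+ 2) / rho ^+ 2).
  apply: mulr_ge0; first exact: mulr_ge0.
  by apply: divr_ge0; rewrite ?addr_ge0 ?sqr_ge0.
have C10 : 0 <= C1 by exact: addr_ge0.
have C20 : 0 <= C2 by rewrite addr_ge0// invr_ge0 powR_ge0.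
have f10 h : 0 <= f1 h by rewrite !divr_ge0 ?powR_ge0 ?addr_ge0 ?sqr_ge0.
have f20 c h : 0 <= f2 c h by rewrite divr_ge0// addr_ge0// powR_ge0.
have mq (G : n.-tuple (measurableTypeR R) -> 'rV[R]_n) : measurable_row G ->
    measurable_fun setT (fun t => enorm (G t) `^ q).
  by move=> mG; exact: (measurableT_comp (measurable_powR _) (measurable_enorm_row mG)).
have mf1 : measurable_fun setT (f1 \o @vec R n).
  apply: measurable_funM; last exact: measurable_invr (mq _ mvec).
  have m2 : measurable_fun setT (fun t => enorm (@vec R n t) ^+ 2).
    exact: measurable_funX (measurable_enorm_row mvec).
  by apply: measurable_funM => //; apply: measurable_invr; exact: measurable_funD.
have mf2 c : measurable_fun setT (f2 c \o @vec R n).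
  have mc : measurable_row (fun t => c *: @vec R n t) by exact: measurable_rowZ.
  apply: measurable_funM.
    apply: measurableT_comp => //.
    apply: (measurable_comp_row (measurable_continuous_row cu)).
    by apply: measurable_rowD => //; exact: measurable_row_cst.
  by apply: measurable_invr; apply: measurable_funD => //; exact: mq.
pose E h := C1 * f1 h + C2 * (f2 1 h + f2 (-1) h).
exists E; split => [h|||v vx vo vC h].
- by rewrite addr_ge0// mulr_ge0// addr_ge0.
- apply: measurable_funD; first exact: measurable_funM.
  by apply: measurable_funM => //; apply: measurable_funD; exact: mf2.
- rewrite (_ : (\int[leb R n]_t _ = \int[leb R n]_t (C1%:E * (f1 (vec t))%:E +
      C2%:E * ((f2 1 (vec t))%:E + (f2 (-1)%R (vec t))%:E)))%E); last first.
    by apply: eq_integral.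
  have Mf1 : measurable_fun setT (fun t => (f1 (@vec R n t))%:E) by exact/measurable_EFinP.
  have Mf2 c : measurable_fun setT (fun t => (f2 c (@vec R n t))%:E).
    by apply/measurable_EFinP; exact: mf2.
  have Mf12 : measurable_fun setT (fun t => ((f2 1 (@vec R n t))%:E + (f2 (-1) (@vec R n t))%:E)%E).
    exact: emeasurable_funD.
  have p2 t : (0 <= (f2 1 (@vec R n t))%:E + (f2 (-1) (@vec R n t))%:E)%E.
    by rewrite adde_ge0// lee_fin.
  rewrite ge0_integralD//; last 4 first.
  + by move=> t _; rewrite mule_ge0// lee_fin.
  + exact: measurable_funeM.
  + by move=> t _; rewrite mule_ge0// lee_fin.
  + exact: measurable_funeM.
  rewrite !ge0_integralZl//; last first.
    by move=> t _; rewrite lee_fin.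
  rewrite ge0_integralD//; last 2 first.
  + by move=> t _; rewrite lee_fin.
  + by move=> t _; rewrite lee_fin.
  have L c : c != 0 -> (\int[leb R n]_t (f2 c (vec t))%:E < +oo)%E.
    by move=> c0; exact: L1_omega_affine.
  apply: lte_add_pinfty; apply: lte_mul_pinfty => //.
  + exact: levy_kernel_lty.
  + apply: lte_add_pinfty; first exact: L (oner_neq0 _).
    by apply: L; rewrite oppr_eq0 oner_neq0.
have [->|h0] := eqVneq h 0.
  rewrite /delta addr0 subr0 vx (_ : u x + u x - 2 * u x = 0); last by ring.
  by rewrite mul0r addr_ge0// mulr_ge0// addr_ge0.
have eh : 0 < enorm h by rewrite enorm_gt0.
have ehq : 0 < enorm h `^ q by rewrite powR_gt0.
have [hr|/existsNP[j /negP]] := pselect (forall j, `|h 0 j| < rho).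
  have hn : enorm h ^+ 2 <= n%:R * rho ^+ 2.
    rewrite enorm_sqr -[X in X%:R](card_ord n) mulr_natl -sumr_const ler_sum// => j _.
    by rewrite -[h 0 j ^+ 2]real_normK ?num_real// lerXn2r ?nnegrE// ltW.
  apply: (@le_trans _ _ (C * (1 + n%:R * rho ^+ 2) * f1 h)).
    rewrite /f1 mulrA ler_wpM2r ?invr_ge0 ?(ltW ehq)//.
    apply: (le_trans (vC h hr)); rewrite -mulrA ler_wpM2l// mulrA ler_pdivlMr.
      by rewrite [leRHS]mulrC ler_wpM2l ?sqr_ge0// lerD2l.
    by rewrite ltr_pwDl// sqr_ge0.
  rewrite -[leLHS]addr0 lerD//; last by rewrite mulr_ge0// addr_ge0.
  by rewrite ler_wpM2r// lerDl.
rewrite -leNgt => rj.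
have rh : rho <= enorm h := le_trans rj (coord_le_enorm h j).
have out w : `|w 0 j| = `|h 0 j| -> v (x + w) = u (x + w).
  move=> wj; apply: vo; rewrite ball_box// => /(_ j).
  by rewrite mxE addrAC subrr add0r wj ltNge rj.
rewrite /delta vx !out ?mxE ?normrN//.
have rq : rho `^ q <= enorm h `^ q.
  by apply: ge0_ler_powR => //; rewrite ?nnegrE ?(ltW q0) ?(ltW rho0) ?enorm_ge0.
have K2 : (enorm h `^ q)^-1 <= C2 / (1 + enorm h `^ q).
  have rq0 : 0 < rho `^ q by rewrite powR_gt0.
  rewrite ler_pdivlMr; last by rewrite ltr_pwDl// ltW.
  rewrite mulrDr mulr1 mulVf ?gt_eqF// addrC lerD2l lef_pV2//.
have K1 : 2 * `|u x| <= 2 * `|u x| * ((1 + rho ^+ 2) / rho ^+ 2) *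
    (enorm h ^+ 2 / (1 + enorm h ^+ 2)).
  rewrite -mulrA ler_peMr ?mulr_ge0//.
  have r2 : 0 < rho ^+ 2 by rewrite exprn_gt0.
  have h2 : rho ^+ 2 <= enorm h ^+ 2 by rewrite lerXn2r ?nnegrE ?enorm_ge0 ?(ltW rho0).
  rewrite mulf_div ler_pdivlMr; last by rewrite mulr_gt0// ltr_pwDl// sqr_ge0.
  move: r2 h2; move: (rho ^+ 2) (enorm h ^+ 2) => a b a0 ab.
  by rewrite mul1r; nra.
have -> : E h = C * (1 + n%:R * rho ^+ 2) * f1 h +
   ((2 * `|u x| * ((1 + rho ^+ 2) / rho ^+ 2) *
      (enorm h ^+ 2 / (1 + enorm h ^+ 2))) / enorm h `^ q +
    (`|u (x + h)| + `|u (x - h)|) * (C2 / (1 + enorm h `^ q))).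
  rewrite /E /f2 scale1r scaleN1r enormN ![_ + x]addrC /C1 /f1.
  move: (enorm h ^+ 2 / _) => *; ring.
rewrite -[leLHS]add0r lerD//; first exact: mulr_ge0.
apply: (@le_trans _ _ ((2 * `|u x| + (`|u (x + h)| + `|u (x - h)|)) / enorm h `^ q)).
  rewrite ler_wpM2r ?invr_ge0 ?(ltW ehq)//.
  have := ler_norm (u (x + h)); have := ler_norm (u (x - h)); have := ler_norm (- u x).
  by rewrite normrN; lra.
rewrite mulrDl lerD//; first by rewrite ler_wpM2r ?invr_ge0 ?(ltW ehq).
by rewrite ler_wpM2l// addr_ge0.
Qed.

Lemma C2_on_sub (N N' : set 'rV[R]_n) psi : N' `<=` N -> C2_on N psi -> C2_on N' psi.
Proof.
move=> NN.
have sub1 (f : 'rV[R]_n -> R) : C1_on N f -> C1_on N' f.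
  move=> [cf df]; split=> [y|i]; first by rewrite inE => /NN Ny; apply: cf; rewrite inE.
  have [di ci] := df i; split=> [y /NN|y]; first exact: di.
  by rewrite inE => /NN Ny; apply: ci; rewrite inE.
by move=> [c1 c2]; split=> [|i]; apply: sub1 => //; exact: c2.
Qed.

Lemma touches_above_ball (Omega N : set 'rV[R]_n) u psi x r : 0 < r ->
  ball x r `<=` N -> touches_above Omega u x N psi ->
  touches_above Omega u x (ball x r) psi.
Proof.
move=> r0 rN [[oN Nx NO] [c2 px tp]]; split; split=> //.
- exact: ball_open.
- exact: ballxx.
- by apply: subset_trans NO.
- exact: C2_on_sub c2.
- by move=> y /rN Ny; exact: tp.
Qed.

Let Qf (A : 'M[R]_n) v x (t : n.-tuple (measurableTypeR R)) : R :=
  delta v x (vec t *m A^T) / enorm (vec t) `^ q.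

Lemma measurable_delta_kernel (A : 'M[R]_n) v x :
  measurable_fun setT (v \o @vec R n) -> measurable_fun setT (Qf A v x).
Proof.
move=> mv; apply: measurable_funM; last first.
  apply: measurable_invr.
  exact: (measurableT_comp (measurable_powR _) (measurable_enorm_row mvec)).
have mA : measurable_row (fun t => @vec R n t *m A^T) by exact: measurable_rowM.
have mx : measurable_row (fun t : n.-tuple (measurableTypeR R) => x) by exact: measurable_row_cst.
apply: measurable_funB => //; apply: measurable_funD.
  by apply: (measurable_comp_row mv); exact: measurable_rowD.
by apply: (measurable_comp_row mv); apply: measurable_rowD => //; exact: measurable_rowN.
Qed.

Lemma Gamma_funE (a : R) : 0 < a -> (Gamma_fun a)%:E = gamma_int a.
Proof.
move=> a0; rewrite /Gamma_fun gamma_intE fineK// ge0_fin_numE ?gamma_int_lty//.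
by rewrite ltW// gamma_int_gt0.
Qed.

Lemma Gamma_fun_gt0 (a : R) : 0 < a -> 0 < Gamma_fun a.
Proof. by move=> a0; rewrite -lte_fin Gamma_funE// gamma_int_gt0. Qed.

Lemma C_ns_gt0 : 0 < C_ns n s.
Proof.
have /andP[_ s1] := s01.
rewrite /C_ns divr_gt0// ?mulr_gt0// ?powR_gt0 ?pi_gt0// ?Gamma_fun_gt0 ?subr_gt0//.
by rewrite divr_gt0.
Qed.

(** The way back from classical to viscosity inequalities: the patched function lies above [u] and
    agrees with it at [x], so its second differences are larger. *)
Lemma L_op_patch_ge (A : 'M[R]_n) (Omega N : set 'rV[R]_n) u psi x : continuous u ->
  touches_above Omega u x N psi ->
  (L_op s A u x <= L_op s A (patch u N psi) x)%E.
Proof.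
move=> cu [[oN Nx NO] [[[cpsi _] _] px tp]].
rewrite /L_op lee_pmul2l//; last by rewrite lte_fin divr_gt0// C_ns_gt0.
have up w : u w <= patch u N psi w.
  rewrite /patch; case: ifPn => // /set_mem Nw.
  by have [->|wx] := eqVneq w x; [rewrite px|exact/ltW/tp].
apply: (@le_integral_measurable _ _ _ _ (Qf A u x) (Qf A (patch u N psi) x)).
- exact: measurable_delta_kernel (measurable_continuous_row cu).
- exact: measurable_delta_kernel (measurable_patch oN cu cpsi).
- move=> t; rewrite /Qf ler_wpM2r ?invr_ge0 ?powR_ge0//.
  have vx : patch u N psi x = u x by rewrite /patch mem_set.
  by rewrite /delta vx lerD2r lerD.
Qed.

(** The majorant bounds the patched integrals from above, the viscosity inequality from below.
    Integrability for [u] itself comes out as well and is what later permits subtracting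
    integrals. *)
Lemma visc_ge_classical (A : 'M[R]_n) (Omega : set 'rV[R]_n) u x (c : R) :
  A \in unitmx -> continuous u -> L1_omega s u -> visc_ge (L_op s A) Omega u c ->
  Omega x -> touchable_above Omega u x ->
  (leb R n).-integrable setT (fun t => (delta u x (vec t *m A^T) / enorm (vec t) `^ q)%:E) /\
  (c%:E <= L_op s A u x)%E.
Proof.
move=> uA cu Lu vu Ox [N [psi tN]].
have C0 := C_ns_gt0; have C20 : 0 < C_ns n s / 2 by rewrite divr_gt0.
have [[oN Nx _] [c2 px tp]] := tN.
have [rho rho0 [rhoN [C Cge0 CP]]] := C2_second_difference oN Nx c2.
have [E [E0 mE Eoo EP]] := second_difference_majorant x rho0 Cge0 cu Lu.
have [M M0 MP] := enorm_mulmx_bound A^T.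
have [k k0 kP] := ge0_integral_leb_mulmx (A := A^T) (etrans (unitmx_tr A) uA).
pose r (i : nat) : R := rho / i.+1%:R.
have r0 i : 0 < r i by rewrite divr_gt0.
have rrho i : r i <= rho by rewrite ler_pdivrMr// ler_peMr ?ler1n// ltW.
have brho i : ball x (r i) `<=` ball x rho by exact: le_ball.
pose v i := patch u (ball x (r i)) psi.
have vx i : v i x = u x by rewrite /v /patch mem_set ?px//; exact: ballxx.
have vmaj i h : delta (v i) x h / enorm h `^ q <= E h.
  apply: EP => // [w nw|h' h'rho].
    by rewrite /v /patch memNset// => /brho.
  apply: le_trans (CP h' h'rho).
  have vp w : ball x rho w -> v i w <= psi w.
    move=> bw; rewrite /v /patch; case: ifPn => // _.
    have [->|wx] := eqVneq w x; first by rewrite px.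
    by apply/ltW/tp => //; exact: rhoN.
  rewrite /delta vx px lerD2r lerD// vp// ball_box// => j.
    by rewrite mxE addrAC subrr add0r.
  by rewrite !mxE addrAC subrr add0r normrN.
have mf i : measurable_fun setT (Qf A (v i) x).
  apply: measurable_delta_kernel; apply: measurable_patch => //; first exact: ball_open.
  have [[cpsi _] _] := c2.
  by move=> y; rewrite inE => /(brho i) /rhoN Ny; apply: cpsi; rewrite inE.
have mEA : measurable_fun setT (fun t => E (vec t *m A^T)).
  by apply: (measurable_comp_row mE); exact: measurable_rowM.
have [] := @fatou_majorized _ _ R (leb R n) (fun i => Qf A (v i) x) (Qf A u x)
  (fun t => M `^ q * E (vec t *m A^T)) (c / (C_ns n s / 2)).
- exact: mf.
- exact: measurable_delta_kernel (measurable_continuous_row cu).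
- exact: measurable_funM.
- under eq_integral => t _ do rewrite EFinM.
  rewrite ge0_integralZl ?lee_fin ?powR_ge0//; last 2 first.
  + exact/measurable_EFinP.
  + by move=> t _; rewrite lee_fin.
  rewrite (kP (EFin \o E))//; last exact/measurable_EFinP.
  do 2 (apply: lte_mul_pinfty; rewrite ?lee_fin ?powR_ge0 ?(ltW k0)//).
- by move=> t; rewrite mulr_ge0// powR_ge0.
- move=> i t; rewrite /Qf.
  (* The majorant carries the kernel at [|A t|], the integrand the one at [|t|]. Where the second
     difference is positive, [|A t| <= M |t|] converts one into the other at the cost of [M^q]. *)
  have [d0|d0] := lerP (delta (v i) x (vec t *m A^T)) 0.
    apply: (@le_trans _ _ 0); last by rewrite mulr_ge0// powR_ge0.
    by rewrite mulr_le0_ge0// invr_ge0 powR_ge0.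
  have tA0 : vec t *m A^T != 0.
    apply: contraTneq d0 => ->; rewrite -leNgt /delta addr0 subr0.
    by rewrite le_eqVlt; apply/orP; left; apply/eqP; ring.
  have eA : 0 < enorm (vec t *m A^T) by rewrite enorm_gt0.
  have et : 0 < enorm (vec t).
    by rewrite enorm_gt0; apply: contraNneq tA0 => ->; rewrite mul0mx.
  apply: (@le_trans _ _ (M `^ q * (delta (v i) x (vec t *m A^T) / enorm (vec t *m A^T) `^ q))).
    rewrite mulrCA ler_wpM2l ?(ltW d0)//.
    rewrite ler_pdivlMr ?powR_gt0// ler_pdivrMl ?powR_gt0//.
    rewrite -powRM ?(ltW M0) ?enorm_ge0//; apply: ge0_ler_powR => //.
    + exact: ltW.
    + by rewrite nnegrE enorm_ge0.
    + by rewrite nnegrE mulr_ge0 ?(ltW M0) ?enorm_ge0.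
    + by rewrite mulrC.
  by rewrite ler_wpM2l ?powR_ge0.
- move=> t; rewrite /Qf.
  (* The shrinking balls eventually miss [x + w] for [w != 0], and at [w = 0] the values agree
     because [psi x = u x]. *)
  have ev w : \forall i \near \oo, v i (x + w) = u (x + w).
    have [->|w0] := eqVneq w 0; first by apply: nearW => i; rewrite addr0.
    have [j wj] : exists j, 0 < `|w 0 j|.
      apply/not_existsP => h; move/eqP: w0; apply; apply/rowP => j; rewrite mxE.
      by apply/eqP; rewrite -normr_le0 leNgt; apply/negP; exact: h.
    near=> i; rewrite /v /patch memNset// ball_box// => /(_ j).
    rewrite mxE addrAC subrr add0r ltNge => /negP; apply.
    rewrite /r ler_pdivrMr// mulrC -ler_pdivrMr//.
    near: i; apply: filterS (nbhs_infty_ger (rho / `|w 0 j|)) => i.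
    by rewrite -natr1 => /le_trans; apply; rewrite lerDl.
  near=> i; rewrite /delta vx; congr ((_ + _ - _) / _).
    by near: i; exact: ev.
  by near: i; exact: ev.
- move=> i; have := vu x _ psi Ox (touches_above_ball (r0 i) (subset_trans (brho i) rhoN) tN).
  by rewrite mulrC EFinM lee_pdivrMl.
move=> fi fc; split=> //.
by rewrite /L_op -lee_pdivrMl// -EFinM mulrC.
Unshelve. all: by end_near. Qed.

End classical_viscosity.

(** * Averaging the second-difference inequality *)

Section second_differences.
Context {R : realType} (n : nat).
Let X := n.-tuple (measurableTypeR R).
Let mvec : measurable_row (@vec R n) := @measurable_row_vec R n.

(** The preimage of a null set under [(g, h) |-> (g A, b h)] is null: by Tonelli and the linear
    changes of variables its measure is a finite multiple of that of the set. *)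
Lemma ae_linear_pair (P : 'rV[R]_n -> 'rV[R]_n -> Prop) (A : 'M[R]_n) (b : R) :
  A \in unitmx -> b != 0 ->
  {ae (leb R n \x leb R n)%E, forall p, P (vec p.1) (vec p.2)} ->
  {ae (leb R n \x leb R n)%E, forall p, P (vec p.1 *m A) (b *: vec p.2)}.
Proof.
move=> uA b0 [N [mN N0 PN]].
pose F (g h : 'rV[R]_n) : \bar R := (\1_N (unvec g, unvec h))%:E.
have F0 g h : (0 <= F g h)%E by rewrite lee_fin.
have mF : measurable_row2 F.
  apply/measurable_EFinP; rewrite /F.
  under eq_fun => p do rewrite !vecK -surjective_pairing.
  by apply: measurable_indic.
have mAb : measurable_row (fun p : X * X => vec p.1 *m A).
  by apply: measurable_rowM; exact: measurable_row_vec1.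
have mb : measurable_row (fun p : X * X => b *: vec p.2 : 'rV[R]_n).
  by apply: measurable_rowZ => //; exact: measurable_row_vec2.
pose S : set (X * X) := [set p | N (unvec (vec p.1 *m A), unvec (b *: vec p.2))].
have SF p : (\1_S p)%:E = F (vec p.1 *m A) (b *: vec p.2) by rewrite /F !indicE.
have mS : measurable S.
  have m : measurable_fun setT (fun p : X * X =>
      (unvec (vec p.1 *m A), unvec (b *: vec p.2 : 'rV[R]_n))).
    apply/measurable_fun_pairP; split; first exact: measurable_row_unvec mAb.
    exact: measurable_row_unvec mb.
  by rewrite -[S]setTI; exact: m.
exists S; split => //; last first.
  move=> p /= np; apply: PN => /=; rewrite !unvecK; exact: np.
have IN (M : set (X * X)) : measurable M -> (leb R n \x leb R n)%E M =
    (\int[leb R n]_g \int[leb R n]_h (\1_M (g, h))%:E)%E.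
  move=> mM; rewrite -[M in LHS]setIT -integral_indic//.
  rewrite (fubini_tonelli1 (EFin \o \1_M))//.
    by apply/measurable_EFinP; exact: measurable_indic.
  by move=> p; rewrite lee_fin.
rewrite IN// (_ : (\int[_]_g _)%E =
    (\int[leb R n]_g \int[leb R n]_h F (vec g *m A) (b *: vec h))%E); last first.
  by apply: eq_integral => g _; apply: eq_integral => h _; rewrite SF.
have Fh g : (\int[leb R n]_h F g (b *: vec h) =
    (`|b| ^- n)%:E * \int[leb R n]_h F g (vec h))%E.
  rewrite -(@ge0_integral_leb_affine _ _ b 0 (F g))//.
    by apply: eq_integral => t _; rewrite addr0.
  apply: (measurable_comp_row2 mF) => //; exact: measurable_row_cst.
pose G g := (\int[leb R n]_h F g (vec h))%E.
have G0 g : (0 <= G g)%E by exact: integral_ge0.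
have mG : measurable_fun setT (G \o @vec R n).
  exact: (measurable_fun_fubini_tonelli_F (fun p : X * X => F (vec p.1) (vec p.2))).
have mGA : measurable_fun setT (fun g => G (vec g *m A)).
  by apply: (measurable_comp_row mG); exact: measurable_rowM.
under eq_integral => g _ do rewrite Fh//.
rewrite (@ge0_integralZl _ _ _ _ _ measurableT (fun g => G (vec g *m A)))
  ?lee_fin ?invr_ge0 ?exprn_ge0//.
have [c c0 cP] := ge0_integral_leb_mulmx uA.
rewrite (cP G)//.
rewrite (_ : (\int[leb R n]_t G (vec t))%E = 0%E) ?mule0//.
rewrite -N0 IN//; apply: eq_integral => g _; apply: eq_integral => h _.
by rewrite /F !vecK.
Qed.

(** Here [oo - oo] is dealt with pointwise. If a part on the right of the conclusion is infinite,
    nothing is to be proved; otherwise an infinite part on the left would make the left side of the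
    hypothesis infinite. *)
Lemma second_difference_ge0 (c k : R) (p1 m1 p2 m2 p0 m0 : \bar R) : 0 < c ->
  (0 <= p1 -> 0 <= m1 -> 0 <= p2 -> 0 <= m2 -> 0 <= p0 -> 0 <= m0 ->
  c%:E * (p1 - m1) + c%:E * (p2 - m2) - 2%:E * (c%:E * (p0 - m0)) <= k%:E ->
  c%:E * (p1 + p2 + 2%:E * m0) <= c%:E * (m1 + m2 + 2%:E * p0) + k%:E)%E.
Proof.
move=> c0; have nonneg (x : \bar R) : (0 <= x)%E -> x = +oo%E \/ exists2 r, 0 <= r & x = r%:E.
  by case: x => [r||//]; [rewrite lee_fin; right; exists r|left].
have gt0 : (0 < c%:E)%E by rewrite lte_fin.
have gt2 : (0 < 2%:E :> \bar R)%E by rewrite lte_fin.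
move=> /nonneg P1 /nonneg M1 /nonneg P2 /nonneg M2 /nonneg P0 /nonneg M0.
case: M1 => [->|[m1' _ ->]]; last case: M2 => [->|[m2' _ ->]]; last case: P0 => [->|[p0' _ ->]].
- have Z : (0 <= m2 + 2%:E * p0)%E.
    rewrite adde_ge0//; first by case: M2 => [->//|[r r0 ->]].
    by rewrite mule_ge0//; case: P0 => [->//|[r r0 ->]].
  have {}Z : (m2 + 2%:E * p0)%E != -oo%E by rewrite -ltNye (lt_le_trans (ltNyr 0) Z).
  by move=> _; rewrite -[X in (_ <= _ * X + _)%E]addeA addye// gt0_muley// addye// leey.
- have Z : (0 <= 2%:E * p0)%E by rewrite mule_ge0//; case: P0 => [->//|[r r0 ->]].
  have {}Z : (2%:E * p0)%E != -oo%E by rewrite -ltNye (lt_le_trans (ltNyr 0) Z).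
  by move=> _; rewrite [X in (_ <= _ * (X + _) + _)%E]addey// addye// gt0_muley// addye// leey.
- by move=> _; rewrite [X in (_ <= _ * (_ + X) + _)%E]gt0_muley// addey// gt0_muley// addye// leey.
case: P1 => [->|[p1' _ ->]]; case: P2 => [->|[p2' _ ->]]; case: M0 => [->|[m0' _ ->]];
  rewrite ?addye ?addeNy /= ?gt0_muley ?gt0_muleNy ?oppeNy ?addye ?addey //=.
rewrite -!EFinM !lee_fin; lra.
Qed.

Lemma double_integralE (F : 'rV[R]_n -> 'rV[R]_n -> \bar R) :
  (forall g h, 0 <= F g h)%E -> measurable_row2 F ->
  double_integral F = (\int[(leb R n \x leb R n)%E]_p F (vec p.1) (vec p.2))%E.
Proof.
by move=> F0 mF; rewrite (fubini_tonelli1 (fun p : X * X => F (vec p.1) (vec p.2))).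
Qed.

Let P : R := pi `^ (n%:R / 2).
Let P0 : 0 < P. Proof. by rewrite powR_gt0// pi_gt0. Qed.

(** Serves both sides of the rearranged inequality, with the roles of the positive and negative
    parts exchanged. The signs [b] and [- b] give the same average, since only [b^2] enters the
    law. *)
Lemma gaussian_average (W1 W2 : 'rV[R]_n -> \bar R) (A B : 'M[R]_n) (b c : R) :
  A^T = A -> B^T = B -> B \in unitmx -> A *m B = B *m A -> b != 0 ->
  B *m B = A *m A + (b ^+ 2)%:M -> 0 <= c ->
  measurable_fun setT (W1 \o @vec R n) -> (forall v, 0 <= W1 v)%E ->
  measurable_fun setT (W2 \o @vec R n) -> (forall v, 0 <= W2 v)%E ->
  double_integral (fun g h => (gaussian g * gaussian h)%:E *
     (c%:E * (W1 (g *m A + b *: h)%R + W1 (g *m A - b *: h)%R + 2%:E * W2 (g *m A))))%E =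
  (c%:E * (2%:E * (P%:E * \int[leb R n]_t ((gaussian (vec t))%:E * W1 (vec t *m B)) +
   P%:E * \int[leb R n]_t ((gaussian (vec t))%:E * W2 (vec t *m A)))))%E.
Proof.
move=> At Bt uB AB b0 BB c0 mW1 W10 mW2 W20.
have mgg : measurable_fun setT (fun p : X * X => (gaussian (vec p.1) * gaussian (vec p.2) : R)%:E).
  rewrite (_ : (fun p => _) = (fun p : X * X =>
    ((gaussian (vec p.1))%:E * (gaussian (vec p.2))%:E)%E)); last exact/funext.
  apply: emeasurable_funM; apply: measurable_gaussian_row.
    exact: measurable_row_vec1.
  exact: measurable_row_vec2.
have gg0 g h : (0 <= (gaussian g * gaussian h : R)%:E)%E.
  by rewrite lee_fin mulr_ge0 ?gaussian_ge0.
have mgA : measurable_row (fun p : X * X => vec p.1 *m A).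
  by apply: measurable_rowM; exact: measurable_row_vec1.
have mW1b (e : R) : measurable_fun setT (fun p : X * X => W1 (vec p.1 *m A + e *: vec p.2)%R).
  apply: (measurable_comp_row mW1); apply: measurable_rowD => //.
  by apply: measurable_rowZ => //; exact: measurable_row_vec2.
have mW2A : measurable_fun setT (fun p : X * X => W2 (vec p.1 *m A)).
  exact: (measurable_comp_row mW2).
have D1 (e : R) : e != 0 -> e ^+ 2 = b ^+ 2 ->
    double_integral (fun g h => (gaussian g * gaussian h)%:E * W1 (g *m A + e *: h)%R)%E =
    (P%:E * \int[leb R n]_t ((gaussian (vec t))%:E * W1 (vec t *m B)))%E.
  by move=> e0 eb; apply: double_integral_gaussian => //; rewrite BB eb.
have D2 : double_integral (fun g h => (gaussian g * gaussian h)%:E * W2 (g *m A))%E =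
    (P%:E * \int[leb R n]_t ((gaussian (vec t))%:E * W2 (vec t *m A)))%E.
  rewrite muleC -(integral_gaussian n).
  rewrite -(@double_integralM _ _ (fun g => (gaussian g)%:E * W2 (g *m A))%E
    (fun h => (gaussian h)%:E)).
  - apply: eq_integral => g _; apply: eq_integral => h _.
    by rewrite EFinM [RHS]muleAC.
  - by move=> v; rewrite mule_ge0// lee_fin gaussian_ge0.
  - by move=> v; rewrite lee_fin gaussian_ge0.
  - apply: emeasurable_funM; first exact: measurable_gaussian_row.
    by apply: (measurable_comp_row mW2); exact: measurable_rowM.
  - exact: measurable_gaussian_row.
rewrite double_integralE; last 2 first.
- by move=> g h; rewrite mule_ge0// mule_ge0 ?lee_fin// !adde_ge0// mule_ge0.
- apply: emeasurable_funM => //; apply: measurable_funeM.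
  apply: emeasurable_funD; last exact: measurable_funeM.
  apply: emeasurable_funD; first exact: mW1b.
  by under eq_fun => p do rewrite -scaleNr; exact: mW1b.
have ptw (w a e d : \bar R) : (0 <= a -> 0 <= e -> 0 <= d ->
    w * (c%:E * (a + e + 2%:E * d)) = c%:E * (w * a + w * e + 2%:E * (w * d)))%E.
  move=> a0 e0 d0; rewrite muleCA ge0_muleDr ?adde_ge0 ?mule_ge0//.
  by rewrite [(w * (a + e))%E]ge0_muleDr// [(w * (2%:E * d))%E]muleCA.
under eq_integral => p _ do rewrite ptw// -scaleNr.
have mg1 e : measurable_fun setT (fun p : X * X =>
    (gaussian (vec p.1) * gaussian (vec p.2))%:E * W1 (vec p.1 *m A + e *: vec p.2)%R)%E.
  exact: emeasurable_funM.
have mg2 : measurable_fun setT (fun p : X * X =>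
    (gaussian (vec p.1) * gaussian (vec p.2))%:E * W2 (vec p.1 *m A))%E.
  exact: emeasurable_funM.
rewrite ge0_integralZl//; last 2 first.
- apply: emeasurable_funD; last exact: measurable_funeM.
  exact: emeasurable_funD.
- by move=> p _; rewrite !adde_ge0 ?mule_ge0.
congr (_ * _)%E.
rewrite ge0_integralD//; last 4 first.
- by move=> p _; rewrite adde_ge0 ?mule_ge0.
- exact: emeasurable_funD.
- by move=> p _; rewrite !mule_ge0.
- exact: measurable_funeM.
rewrite ge0_integralD//; last 2 first.
- by move=> p _; rewrite mule_ge0.
- by move=> p _; rewrite mule_ge0.
rewrite ge0_integralZl//; last by move=> p _; rewrite mule_ge0.
have dE1 e : (\int[(leb R n \x leb R n)%E]_p ((gaussian (vec p.1) * gaussian (vec p.2))%:E *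
    W1 (vec p.1 *m A + e *: vec p.2)%R) =
    double_integral (fun g h => (gaussian g * gaussian h)%:E * W1 (g *m A + e *: h)%R))%E.
  by rewrite double_integralE//; [move=> g h; rewrite mule_ge0|exact: mg1].
have dE2 : (\int[(leb R n \x leb R n)%E]_p ((gaussian (vec p.1) * gaussian (vec p.2))%:E *
    W2 (vec p.1 *m A)%R) =
    double_integral (fun g h => (gaussian g * gaussian h)%:E * W2 (g *m A)%R))%E.
  by rewrite double_integralE//; move=> g h; rewrite mule_ge0.
rewrite !dE1 dE2 D1// D1 ?oppr_eq0 ?sqrrN// D2.
have I0 (W : 'rV[R]_n -> \bar R) (C : 'M[R]_n) : (forall v, 0 <= W v)%E ->
    (0 <= P%:E * \int[leb R n]_t ((gaussian (vec t))%:E * W (vec t *m C)))%E.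
  move=> W0; rewrite mule_ge0 ?lee_fin ?(ltW P0)//; apply: integral_ge0 => t _.
  by rewrite mule_ge0 ?lee_fin ?gaussian_ge0.
by rewrite [RHS]ge0_muleDr ?I0//; congr (_ + _)%E; rewrite mule_natl mule2n.
Qed.

(** * Averaging ray integrals of the second difference *)

Section rays.
Variable s : R.
Hypothesis s01 : 0 < s < 1.
Hypothesis n0 : (0 < n)%N.
Let q : R := n%:R + 2 * s.
Let q0 : 0 < q / 2.
Proof. by have /andP[s0 _] := s01; rewrite divr_gt0// ltr_wpDl ?ler0n// mulr_gt0. Qed.
Let s1 : 0 < 1 - s. Proof. by have /andP[_ ?] := s01; rewrite subr_gt0. Qed.
Implicit Types (f : 'rV[R]_n -> R) (A B : 'M[R]_n).

(** The integral in [I_op] with [f] in place of the second difference, to be applied to its positive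
    and negative parts. *)
Definition ray_integral f (y : 'rV[R]_n) : \bar R :=
  (\int[lebesgue_measure]_r (f (r *: y) * radial_weight s r)%:E)%E.

Lemma ray_integral_ge0 f y : (forall v, 0 <= f v) -> (0 <= ray_integral f y)%E.
Proof.
by move=> f0; apply: integral_ge0 => r _; rewrite lee_fin mulr_ge0// radial_weight_ge0.
Qed.

Lemma measurable_ray_integral f : measurable_fun setT (f \o @vec R n) ->
  (forall v, 0 <= f v) -> measurable_fun setT (ray_integral f \o @vec R n).
Proof.
move=> mf f0.
apply: (measurable_fun_fubini_tonelli_F (fun p : X * measurableTypeR R =>
  (f (p.2 *: vec p.1) * radial_weight s p.2)%:E)) => [|p].
  apply/measurable_EFinP; apply: measurable_funM.
    apply: (measurable_comp_row mf); apply: measurable_rowZ => //.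
    exact: measurable_row_vec_comp.
  exact: (measurableT_comp (measurable_radial_weight s)).
by rewrite lee_fin mulr_ge0// radial_weight_ge0.
Qed.

Lemma ray_integral_gaussian f A : measurable_fun setT (f \o @vec R n) ->
  (forall v, 0 <= f v) -> f 0 = 0 ->
  (\int[leb R n]_t ((gaussian (vec t))%:E * ray_integral f (vec t *m A)) =
  gamma_int (q / 2) * \int[leb R n]_t (f (vec t *m A) / enorm (vec t) `^ q)%:E)%E.
Proof.
move=> mf f0 f00.
rewrite -(@ge0_polar_gaussian _ n s s01 (fun v => f (v *m A)))//.
- apply: eq_integral => t _; congr (_ * _)%E; apply: eq_integral => r _.
  by rewrite scalemxAl.
- by apply: (measurable_comp_row mf); exact: measurable_rowM.
- by rewrite mul0mx.
Qed.

Section touched.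
Variables (u : 'rV[R]_n -> R) (x : 'rV[R]_n).
Hypothesis cu : continuous u.

Let up v : R := Num.max (delta u x v) 0.
Let dn v : R := Num.max (- delta u x v) 0.

Let up0 v : 0 <= up v. Proof. by rewrite le_max lexx orbT. Qed.
Let dn0 v : 0 <= dn v. Proof. by rewrite le_max lexx orbT. Qed.

Let mdelta : measurable_fun setT (delta u x \o @vec R n).
Proof.
have mx : measurable_row (fun t : X => x) by exact: measurable_row_cst.
have mu := measurable_continuous_row cu.
apply: measurable_funB => //; apply: measurable_funD.
  by apply: (measurable_comp_row mu); exact: measurable_rowD.
by apply: (measurable_comp_row mu); apply: measurable_rowD => //; exact: measurable_rowN.
Qed.

Let mup : measurable_fun setT (up \o @vec R n).
Proof. exact: measurable_maxr. Qed.
Let mdn : measurable_fun setT (dn \o @vec R n).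
Proof. by apply: measurable_maxr => //; exact: measurableT_comp. Qed.

Let delta00 : delta u x 0 = 0.
Proof. by rewrite /delta addr0 subr0; ring. Qed.

Let up00 : up 0 = 0. Proof. by rewrite /up delta00 maxxx. Qed.
Let dn00 : dn 0 = 0. Proof. by rewrite /dn delta00 oppr0 maxxx. Qed.

Lemma I_op_ray y :
  I_op s u x y = ((1 - s)%:E * (ray_integral up y - ray_integral dn y))%E.
Proof.
rewrite /I_op integralE; congr (_ * (_ - _))%E; apply: eq_integral => r _.
  by rewrite funeposE /up maxr_pMl ?radial_weight_ge0// mul0r -EFin_max.
by rewrite funenegE /dn maxr_pMl ?radial_weight_ge0// mul0r mulNr -EFin_max.
Qed.

Let Jp A := (\int[leb R n]_t (up (vec t *m A) / enorm (vec t) `^ q)%:E)%E.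
Let Jn A := (\int[leb R n]_t (dn (vec t *m A) / enorm (vec t) `^ q)%:E)%E.

Let J_pos_neg A :
  (leb R n).-integrable setT (fun t => (delta u x (vec t *m A) / enorm (vec t) `^ q)%:E) ->
  exists p m, [/\ Jp A = p%:E, Jn A = m%:E &
   (\int[leb R n]_t (delta u x (vec t *m A) / enorm (vec t) `^ q)%:E)%E = (p - m)%:E].
Proof.
move=> i.
have w0 t : 0 <= (enorm (@vec R n t) `^ q)^-1 by rewrite invr_ge0 powR_ge0.
have EP : (\int[leb R n]_t
    (fun t => (delta u x (vec t *m A) / enorm (vec t) `^ q)%:E)^\+ t = Jp A)%E.
  by apply: eq_integral => t _; rewrite funeposE /up maxr_pMl// mul0r -EFin_max.
have EN : (\int[leb R n]_t
    (fun t => (delta u x (vec t *m A) / enorm (vec t) `^ q)%:E)^\- t = Jn A)%E.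
  by apply: eq_integral => t _; rewrite funenegE /dn maxr_pMl// mul0r mulNr -EFin_max.
have := integrable_fin_num measurableT (integrable_funepos measurableT i).
have := integrable_fin_num measurableT (integrable_funeneg measurableT i).
rewrite EP EN => fn fp; exists (fine (Jp A)), (fine (Jn A)); rewrite !fineK//; split=> //.
by rewrite integralE EP EN EFinB !fineK.
Qed.

(** The parts are first compared as averages in [[0, +oo]]. Integrability for [A] and [B] then turns
    every term into a real number, and the parts are reassembled into the two signed integrals. *)
Lemma delta_integral_shift_le (K b : R) A B :
  A^T = A -> B^T = B -> A \in unitmx -> B \in unitmx -> A *m B = B *m A -> 0 < b ->
  B *m B = A *m A + (b ^+ 2)%:M -> 0 < K ->
  {ae (leb R n \x leb R n)%E, forall p, let y := vec p.1 in let z := vec p.2 in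
      (I_op s u x (y + z)%R + I_op s u x (y - z)%R - 2%:E * I_op s u x y
         <= (2 * K * enorm z `^ (2 * s))%:E)%E} ->
  (leb R n).-integrable setT (fun t => (delta u x (vec t *m A) / enorm (vec t) `^ q)%:E) ->
  (leb R n).-integrable setT (fun t => (delta u x (vec t *m B) / enorm (vec t) `^ q)%:E) ->
  (((1 - s) * Gamma_fun (q / 2))%:E *
     (\int[leb R n]_t (delta u x (vec t *m B) / enorm (vec t) `^ q)%:E -
      \int[leb R n]_t (delta u x (vec t *m A) / enorm (vec t) `^ q)%:E) <=
  (K * b `^ (2 * s) * (n%:R / 2) `^ s * P)%:E)%E.
Proof.
move=> At Bt uA uB AB b0 BB K0 sd iA iB.
have [pA [mA [JpA JnA ->]]] := J_pos_neg iA.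
have [pB [mB [JpB JnB ->]]] := J_pos_neg iB.
have bn0 : b != 0 by rewrite gt_eqF.
pose W1 := ray_integral up; pose W2 := ray_integral dn.
have W10 v : (0 <= W1 v)%E by exact: ray_integral_ge0.
have W20 v : (0 <= W2 v)%E by exact: ray_integral_ge0.
have mW1 : measurable_fun setT (W1 \o @vec R n) by exact: measurable_ray_integral.
have mW2 : measurable_fun setT (W2 \o @vec R n) by exact: measurable_ray_integral.
pose w (g h : 'rV[R]_n) : \bar R := (gaussian g * gaussian h)%:E.
pose S (U V : 'rV[R]_n -> \bar R) (g h : 'rV[R]_n) : \bar R :=
  ((1 - s)%:E * (U (g *m A + b *: h)%R + U (g *m A - b *: h)%R + 2%:E * V (g *m A)))%E.
pose e (h : 'rV[R]_n) : R := 2 * K * enorm (b *: h) `^ (2 * s).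
have w0 g h : (0 <= w g h)%E by rewrite lee_fin mulr_ge0 ?gaussian_ge0.
have S0 (U V : 'rV[R]_n -> \bar R) g h : (forall v, 0 <= U v)%E -> (forall v, 0 <= V v)%E ->
    (0 <= S U V g h)%E.
  by move=> U0 V0; rewrite mule_ge0 ?lee_fin ?(ltW s1)// !adde_ge0// mule_ge0.
have e0 h : 0 <= e h by rewrite mulr_ge0 ?powR_ge0// mulr_ge0// ltW.
have mw : measurable_row2 w.
  rewrite /measurable_row2 (_ : (fun p => _) = (fun p : X * X =>
    ((gaussian (vec p.1))%:E * (gaussian (vec p.2))%:E)%E)); last exact/funext.
  apply: emeasurable_funM; apply: measurable_gaussian_row.
    exact: measurable_row_vec1.
  exact: measurable_row_vec2.
have mS (U V : 'rV[R]_n -> \bar R) : measurable_fun setT (U \o @vec R n) ->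
    measurable_fun setT (V \o @vec R n) -> measurable_row2 (S U V).
  move=> mU mV.
  have mgA : measurable_row (fun p : X * X => vec p.1 *m A).
    by apply: measurable_rowM; exact: measurable_row_vec1.
  have mbh : measurable_row (fun p : X * X => b *: vec p.2 : 'rV[R]_n).
    by apply: measurable_rowZ => //; exact: measurable_row_vec2.
  apply: measurable_funeM; apply: emeasurable_funD; last first.
    by apply: measurable_funeM; exact: (measurable_comp_row mV).
  apply: emeasurable_funD; apply: (measurable_comp_row mU); apply: measurable_rowD => //.
  exact: measurable_rowN.
have me : measurable_row2 (fun g h => (e h)%:E).
  apply/measurable_EFinP; apply: measurable_funM => //.
  apply: (measurableT_comp (measurable_powR _)); apply: measurable_enorm_row.
  by apply: measurable_rowZ => //; exact: measurable_row_vec2.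
have main : (double_integral (fun g h => w g h * S W1 W2 g h) <=
    double_integral (fun g h => w g h * S W2 W1 g h + w g h * (e h)%:E))%E.
  rewrite !double_integralE; last 4 first.
  - by move=> g h; rewrite adde_ge0// mule_ge0// ?S0// lee_fin.
  - apply: emeasurable_funD; apply: emeasurable_funM => //; exact: mS.
  - by move=> g h; rewrite mule_ge0// S0.
  - by apply: emeasurable_funM => //; exact: mS.
  apply: ae_ge0_le_integral => //.
  - by move=> p _; rewrite mule_ge0// S0.
  - by apply: emeasurable_funM => //; exact: mS.
  - by move=> p _; rewrite adde_ge0// mule_ge0// ?S0// lee_fin.
  - apply: emeasurable_funD; apply: emeasurable_funM => //; exact: mS.
  have := @ae_linear_pair (fun y z => (I_op s u x (y + z)%R + I_op s u x (y - z)%R -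
    2%:E * I_op s u x y <= (2 * K * enorm z `^ (2 * s))%:E)%E) A b uA bn0 sd.
  apply: filterS => p /=; rewrite !I_op_ray => h _.
  rewrite -ge0_muleDr ?S0 ?lee_fin//; apply: lee_pmul => //; first exact: S0.
  by apply: second_difference_ge0 => //; rewrite -/(e _); exact: h.
have Gk : gamma_int (q / 2) = (Gamma_fun (q / 2))%:E by rewrite Gamma_funE.
have lhs : (double_integral (fun g h => w g h * S W1 W2 g h) =
    ((1 - s) * (2 * (P * (Gamma_fun (q / 2) * pB) + P * (Gamma_fun (q / 2) * mA))))%:E)%E.
  rewrite (@gaussian_average W1 W2 A B b (1 - s)) ?(ltW s1)//.
  rewrite /W1 /W2 !ray_integral_gaussian// -/(Jp B) -/(Jn A) JpB JnA Gk.
  by [].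
have rhs : (double_integral (fun g h => w g h * S W2 W1 g h) =
    ((1 - s) * (2 * (P * (Gamma_fun (q / 2) * mB) + P * (Gamma_fun (q / 2) * pA))))%:E)%E.
  rewrite (@gaussian_average W2 W1 A B b (1 - s)) ?(ltW s1)//.
  rewrite /W1 /W2 !ray_integral_gaussian// -/(Jp A) -/(Jn B) JpA JnB Gk.
  by [].
(* The error depends on [h] only: the [g]-integral gives [P], and the rest is [2 K b^(2 s)] times
   the Gaussian moment of order [2 s]. *)
have err : (double_integral (fun g h => w g h * (e h)%:E) <=
    (P * (2 * K * b `^ (2 * s) * ((n%:R / 2) `^ s * P)))%:E)%E.
  pose m (h : 'rV[R]_n) := ((2 * K * b `^ (2 * s))%:E * (enorm h `^ (2 * s) * gaussian h)%:E)%E.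
  rewrite (_ : double_integral _ = double_integral (fun g h => (gaussian g)%:E * m h)%E).
    have mh : measurable_fun setT
        (fun h : X => (enorm (vec h) `^ (2 * s) * gaussian (vec h) : R)%:E).
      apply/measurable_EFinP; apply: measurable_funM; last exact: measurable_gaussian.
      exact: (measurableT_comp (measurable_powR _) (measurable_enorm_row mvec)).
    have kk : 0 < 2 * K * b `^ (2 * s) by rewrite mulr_gt0 ?powR_gt0// mulr_gt0.
    rewrite (@double_integralM _ _ (fun g => (gaussian g)%:E)).
    - rewrite integral_gaussian ge0_integralZl//.
      + by rewrite !EFinM !lee_pmul2l ?lte_fin//; exact: gaussian_moment_le.
      + by move=> h _; rewrite lee_fin mulr_ge0 ?powR_ge0 ?gaussian_ge0.
      + by rewrite lee_fin ltW.
    - by move=> v; rewrite lee_fin gaussian_ge0.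
    - by move=> v; rewrite mule_ge0 ?lee_fin ?(ltW kk)// mulr_ge0 ?powR_ge0 ?gaussian_ge0.
    - exact: measurable_gaussian_row.
    - exact: measurable_funeM.
  apply: eq_integral => g _; apply: eq_integral => h _.
  rewrite /w /e /m -!EFinM enormZ (gtr0_norm b0) powRM ?enorm_ge0 ?(ltW b0)//.
  by congr EFin; ring.
have : (double_integral (fun g h => w g h * S W2 W1 g h + w g h * (e h)%:E) <=
  ((1 - s) * (2 * (P * (Gamma_fun (q / 2) * mB) + P * (Gamma_fun (q / 2) * pA))))%:E +
  (P * (2 * K * b `^ (2 * s) * ((n%:R / 2) `^ s * P)))%:E)%E.
  rewrite -rhs; apply: le_trans (leeD (lexx _) err).
  have wS0 g h : (0 <= w g h * S W2 W1 g h)%E by rewrite mule_ge0 ?S0.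
  have we0 g h : (0 <= w g h * (e h)%:E)%E.
    by apply: mule_ge0 => //; rewrite lee_fin.
  have mwS : measurable_row2 (fun g h => w g h * S W2 W1 g h)%E.
    by apply: emeasurable_funM => //; exact: mS.
  have mwe : measurable_row2 (fun g h => w g h * (e h)%:E)%E by exact: emeasurable_funM.
  rewrite !double_integralE ?ge0_integralD// => [g h|]; first by rewrite adde_ge0.
  exact: emeasurable_funD.
move/(le_trans main); rewrite lhs -EFinD lee_fin => fin.
rewrite -EFinB -EFinM lee_fin.
(* The [2] comes from the two points [y + z] and [y - z], the [P] from the vector integrated out. *)
rewrite -(@ler_pM2l _ (2 * P)) ?mulr_gt0//.
have := fin; move: (Gamma_fun _) (b `^ _) ((n%:R / 2) `^ s) => G bb nn; lra.
Qed.

End touched.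
End rays.
End second_differences.

(** * The lower bound *)

Section lower_bound.
Context {R : realType} (n : nat).
Implicit Types (u : 'rV[R]_n -> R) (x : 'rV[R]_n) (A B : 'M[R]_n).

Lemma spd_unitmx A : spd A -> A \in unitmx.
Proof.
move=> [_ pA]; rewrite -row_free_unit; apply/row_freeP.
apply/row_freeP/inj_row_free => v vA; apply/eqP/negP => /negP v0.
by have := pA v v0; rewrite vA mul0mx mxE ltxx.
Qed.

Lemma integral_leb_scale (G : 'rV[R]_n -> R) (a : R) : 0 < a ->
  (leb R n).-integrable setT (fun t => (G (vec t))%:E) ->
  (leb R n).-integrable setT (fun t => (G (a *: vec t))%:E) /\
  (\int[leb R n]_t (G (a *: vec t))%:E =
   (a ^- n)%:E * \int[leb R n]_t (G (vec t))%:E)%E.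
Proof.
move=> a0 iG; have /integrableP[mG Goo] := iG.
have sc (F : 'rV[R]_n -> \bar R) : measurable_fun setT (F \o @vec R n) ->
    (forall v, 0 <= F v)%E ->
    (\int[leb R n]_t F (a *: vec t)%R = (a ^- n)%:E * \int[leb R n]_t F (vec t))%E.
  move=> mF F0; rewrite -{2}(gtr0_norm a0) -(@ge0_integral_leb_affine _ _ a 0) ?gt_eqF//.
  by apply: eq_integral => t _; rewrite addr0.
have ia : 0 <= a ^- n by rewrite invr_ge0 exprn_ge0// ltW.
split.
  apply/integrableP; split.
    apply: (@measurable_comp_row _ _ _ _ _ _ (EFin \o G) _ mG); apply: measurable_rowZ => //.
    exact: measurable_row_vec.
  rewrite (sc (fun v => `|(G v)%:E|%E)) ?lte_mul_pinfty ?lee_fin//.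
  exact: measurableT_comp.
rewrite integralE [X in (_ * X)%E]integralE.
have mp := measurable_funepos mG; have mn := measurable_funeneg mG.
have fp := integrable_fin_num measurableT (integrable_funepos measurableT iG).
have fn := integrable_fin_num measurableT (integrable_funeneg measurableT iG).
rewrite muleBr ?fin_num_adde_defl ?fin_numN//; congr (_ - _)%E.
  have E (g : n.-tuple (measurableTypeR R) -> 'rV[R]_n) :
      (\int[leb R n]_t (fun t => (G (g t))%:E)^\+ t =
       \int[leb R n]_t (fun v => maxe (G v)%:E 0) (g t))%E.
    by apply: eq_integral => t _; rewrite funeposE.
  rewrite (E (fun t => a *: vec t)) (E (@vec R n)) (sc (fun v => maxe (G v)%:E 0)%E)// => [|v].
    by move: mp; congr measurable_fun; apply/funext => t; rewrite funeposE.
  by rewrite le_max lexx orbT.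
have E (g : n.-tuple (measurableTypeR R) -> 'rV[R]_n) :
    (\int[leb R n]_t (fun t => (G (g t))%:E)^\- t =
     \int[leb R n]_t (fun v => maxe (- (G v)%:E) 0) (g t))%E.
  by apply: eq_integral => t _; rewrite funenegE.
rewrite (E (fun t => a *: vec t)) (E (@vec R n)) (sc (fun v => maxe (- (G v)%:E) 0)%E)// => [|v].
  by move: mn; congr measurable_fun; apply/funext => t; rewrite funenegE.
by rewrite le_max lexx orbT.
Qed.

(** Dilating [t] by [c^-1] produces [c^n] from the volume and [c^-q] from the kernel, together
    [c^(-2 s)]. Integrability passes from [c B], the matrix that lies in [A2], to [B]. *)
Lemma L_op_scale (s c : R) B u x : 0 < c ->
  (leb R n).-integrable setT (fun t =>
    (delta u x (vec t *m (c *: B)^T) / enorm (vec t) `^ (n%:R + 2 * s))%:E) ->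
  (leb R n).-integrable setT (fun t =>
    (delta u x (vec t *m B^T) / enorm (vec t) `^ (n%:R + 2 * s))%:E) /\
  L_op s B u x = ((c `^ (2 * s))^-1%:E * L_op s (c *: B) u x)%E.
Proof.
move=> c0 iC; set q := n%:R + 2 * s.
pose F v := delta u x (v *m (c *: B)^T) / enorm v `^ q.
have ci : 0 < c^-1 by rewrite invr_gt0.
have FE t : delta u x (vec t *m B^T) / enorm (vec t) `^ q = (c `^ q)^-1 * F (c^-1 *: vec t).
  rewrite /F linearZ /= -scalemxAl scalemxAr scalerA mulVf ?gt_eqF// scale1r.
  rewrite enormZ (gtr0_norm ci) powRM ?enorm_ge0 ?(ltW ci)//.
  rewrite -(powR_inv1 (ltW c0)) -powRrM mulN1r powRN invfM invrK mulrCA mulKf//.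
  by rewrite gt_eqF// powR_gt0.
have [iF EF] := @integral_leb_scale F c^-1 ci iC.
split.
  under eq_fun => t do rewrite FE EFinM.
  exact: integrableZl.
rewrite /L_op; under eq_integral => t _ do rewrite FE EFinM.
rewrite (integralZl measurableT iF) EF.
rewrite -[X in _ = (_ * (_ * X))%E]/(\int[leb R n]_t (F (vec t))%:E)%E.
move: (\int[leb R n]_t _)%E => J; rewrite !muleA; congr (_ * _)%E.
have cq : c `^ q = c ^+ n * c `^ (2 * s).
  by rewrite /q powRD ?(gt_eqF c0) ?implybT// powR_mulrn// ltW.
rewrite -!EFinM cq exprVn invrK; congr EFin; field.
by rewrite !gt_eqF ?powR_gt0 ?exprn_gt0.
Qed.

(* The maximum over [t] is attained at [t ^ (s / 2) = a / (2 b)]. *)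
Lemma ge_of_quadratic_bounds (s sg a b l : R) : 0 < s -> 0 < sg -> 0 < a -> 0 < b ->
  (forall t, 0 < t -> a * (t * sg) `^ (s / 2) <= l + b * t `^ s) ->
  a ^+ 2 * sg `^ s / (4 * b) <= l.
Proof.
move=> s0 sg0 a0 b0 H.
pose y := a * sg `^ (s / 2) / (2 * b).
have y0 : 0 < y by rewrite divr_gt0 ?mulr_gt0 ?powR_gt0.
have := H (y `^ (2 / s)) (powR_gt0 _ y0).
rewrite powRM ?powR_ge0 ?(ltW sg0)// -!powRrM.
rewrite (_ : 2 / s * (s / 2) = 1); last by field; rewrite ?gt_eqF.
rewrite (_ : 2 / s * s = 2%:R); last by rewrite -mulrA mulVf ?mulr1 ?gt_eqF.
rewrite powRr1 ?(ltW y0)// powR_mulrn ?(ltW y0)//.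
have -> : sg `^ s = (sg `^ (s / 2)) ^+ 2.
  by rewrite -powR_mulrn ?powR_ge0// -powRrM; congr (_ `^ _); field.
move: y0; rewrite /y; move: (sg `^ _) => w y0.
suff -> : a ^+ 2 * w ^+ 2 / (4 * b) = a * (a * w / (2 * b) * w) - b * (a * w / (2 * b)) ^+ 2 by lra.
by field; rewrite gt_eqF.
Qed.

Lemma frob_gt0 A : (0 < n)%N -> A^T = A -> A \in unitmx -> 0 < frob A.
Proof.
move=> n0 At uA; rewrite sqrtr_gt0 lt_def -[X in A *m X]At.
have trE : \tr (A *m A^T) = \sum_i \sum_j A i j ^+ 2.
  by apply: eq_bigr => i _; rewrite mxE; apply: eq_bigr => j _; rewrite mxE expr2.
have sq0 i : 0 <= \sum_j A i j ^+ 2 by apply: sumr_ge0 => j _; exact: sqr_ge0.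
rewrite trE sumr_ge0 ?andbT//.
apply: contraL uA; rewrite psumr_eq0// => /allP A0.
suff -> : A = 0 by rewrite -row_free_unit /row_free mxrank0 eq_sym -lt0n.
apply/matrixP => i j; have := A0 i (mem_index_enum _).
rewrite psumr_eq0 => [|k _]; last exact: sqr_ge0.
by move=> /allP /(_ j (mem_index_enum _)); rewrite sqrf_eq0 mxE => /eqP.
Qed.

(** For every [t > 0] one gets [eta0 (t sg)^(s/2) <= L_A u(x) + b t^s] with
    [sg = |A|_F^2 / (n - 1)], where [b] is the factor multiplying [4] in the denominator. The terms
    [Gamma((n + 2 s)/2)] and [pi^(n/2)] of [C_ns] cancel against the Gaussian average, so only
    [Gamma(1 - s)] survives. *)
Lemma L_op_ge (s K eta0 : R) (Omega : set 'rV[R]_n) u x A :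
  (3 <= n)%N -> 0 < s < 1 -> 0 < K -> 0 < eta0 -> continuous u -> L1_omega s u ->
  visc_ge (K_op s) Omega u eta0 -> second_difference_bound s K Omega u ->
  Omega x -> touchable_above Omega u x -> A2 A ->
  ((eta0 ^+ 2 * (frob A ^+ 2 / (n%:R - 1)) `^ s /
     (4 * (K * s * (2 * n%:R) `^ s / (2 * ((1 - s) * Gamma_fun (1 - s))))))%:E
    <= L_op s A u x)%E.
Proof.
move=> n3 s01 K0 eta00 cu Lu vu sdu Ox tx A2A.
have /andP[s0 s1] := s01; have s1' : 0 < 1 - s by rewrite subr_gt0.
have n0 : (0 < n)%N by case: (n) n3.
have n0R : 0 < n%:R :> R by rewrite ltr0n.
have n1R : 0 < n%:R - 1 :> R by rewrite subr_gt0 ltr1n (leq_trans _ n3).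
have q0 : 0 < (n%:R + 2 * s) / 2 :> R by rewrite divr_gt0// addr_gt0// mulr_gt0.
have G1 := Gamma_fun_gt0 q0; have G2 := Gamma_fun_gt0 s1'.
have P0 : 0 < pi `^ (n%:R / 2) :> R by rewrite powR_gt0// pi_gt0.
have cls B : A2 B -> (leb R n).-integrable setT (fun t =>
      (delta u x (vec t *m B^T) / enorm (vec t) `^ (n%:R + 2 * s))%:E) /\
    (eta0%:E <= L_op s B u x)%E.
  move=> A2B; apply: (visc_ge_classical s01 n0) Ox tx => //.
    by apply: spd_unitmx; case: A2B.
  move=> y N psi Oy ty; apply: le_trans (vu y N psi Oy ty) _.
  by apply: ereal_inf_lbound; exists B.
have [iA _] := cls A A2A.
have [[At _] _] := A2A; have uA : A \in unitmx by apply: spd_unitmx; case: A2A.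
have sg0 : 0 < frob A ^+ 2 / (n%:R - 1).
  by rewrite divr_gt0// exprn_gt0// frob_gt0.
have CE : C_ns n s = 4 `^ s * s * Gamma_fun ((n%:R + 2 * s) / 2) /
  (pi `^ (n%:R / 2) * Gamma_fun (1 - s)) by [].
have JE C : C^T = C -> (leb R n).-integrable setT (fun t =>
      (delta u x (vec t *m C^T) / enorm (vec t) `^ (n%:R + 2 * s))%:E) ->
    (\int[leb R n]_t (delta u x (vec t *m C) / enorm (vec t) `^ (n%:R + 2 * s))%:E =
     (fine (\int[leb R n]_t (delta u x (vec t *m C^T) /
       enorm (vec t) `^ (n%:R + 2 * s))%:E))%:E)%E.
  by move=> Ct iC; rewrite (fineK (integrable_fin_num measurableT iC)) Ct.
have fA := integrable_fin_num measurableT iA.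
rewrite /L_op -(fineK fA) -EFinM lee_fin.
apply: ge_of_quadratic_bounds => // [|t t0].
  by rewrite divr_gt0 ?mulr_gt0 ?powR_gt0 ?mulr_gt0.
have [B [c [[Bt uB AB BB] [c0 A2cB tc]]]] := A2_sqrt_shift n3 A2A t0.
have [icB LcB] := cls _ A2cB.
have [iB LB] := L_op_scale c0 icB.
have fB := integrable_fin_num measurableT iB.
have tq : 0 < Num.sqrt t by rewrite sqrtr_gt0.
have BB' : B *m B = A *m A + (Num.sqrt t ^+ 2)%:M by rewrite sqr_sqrtr ?(ltW t0).
have := @delta_integral_shift_le _ n s s01 n0 u x cu K _ A B At Bt uA uB AB tq BB' K0 (sdu x Ox tx).
have iA' := iA; have iB' := iB; rewrite At in iA'; rewrite Bt in iB'; move=> /(_ iA' iB').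
set JA := fine _; pose JB := fine (\int[leb R n]_t
  (delta u x (vec t *m B^T) / enorm (vec t) `^ (n%:R + 2 * s))%:E)%E.
rewrite (JE A)// (JE B)// -/JA -/JB -EFinB -EFinM lee_fin => shift.
have LBge : eta0 * (c `^ (2 * s))^-1 <= C_ns n s / 2 * JB.
  rewrite -lee_fin EFinM [leRHS]EFinM fineK//.
  rewrite -[leRHS]/(L_op s B u x) LB muleC lee_pmul2l// lte_fin invr_gt0 powR_gt0//.
(* Written as [(c^-4)^(s/2)], the scaling factor is bounded below by the gain in [sigma2]. *)
have cs : (t * (frob A ^+ 2 / (n%:R - 1))) `^ (s / 2) <= (c `^ (2 * s))^-1.
  rewrite (_ : (c `^ (2 * s))^-1 = (c ^- 4) `^ (s / 2)).
    apply: ge0_ler_powR; rewrite ?nnegrE.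
    - by rewrite divr_ge0// ltW.
    - exact: ltW (mulr_gt0 t0 sg0).
    - by rewrite invr_ge0 exprn_ge0// ltW.
    - by rewrite mulrA.
  have c4 : c ^- 4 = c `^ (- 4%:R) by rewrite powRN powR_mulrn// ltW.
  by rewrite c4 -powRrM -powRN; congr (_ `^ _); field.
apply: (le_trans (ler_wpM2l (ltW eta00) cs)); apply: (le_trans LBge).
rewrite -lerBlDl -mulrBr CE.
have : Num.sqrt t `^ (2 * s) = t `^ s.
  by rewrite -[in RHS](sqr_sqrtr (ltW t0)) -powR_mulrn ?sqrtr_ge0// -powRrM.
move: shift => /[swap] ->.
(* The factor [4^s] belongs to [C_ns], and [(n/2)^s] to the Gaussian moment. *)
have -> : (2 * n%:R) `^ s = 4 `^ s * (n%:R / 2) `^ s :> R.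
  by rewrite -powRM ?divr_ge0//; congr (_ `^ _); field.
move: (Gamma_fun _) G1 (Gamma_fun _) G2 (pi `^ _) P0 => g1 G1 g2 G2 P P0.
move: (t `^ s) ((n%:R / 2) `^ s) => ts ns shift.
have f40 : 0 < 4 `^ s :> R by rewrite powR_gt0.
move: (4 `^ s) f40 => f4 f40.
have -> : K * s * (f4 * ns) / (2 * ((1 - s) * g2)) * ts =
    f4 * s / (2 * (1 - s) * g2 * P) * (K * ts * ns * P).
  by field; rewrite !gt_eqF.
have -> : f4 * s * g1 / (P * g2) / 2 * (JB - JA) =
    f4 * s / (2 * (1 - s) * g2 * P) * ((1 - s) * g1 * (JB - JA)).
  by field; rewrite !gt_eqF.
apply: ler_wpM2l => //.
by rewrite divr_ge0 ?mulr_ge0 ?(ltW s0) ?(ltW f40) ?(ltW s1') ?(ltW G2) ?(ltW P0).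
Qed.

End lower_bound.

(* The factor [expR (- 10^-1) * 10^-1 `^ (1 - s)] bounds [(1 - s) Gamma(1 - s)]
   from below; at [s = 1] it exceeds [sqrt 3 / 2]. *)
Definition gamma_low {R : realType} (n : nat) (s K eta0 : R) : R :=
  eta0 ^+ 2 * (expR (- 10^-1) * 10^-1 `^ (1 - s)) /
  (2 * K * s * (2 * n%:R * (n%:R - 1)) `^ s).

Definition gamma_nonlocal {R : realType} (n : nat) (s K eta0 : R) : R :=
  Num.min (gamma_loc n K eta0) (gamma_low n s K eta0).

(** * The explicit constant and its limit as [s] tends to 1 *)

Section constants.
Context {R : realType} (n : nat) (K eta0 : R).
Hypotheses (n3 : (3 <= n)%N) (K0 : 0 < K) (eta00 : 0 < eta0).

Let n0R : 0 < n%:R :> R. Proof. by rewrite ltr0n (leq_trans _ n3). Qed.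
Let n1R : 0 < n%:R - 1 :> R. Proof. by rewrite subr_gt0 ltr1n (leq_trans _ n3). Qed.

Lemma gamma_loc_gt0 : 0 < gamma_loc n K eta0.
Proof. by rewrite /gamma_loc divr_gt0 ?mulr_gt0 ?sqrtr_gt0 ?exprn_gt0. Qed.

Lemma gamma_low_gt0 (s : R) : 0 < s -> 0 < gamma_low n s K eta0.
Proof.
move=> s0; rewrite /gamma_low divr_gt0//.
  by apply: mulr_gt0; rewrite ?exprn_gt0//; apply: mulr_gt0; rewrite ?expR_gt0 ?powR_gt0.
by apply: mulr_gt0; [rewrite !mulr_gt0|rewrite powR_gt0 ?mulr_gt0].
Qed.

(** The bound [gamma_int_ge] with cutoff [1/10] replaces [(1 - s) Gamma(1 - s)] by an explicit
    function continuous at [s = 1]. *)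
Lemma gamma_low_le (s f : R) : 0 < s < 1 -> 0 <= f ->
  gamma_low n s K eta0 * f `^ (2 * s) <=
  eta0 ^+ 2 * (f ^+ 2 / (n%:R - 1)) `^ s /
     (4 * (K * s * (2 * n%:R) `^ s / (2 * ((1 - s) * Gamma_fun (1 - s))))).
Proof.
move=> /andP[s0 s1] f0; have s1' : 0 < 1 - s by rewrite subr_gt0.
have G0 := Gamma_fun_gt0 s1'.
have := @gamma_int_ge R (1 - s) 10^-1 s1' ltac:(by []).
rewrite -Gamma_funE// lee_fin ler_pdivrMr// [leRHS]mulrC.
have -> : (f ^+ 2 / (n%:R - 1)) `^ s = f `^ (2 * s) * ((n%:R - 1) `^ s)^-1.
  rewrite powRM ?sqr_ge0 ?invr_ge0 ?(ltW n1R)// -powR_mulrn// -powRrM.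
  by rewrite -(powR_inv1 (ltW n1R)) -powRrM mulN1r powRN.
have nn0 : 0 <= 2 * n%:R :> R by rewrite mulr_ge0 ?(ltW n0R).
rewrite /gamma_low (powRM _ nn0 (ltW n1R)).
have := powR_gt0 s n1R; have n20 : 0 < 2 * n%:R :> R by rewrite mulr_gt0.
have := powR_gt0 s n20; have := powR_ge0 f (2 * s).
move: (f `^ _) ((2 * n%:R) `^ s) ((n%:R - 1) `^ s) (Gamma_fun _) G0 (expR _ * _) =>
  F a b g g0 e F0 a0 b0 eg.
have -> : eta0 ^+ 2 * (F * b^-1) / (4 * (K * s * a / (2 * ((1 - s) * g)))) =
   eta0 ^+ 2 * F / (2 * K * s * (a * b)) * ((1 - s) * g).
  by field; rewrite !gt_eqF.
rewrite (_ : _ / _ * F = eta0 ^+ 2 * F / (2 * K * s * (a * b)) * e); last by ring.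
apply: ler_wpM2l => //; apply: divr_ge0; first by rewrite mulr_ge0 ?sqr_ge0.
by rewrite ltW ?mulr_gt0.
Qed.

Lemma gamma_loc_lt : gamma_loc n K eta0 < gamma_low n 1 K eta0.
Proof.
rewrite /gamma_loc /gamma_low subrr powRr0 mulr1 mulr1 powRr1; last first.
  by rewrite ltW ?mulr_gt0.
have -> : Num.sqrt 3 * eta0 ^+ 2 / (8 * n%:R * (n%:R - 1) * K) =
    eta0 ^+ 2 / (4 * n%:R * (n%:R - 1) * K) * (Num.sqrt 3 / 2).
  by field; rewrite !gt_eqF.
have -> : eta0 ^+ 2 * expR (- 10^-1) / (2 * K * (2 * n%:R * (n%:R - 1))) =
    eta0 ^+ 2 / (4 * n%:R * (n%:R - 1) * K) * expR (- 10^-1).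
  by field; rewrite !gt_eqF.
rewrite ltr_pM2l; last by rewrite divr_gt0 ?exprn_gt0 ?mulr_gt0.
(* The comparison is [sqrt 3 / 2 < 9/10 <= exp (- 1/10)]. *)
apply: lt_le_trans (expR_ge1Dx _).
have : Num.sqrt 3 < 9 / 5 :> R.
  rewrite -(@ltr_pXn2r _ 2) ?nnegrE ?sqrtr_ge0// sqr_sqrtr//.
  by rewrite expr2; lra.
lra.
Qed.

Lemma gamma_low_cvg : gamma_low n s K eta0 @[s --> (1 : R)] --> gamma_low n 1 K eta0.
Proof.
have cp (a : R) (f : R -> R) : 0 < a -> {for 1, continuous f} ->
    {for 1, continuous (fun s => a `^ f s)}.
  move=> a0 cf; rewrite (_ : (fun s => _) = (fun s => expR (f s * ln a))).
    apply: (@continuous_comp _ _ _ (fun s => f s * ln a) expR); last exact: continuous_expR.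
    exact: cvgMr_tmp.
  by apply/funext => s; rewrite /powR gt_eqF.
have a0 : 0 < 2 * n%:R * (n%:R - 1) :> R by rewrite !mulr_gt0.
apply: cvgM.
  apply: cvgMl_tmp; apply: cvgMl_tmp.
  apply: (cp 10^-1 (fun s => 1 - s)) => //.
  apply: cvgB; [exact: cvg_cst|exact: cvg_id].
apply: cvgV; first by rewrite gt_eqF ?mulr_gt0 ?powR_gt0.
apply: cvgM; last exact: (cp _ id a0 (@cvg_id _ _)).
by apply: cvgMl_tmp; exact: cvg_id.
Qed.

(** By the strict inequality at [s = 1], the minimum equals [gamma_loc] for all [s] close enough to
    [1], so the limit is that of an eventually constant function. *)
Lemma gamma_nonlocal_cvg :
  gamma_nonlocal n s K eta0 @[s --> 1^'-] --> gamma_loc n K eta0.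
Proof.
apply: cvg_near_cst.
apply: filterS (cvgr_gt _ (cvg_at_left_filter gamma_low_cvg) _ gamma_loc_lt) => s ls.
by apply/min_idPl/ltW.
Qed.

End constants.

Theorem theorem6p1 (R : realType) :
  exists gamma0 : nat -> R -> R -> R -> R,
  forall (n : nat) (K eta0 : R), (3 <= n)%N -> 0 < K -> 0 < eta0 ->
    (forall s : R, 0 < s < 1 ->
      0 < gamma0 n s K eta0 /\
      forall (Omega : set 'rV[R]_n) (u : 'rV[R]_n -> R),
        domain Omega ->
        continuous u ->
        L1_omega s u ->
        visc_ge (K_op s) Omega u eta0 ->
        second_difference_bound s K Omega u ->
        forall A : 'M[R]_n, A2 A ->
          visc_ge (L_op s A) Omega u
            (gamma0 n s K eta0 * frob A `^ (2 * s))) /\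
    gamma0 n s K eta0 @[s --> 1^'-] --> gamma_loc n K eta0.
Proof.
exists (@gamma_nonlocal R) => n K eta0 n3 K0 eta00; split; last exact: gamma_nonlocal_cvg.
move=> s s01; have /andP[s0 _] := s01; split.
  by rewrite lt_min gamma_loc_gt0// gamma_low_gt0.
move=> Omega u _ cu Lu vu sdu A A2A x N psi Ox tx.
apply: le_trans (L_op_patch_ge s01 A cu tx).
apply: le_trans (L_op_ge n3 s01 K0 eta00 cu Lu vu sdu Ox _ A2A); last by exists N, psi.
rewrite lee_fin; apply: le_trans (gamma_low_le eta0 n3 K0 s01 (sqrtr_ge0 _)).
by rewrite ler_wpM2r ?powR_ge0// ge_min lexx orbT.
Qed.
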